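(* Let $K$ be a field of characteristic $0$, $G$ the split simply connected simple group of type $\mathrm{E}_6$ over $K$, $V=V_{\omega_1}$ its $27$-dimensional irreducible representation, and $E$ a $3$-dimensional $K$-vector space. Let $\mathcal{R}_3\subset V\times G/P_4$ be the rank $3$ tautological subbundle over $G/P_4$, and let $Y\subset\operatorname{Hom}(E,V)$ be the image of the total space of $\operatorname{Hom}(E,\mathcal{R}_3)\subset\operatorname{Hom}(E,V)\times G/P_4$ under projection to $\operatorname{Hom}(E,V)$. Then the defining ideal of $Y$ in $K[\operatorname{Hom}(E,V)]$ is generated by quadrics.
   Context: Bourbaki numbering of the $\mathrm{E}_6$ Dynkin diagram (chain $1-3-4-5-6$ with node $2$ attached to $4$). $P_i$ is the maximal parabolic subgroup stabilizing the highest weight line in the irreducible $G$-module $V_{\omega_i}$. The fiber of $\mathcal{R}_3$ at the base point of $G/P_4$ is the $3$-dimensional $P_4$-stable subspace of $V$ generated, under the Levi subgroup of $P_4$, by a highest weight vector of $V$. $Y$ has its reduced structure. *)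

(* Defs.v *)
From HB Require Import structures.
From mathcomp Require Import all_boot all_order all_algebra.
From mathcomp Require Import mpoly.

Set Implicit Arguments.
Unset Strict Implicit.
Unset Printing Implicit Defensive.

Import GRing.Theory.
Local Open Scope ring_scope.

(* The ordinal i : 'I_6 stands for the node i.+1 of the Bourbaki labelling. *)
Definition e6_edges : seq (nat * nat) :=
  [:: (1, 3); (3, 4); (4, 5); (5, 6); (2, 4)]%N.

Definition e6_adj (i j : 'I_6) : bool :=
  ((i.+1, j.+1) \in e6_edges) || ((j.+1, i.+1) \in e6_edges).

Definition e6_cartan (i j : 'I_6) : int :=
  if i == j then 2 else if e6_adj i j then -1 else 0.

Definition node1 : 'I_6 := inord 0.
Definition node4 : 'I_6 := inord 3.

Definition fund_weight (k : 'I_6) : 'I_6 -> int := fun i => (i == k)%:R.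

(* The operators by which the Chevalley generators act on F^n (columns). *)
Record chev_ops (F : fieldType) (n : nat) := ChevOps {
  ce : 'I_6 -> 'M[F]_n;
  cf : 'I_6 -> 'M[F]_n;
  ch : 'I_6 -> 'M[F]_n }.

Definition base_change (F L : fieldType) (iota : {rmorphism F -> L}) (n : nat)
    (rho : chev_ops F n) : chev_ops L n :=
  ChevOps (fun i => map_mx iota (ce rho i))
          (fun i => map_mx iota (cf rho i))
          (fun i => map_mx iota (ch rho i)).

Definition bracket (F : fieldType) (n : nat) (x y : 'M[F]_n) : 'M[F]_n :=
  x *m y - y *m x.

(* The Chevalley-Serre relations: by Serre's theorem, in characteristic 0 such
   operators are the same thing as a representation of the split simple Lie
   algebra of type E_6. *)
Definition e6_rep (F : fieldType) (n : nat) (rho : chev_ops F n) : Prop :=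
  forall i j : 'I_6,
    [/\ bracket (ch rho i) (ch rho j) = 0,
        bracket (ce rho i) (cf rho j) = (if i == j then ch rho i else 0),
        bracket (ch rho i) (ce rho j) = (e6_cartan i j)%:~R *: ce rho j,
        bracket (ch rho i) (cf rho j) = - ((e6_cartan i j)%:~R *: cf rho j)
      & i != j ->
          iter `|1 - e6_cartan i j|%N (bracket (ce rho i)) (ce rho j) = 0 /\
          iter `|1 - e6_cartan i j|%N (bracket (cf rho i)) (cf rho j) = 0].

Definition irreducible_ops (F : fieldType) (n : nat) (rho : chev_ops F n) :
    Prop :=
  (0 < n)%N /\
  forall U : {vspace 'cV[F]_n},
    (forall (i : 'I_6) (u : 'cV[F]_n), u \in U ->
       [/\ ce rho i *m u \in U, cf rho i *m u \in U & ch rho i *m u \in U]) ->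
    U = 0%VS \/ U = fullv.

Definition highest_weight_vector (F : fieldType) (n : nat) (rho : chev_ops F n)
    (lambda : 'I_6 -> int) (v : 'cV[F]_n) : Prop :=
  v != 0 /\
  forall i : 'I_6, ce rho i *m v = 0 /\ ch rho i *m v = (lambda i)%:~R *: v.

Definition irrep_of_highest_weight (F : fieldType) (n : nat)
    (rho : chev_ops F n) (lambda : 'I_6 -> int) (v : 'cV[F]_n) : Prop :=
  [/\ e6_rep rho, irreducible_ops rho & highest_weight_vector rho lambda v].

(* exp(t x); in an e6_rep over a field of characteristic 0 the ce i and cf i
   are nilpotent n x n matrices, so the exponential series stops before x^n. *)
Definition expmx (F : fieldType) (n : nat) (t : F) (x : 'M[F]_n) : 'M[F]_n :=
  \sum_(k < n) (t ^+ k / (k`!)%:R) *: x ^+ k.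

(* Products of elements of S. The sets S used below are closed under inverses,
   so that this is the subgroup generated by S. *)
Inductive generated (R : pzRingType) (S : R -> Prop) : R -> Prop :=
  | gen_one : generated S 1
  | gen_mul (x g : R) : S x -> generated S g -> generated S (x * g).

(* Chevalley's construction of the split group of type E_6, by its points over
   a field F of characteristic 0. A point is recorded by the pair (g.1, g.2) of
   its actions on two representations rho and tau. For rho = V_{omega_1}, whose
   weights span the weight lattice, the group is the simply connected one and
   acts faithfully through g.1. *)
Section ChevalleyGroup.
Variables (F : fieldType) (n m : nat).
Variables (rho : chev_ops F n) (tau : chev_ops F m).

Definition x_pos (i : 'I_6) (t : F) : 'M[F]_n * 'M[F]_m :=
  (expmx t (ce rho i), expmx t (ce tau i)).

Definition x_neg (i : 'I_6) (t : F) : 'M[F]_n * 'M[F]_m :=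
  (expmx t (cf rho i), expmx t (cf tau i)).

(* The simple root subgroups and their opposites generate all root subgroups. *)
Definition e6_group : 'M[F]_n * 'M[F]_m -> Prop :=
  generated (fun g => exists (i : 'I_6) (t : F), g = x_pos i t \/ g = x_neg i t).

Definition weyl_elt (i : 'I_6) (t : F) : 'M[F]_n * 'M[F]_m :=
  x_pos i t * x_neg i (- t^-1) * x_pos i t.

(* The value at t of the i-th simple coroot, as a cocharacter of the torus. *)
Definition coroot_elt (i : 'I_6) (t : F) : 'M[F]_n * 'M[F]_m :=
  weyl_elt i t * weyl_elt i (-1).

(* The standard Levi subgroup of P_k: it is generated by the maximal torus and
   by the root subgroups of the simple roots other than alpha_k and of their
   opposites. *)
Definition levi (k : 'I_6) : 'M[F]_n * 'M[F]_m -> Prop :=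
  generated (fun g =>
    (exists (i : 'I_6) (t : F), t != 0 /\ g = coroot_elt i t) \/
    (exists (i : 'I_6) (t : F), i != k /\ (g = x_pos i t \/ g = x_neg i t))).

(* The stabilizer of the line spanned by w in the second representation. *)
Definition line_stabilizer (w : 'cV[F]_m) (g : 'M[F]_n * 'M[F]_m) : Prop :=
  e6_group g /\ exists c : F, c != 0 /\ g.2 *m w = c *: w.

Definition is_left_coset (P C : 'M[F]_n * 'M[F]_m -> Prop)
    (g : 'M[F]_n * 'M[F]_m) : Prop :=
  forall x, C x <-> exists p, P p /\ x = g * p.

(* The linear span of the orbit of v under the Levi subgroup of P_k. *)
Definition levi_span (k : 'I_6) (v : 'cV[F]_n) (u : 'cV[F]_n) : Prop :=
  forall U : {vspace 'cV[F]_n},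
    (forall l, levi k l -> l.1 *m v \in U) -> u \in U.

(* The total space of Hom(E, R_3), with E = F^3, rho = V_{omega_1} with highest
   weight vector v and tau = V_{omega_4} with highest weight vector w. The
   second component C is a point of G/P_4; the fibre of R_3 at C = g P_4 is the
   translate by g of the fibre at the base point. *)
Definition hom_taut (v : 'cV[F]_n) (w : 'cV[F]_m)
    (phi : 'M[F]_(n, 3)) (C : 'M[F]_n * 'M[F]_m -> Prop) : Prop :=
  exists g, [/\ e6_group g, is_left_coset (line_stabilizer w) C g
    & forall a : 'cV[F]_3, exists u : 'cV[F]_n,
        levi_span node4 v u /\ phi *m a = g.1 *m u].

Definition Y_points (v : 'cV[F]_n) (w : 'cV[F]_m) (phi : 'M[F]_(n, 3)) : Prop :=
  exists C, hom_taut v w phi C.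

End ChevalleyGroup.


(* Evaluation at phi : E -> V, the coordinate phi i j of Hom(E, V) being the
   variable of index mxvec_index i j. *)
Definition eval_hom (K L : fieldType) (iota : {rmorphism K -> L}) (n : nat)
    (phi : 'M[L]_(n, 3)) (p : {mpoly K[n * 3]}) : L :=
  mmap iota (fun k => mxvec phi 0 k) p.

(* The ideal of Y with its reduced structure: the polynomials over K vanishing
   at all points of Y, that is at its points over all field extensions L. *)
Definition ideal_Y (K : fieldType) (n m : nat)
    (rho : chev_ops K n) (tau : chev_ops K m) (v : 'cV[K]_n) (w : 'cV[K]_m)
    (p : {mpoly K[n * 3]}) : Prop :=
  forall (L : fieldType) (iota : {rmorphism K -> L}) (phi : 'M[L]_(n, 3)),
    Y_points (base_change iota rho) (base_change iota tau)
      (map_mx iota v) (map_mx iota w) phi ->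
    eval_hom iota phi p = 0.

Definition generated_by_quadrics (K : fieldType) (N : nat)
    (I : {mpoly K[N]} -> Prop) : Prop :=
  exists qs : seq {mpoly K[N]},
    all (fun q => q \is 2.-homog) qs /\
    forall p, I p <-> exists c : 'I_(size qs) -> {mpoly K[N]},
                        p = \sum_(i < size qs) c i * qs`_i.

(* Main.v *)
(* Let [J] be the ideal of [Y] and [I] the ideal of the polarised partial
   derivatives of the invariant cubic of [V]; these are quadrics, they lie in
   [J], and both ideals are stable under gl(E) x e_6.  By complete reducibility
   it suffices to see that a highest weight vector [q] of [J] lies in [I].
   Modulo the quadrics the split Casimir operator of e_6 on [V (x) V] is a
   combination of the identity and the swap of the two factors, so modulo [I]
   the Casimir operator of e_6 is determined by that of gl(E).  If [q] is not
   in [I] and has gl(E)-weight [l], its e_6-weight is at most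
   [(l0 - l1) omega_1 + (l1 - l2) omega_3 + l2 omega_4] and has the same Casimir
   value, hence is equal to it.  Every monomial of that weight only involves the
   coordinates of the fibre of [R_3] at the base point, so [q] is a function
   on [Hom(E, R_3)] at that point which vanishes on [Y]: it is zero. *)
Require Import Defs.
From HB Require Import structures.
From mathcomp Require Import all_boot all_order all_algebra.
From mathcomp Require Import mpoly.
From mathcomp Require Import zify ring.
From Stdlib Require Import Classical_Prop.

Set Implicit Arguments.
Unset Strict Implicit.
Unset Printing Implicit Defensive.

Import Order.TTheory GRing.Theory Num.Theory.
Local Open Scope ring_scope.

(** * Linear vector fields on polynomial rings *)

(** The two algebras are treated asymmetrically. On the gl(E) side an exact highest weight vector is
    needed, because the bounds on its e_6-weight are read off a monomial of its support; products of
    Casimir factors produce such vectors. On the e_6 side it is enough to be highest modulo [I], and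
    this comes from an induction on the depth of the weight. That [V] is minuscule enters twice. The
    simple root operators [A] square to zero, so [1 + t A] lies in the group and the Lie algebra
    acts on [J] by derivatives along lines contained in [Y]. And [V] is identified with an explicit
    integral model, in which the identity for the split Casimir operator on [V (x) V] is a finite
    computation with sparse integer matrices, valid over every field. Since [J] is defined by points
    over all extensions of [K], the last step can evaluate at a generic point of the fibre, with
    coordinates in a field of rational functions. *)

Section LinearVectorFields.
Variables (K : fieldType) (n : nat).
Local Notation S := {mpoly K[n]}.
Implicit Types (M N : 'M[K]_n) (p q : S).

(** Column [k] of [M] holds the image of [X_k]: [M] then acts on linear forms as on column vectors,
    and [vfield] preserves brackets instead of reversing them. *)
Definition linform M (k : 'I_n) : S := \sum_l M l k *: 'X_l.

Definition vfield M p : S := \sum_k linform M k * p^`M(k).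

Lemma vfieldE M p : vfield M p = \sum_k linform M k * p^`M(k).
Proof. by []. Qed.

Lemma vfield_is_linear M : linear (vfield M).
Proof.
move=> c p q; rewrite /vfield scaler_sumr -big_split /=; apply: eq_bigr => k _.
by rewrite mderivD mderivZ mulrDr scalerAr.
Qed.

HB.instance Definition _ M :=
  GRing.isLinear.Build K S S *:%R (vfield M) (vfield_is_linear M).

Lemma linformD M N k : linform (M + N) k = linform M k + linform N k.
Proof.
by rewrite /linform -big_split; apply: eq_bigr => l _; rewrite mxE scalerDl.
Qed.

Lemma linformZ c M k : linform (c *: M) k = c *: linform M k.
Proof.
by rewrite /linform scaler_sumr; apply: eq_bigr => l _; rewrite mxE scalerA.
Qed.

Lemma vfieldD M N p : vfield (M + N) p = vfield M p + vfield N p.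
Proof.
by rewrite /vfield -big_split; apply: eq_bigr => k _; rewrite linformD mulrDl.
Qed.

Lemma vfieldZ c M p : vfield (c *: M) p = c *: vfield M p.
Proof.
by rewrite /vfield scaler_sumr; apply: eq_bigr => k _; rewrite linformZ scalerAl.
Qed.

Lemma vfield0 p : vfield 0 p = 0.
Proof. by rewrite -(scale0r (0 : 'M_n)) vfieldZ scale0r. Qed.

Lemma vfieldN M p : vfield (- M) p = - vfield M p.
Proof. by rewrite -scaleN1r vfieldZ scaleN1r. Qed.

Lemma vfieldB M N p : vfield (M - N) p = vfield M p - vfield N p.
Proof. by rewrite vfieldD vfieldN. Qed.

Lemma vfield_sum (I : Type) (r : seq I) (P : pred I) (F : I -> 'M[K]_n) p :
  vfield (\sum_(i <- r | P i) F i) p = \sum_(i <- r | P i) vfield (F i) p.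
Proof. by elim/big_rec2: _ => [|i y x _ <-]; rewrite ?vfield0 ?vfieldD. Qed.

Lemma mderivXU (k l : 'I_n) : ('X_l : S)^`M(k) = (l == k)%:R.
Proof.
rewrite mderivX mnm1E; case: eqP => [->|_]; last by rewrite scale0r.
rewrite scale1r -mpolyX0; congr 'X_[_].
by apply/mnmP => i; rewrite mnmBE subnn mnm0E.
Qed.

Lemma vfieldM M p q : vfield M (p * q) = vfield M p * q + p * vfield M q.
Proof.
rewrite /vfield mulr_suml mulr_sumr -big_split /=; apply: eq_bigr => k _.
by rewrite mderivM; ring.
Qed.

Lemma vfieldX M k : vfield M 'X_k = linform M k.
Proof.
rewrite /vfield (bigD1 k) //= mderivXU eqxx mulr1 big1 ?addr0 // => l lk.
by rewrite mderivXU eq_sym (negPf lk) mulr0.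
Qed.

Lemma vfield_linform M N k : vfield M (linform N k) = linform (M *m N) k.
Proof.
rewrite /linform linear_sum /=.
under eq_bigr => l _ do rewrite linearZ /= vfieldX /linform scaler_sumr.
rewrite exchange_big /=; apply: eq_bigr => i _.
rewrite !mxE scaler_suml; apply: eq_bigr => l _.
by rewrite scalerA mulrC.
Qed.

(** Normal ordering. The second order part is symmetric in the two fields, so commutators are first
    order, and Casimir operators can be compared through their second order coefficients. *)
Lemma vfield_comp M N p :
  vfield M (vfield N p) = vfield (M *m N) p +
    \sum_k \sum_l linform M k * linform N l * p^`M(l)^`M(k).
Proof.
rewrite {2}/vfield linear_sum /=.
under eq_bigr => l _ do rewrite vfieldM vfield_linform.
rewrite big_split /=; congr (_ + _).
under eq_bigr => l _ do rewrite /vfield mulr_sumr.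
rewrite exchange_big /=; apply: eq_bigr => k _; apply: eq_bigr => l _.
by rewrite mulrA [linform N l * _]mulrC.
Qed.

Lemma vfield_comm M N p :
  vfield M (vfield N p) = vfield N (vfield M p) + vfield (M *m N - N *m M) p.
Proof.
rewrite !vfield_comp vfieldB.
rewrite [X in _ = _ + X + _]exchange_big /=.
rewrite [vfield (M *m N) p - _]addrC addrACA subrr add0r addrC.
congr (_ + _); apply: eq_bigr => k _; apply: eq_bigr => l _.
by rewrite mderiv_comm [linform M k * _]mulrC.
Qed.

Record subspace (P : S -> Prop) : Prop := Subspace {
  subspace0 : P 0;
  subspaceD : forall p q, P p -> P q -> P (p + q);
  subspaceZ : forall c p, P p -> P (c *: p) }.

Definition stable (P : S -> Prop) M := forall p, P p -> P (vfield M p).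

Section Subspace.
Variables (P : S -> Prop) (subP : subspace P).

Lemma subspaceN p : P p -> P (- p).
Proof. by rewrite -scaleN1r; apply: subspaceZ. Qed.

Lemma subspaceB p q : P p -> P q -> P (p - q).
Proof. by move=> Pp Pq; apply: subspaceD => //; apply: subspaceN. Qed.

Lemma subspace_sum (I : Type) (r : seq I) (Q : pred I) (F : I -> S) :
  (forall i, Q i -> P (F i)) -> P (\sum_(i <- r | Q i) F i).
Proof.
move=> PF; elim/big_rec: _ => [|i x Qi Px]; first exact: subspace0.
by apply: subspaceD => //; apply: PF.
Qed.

Lemma subspace_mulrnr p k : P p -> P (p *+ k).
Proof. by move=> Pp; rewrite -scaler_nat; apply: subspaceZ. Qed.

Lemma stableD M N : stable P M -> stable P N -> stable P (M + N).
Proof. by move=> sM sN p Pp; rewrite vfieldD; apply: subspaceD; auto. Qed.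

Lemma stableZ c M : stable P M -> stable P (c *: M).
Proof. by move=> sM p Pp; rewrite vfieldZ; apply: subspaceZ; auto. Qed.

Lemma stableN M : stable P M -> stable P (- M).
Proof. by rewrite -scaleN1r; apply: stableZ. Qed.

Lemma stable_sum (I : Type) (r : seq I) (Q : pred I) (F : I -> 'M[K]_n) :
  (forall i, Q i -> stable P (F i)) -> stable P (\sum_(i <- r | Q i) F i).
Proof.
by move=> sF p Pp; rewrite vfield_sum; apply: subspace_sum => i /sF; apply.
Qed.

Lemma stable_bracket M N :
  stable P M -> stable P N -> stable P (M *m N - N *m M).
Proof.
move=> sM sN p Pp.
have -> : vfield (M *m N - N *m M) p =
    vfield M (vfield N p) - vfield N (vfield M p).
  by rewrite [vfield M (vfield N p)]vfield_comm addrAC subrr add0r.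
by apply: subspaceB; auto.
Qed.

End Subspace.

Definition in_ideal (qs : seq S) p : Prop :=
  exists c : 'I_(size qs) -> S, p = \sum_(i < size qs) c i * qs`_i.

Lemma in_ideal_subspace qs : subspace (in_ideal qs).
Proof.
split.
- by exists (fun=> 0); rewrite big1 // => i _; rewrite mul0r.
- move=> _ _ [c ->] [d ->]; exists (fun i => c i + d i).
  by rewrite -big_split; apply: eq_bigr => i _; rewrite mulrDl.
- move=> a _ [c ->]; exists (fun i => a *: c i).
  by rewrite scaler_sumr; apply: eq_bigr => i _; rewrite scalerAl.
Qed.

Lemma in_ideal_mull qs p q : in_ideal qs q -> in_ideal qs (p * q).
Proof.
move=> [c ->]; exists (fun i => p * c i).
by rewrite mulr_sumr; apply: eq_bigr => i _; rewrite mulrA.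
Qed.

Lemma in_ideal_mulr qs p q : in_ideal qs q -> in_ideal qs (q * p).
Proof. by rewrite mulrC; apply: in_ideal_mull. Qed.

Lemma in_ideal_gen qs q : q \in qs -> in_ideal qs q.
Proof.
move=> qqs; have iqs : (index q qs < size qs)%N by rewrite index_mem.
exists (fun i => (i == Ordinal iqs)%:R).
rewrite (bigD1 (Ordinal iqs)) //= eqxx mul1r nth_index // big1 ?addr0 // => i.
by move/negPf=> ->; rewrite mul0r.
Qed.

Lemma in_ideal_stable qs M :
  (forall q, q \in qs -> in_ideal qs (vfield M q)) -> stable (in_ideal qs) M.
Proof.
move=> qsM _ [c ->]; rewrite linear_sum /=.
apply: (subspace_sum (in_ideal_subspace qs)) => i _; rewrite vfieldM.
apply: (subspaceD (in_ideal_subspace qs)); apply: in_ideal_mull.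
  by apply: in_ideal_gen; apply: mem_nth.
by apply: qsM; apply: mem_nth.
Qed.

End LinearVectorFields.

Lemma pchar0_intr_eq0 (K : fieldType) :
  [pchar K] =i pred0 -> forall z : int, (z%:~R == 0 :> K) = (z == 0).
Proof.
move=> /pcharf0P charK0 [k|k] /=; first by rewrite -pmulrn charK0.
by rewrite NegzE mulrNz oppr_eq0 -pmulrn charK0.
Qed.

Lemma pchar0_intr_inj (K : fieldType) :
  [pchar K] =i pred0 -> injective (fun z : int => z%:~R : K).
Proof.
move=> charK0 a b /eqP; rewrite -subr_eq0 -rmorphB pchar0_intr_eq0 //.
by rewrite subr_eq0 => /eqP.
Qed.

(** * Gradings *)

Section Gradings.
Variables (K : fieldType) (n : nat).
Hypothesis charK0 : [pchar K] =i pred0.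
Local Notation S := {mpoly K[n]}.
Implicit Types (p q : S) (d : 'I_n -> int) (m : 'X_{1..n}).

(** Subtraction of exponents truncates at zero, so the factor [m k != 0] has to discard the
    monomials not divisible by [X_k]. *)
Lemma mcoeff_mulXU k q m :
  ('X_k * q : S)@_m = (m k != 0)%:R * q@_(m - U_(k)).
Proof.
have [mk0|mk_neq0] := eqVneq (m k) 0%N.
  rewrite mul0r mulrC; apply: memN_msupp_eq0.
  rewrite (perm_mem (msuppMX _ _)); apply/negP => /mapP[m' _ m'E].
  by move: mk0; rewrite m'E mnmDE mnm1E eqxx.
rewrite mul1r mulrC -{1}[m](submK (m' := m) (m := U_(k)%MM)) ?lep1mP //.
by rewrite addmC mcoeffMX.
Qed.

Definition grade d m : int := \sum_k d k * (m k)%:Z.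

Definition diagz d : 'M[K]_n := diag_mx (\row_k (d k)%:~R).

Lemma linform_diagz d k : linform (diagz d) k = (d k)%:~R *: 'X_k.
Proof.
rewrite /linform (bigD1 k) //= big1 ?addr0 => [|l lk].
  by rewrite !mxE eqxx mulr1n.
by rewrite !mxE (negPf lk) mulr0n scale0r.
Qed.

Lemma mcoeff_vfield_diagz d p m :
  (vfield (diagz d) p)@_m = (grade d m)%:~R * p@_m.
Proof.
rewrite /vfield raddf_sum /grade rmorph_sum mulr_suml; apply: eq_bigr => k _ /=.
rewrite linform_diagz -scalerAl mcoeffZ mcoeff_mulXU mcoeff_deriv rmorphM /=.
rewrite -mulrA; congr (_ * _).
have [->|mk_neq0] := eqVneq (m k) 0%N; first by rewrite !mul0r.
rewrite mul1r submK ?lep1mP // mnmBE mnm1E eqxx subn1 prednK ?lt0n //.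
by rewrite -mulr_natl pmulrn.
Qed.

(** Euler's relation rather than a condition on the support: in this form homogeneity is carried
    along by commutators of fields. *)
Definition homogeneous d (c : int) p := vfield (diagz d) p = c%:~R *: p.

Lemma homogeneous_grade d c p m :
  homogeneous d c p -> m \in msupp p -> grade d m = c.
Proof.
move=> hp; rewrite mcoeff_msupp => pm; apply: (pchar0_intr_inj charK0).
apply: (mulIf pm); rewrite -mcoeff_vfield_diagz hp.
by rewrite mcoeffZ.
Qed.

Lemma homogeneous_lt0 d c p :
  (forall k, 0 <= d k) -> c < 0 -> homogeneous d c p -> p = 0.
Proof.
move=> d_ge0 c_lt0 hp; apply/eqP; rewrite -msupp_eq0.
case E: (msupp p) => [//|m s]; have mp : m \in msupp p by rewrite E mem_head.
have := homogeneous_grade hp mp; have : 0 <= grade d m.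
  by apply: Num.Theory.sumr_ge0 => k _; apply: Num.Theory.mulr_ge0.
by lia.
Qed.

Lemma homogeneous_subspace d c : subspace (homogeneous d c).
Proof.
split.
- by rewrite /homogeneous linear0 scaler0.
- by move=> p q hp hq; rewrite /homogeneous linearD /= hp hq scalerDr.
- by move=> a p hp; rewrite /homogeneous linearZ /= hp !scalerA mulrC.
Qed.

Lemma homogeneous_shift d c e M p :
  diagz d *m M - M *m diagz d = e%:~R *: M ->
  homogeneous d c p -> homogeneous d (c + e) (vfield M p).
Proof.
move=> dM hp; rewrite /homogeneous vfield_comm hp dM linearZ vfieldZ /=.
by rewrite -scalerDl -rmorphD.
Qed.

Lemma diagz_comm d d' : diagz d *m diagz d' = diagz d' *m diagz d.
Proof.
rewrite !mul_diag_mx; apply/matrixP => i j; rewrite !mxE.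
by case: eqP => [->|_]; rewrite ?mulr0n ?mulr0 // !mulr1n mulrC.
Qed.

Lemma homogeneous_diagz_stable d c d' : stable (homogeneous d c) (diagz d').
Proof.
move=> p hp; rewrite -[c]addr0; apply: homogeneous_shift hp.
by rewrite diagz_comm subrr scale0r.
Qed.

Definition graded_part d c p : S :=
  \sum_(m <- msupp p | grade d m == c) p@_m *: 'X_[m].

Lemma mcoeff_graded_part d c p m :
  (graded_part d c p)@_m = (grade d m == c)%:R * p@_m.
Proof.
rewrite {2}[p]mpolyE /graded_part big_mkcond /= !raddf_sum mulr_sumr.
apply: eq_bigr => m' _ /=; case: eqVneq => [e|ne]; rewrite ?mcoeff0 mcoeffZ mcoeffX.
  case: (eqVneq m' m) => [<-|]; last by rewrite !mulr0.
  by rewrite e eqxx mul1r.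
case: (eqVneq m' m) => [<-|]; last by rewrite !mulr0.
by rewrite (negPf ne) mul0r.
Qed.

Lemma graded_part_homogeneous d c p : homogeneous d c (graded_part d c p).
Proof.
apply/mpolyP => m; rewrite mcoeff_vfield_diagz mcoeffZ mcoeff_graded_part.
by case: eqP => [->|]; rewrite ?mul0r ?mulr0.
Qed.

Lemma sum_graded_part d p :
  p = \sum_(c <- undup [seq grade d m | m <- msupp p]) graded_part d c p.
Proof.
apply/mpolyP => m; rewrite raddf_sum /=.
under eq_bigr do rewrite mcoeff_graded_part.
rewrite -mulr_suml; have [mp|mNp] := boolP (m \in msupp p); last first.
  by rewrite (memN_msupp_eq0 mNp) mulr0.
rewrite (bigD1_seq (grade d m)) ?undup_uniq ?mem_undup ?map_f //= eqxx big1.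
  by rewrite addr0 mul1r.
by move=> c; rewrite eq_sym => /negPf->.
Qed.

(* Lagrange interpolation in the operator [diagz d] extracts graded parts. *)
Lemma graded_part_stable (P : S -> Prop) d c p :
  subspace P -> stable P (diagz d) -> P p -> P (graded_part d c p).
Proof.
move=> subP sPd Pp.
pose cs := rem c (undup [seq grade d m | m <- msupp p]).
pose G := foldr (fun (c' : int) q => vfield (diagz d) q - c'%:~R *: q) p.
have PG s : P (G s).
  elim: s => [//|c' s IHs] /=.
  by apply: subspaceB => //; [apply: sPd | apply: subspaceZ].
have GE s m : (G s)@_m = (\prod_(c' <- s) (grade d m - c'))%:~R * p@_m.
  elim: s => [|c' s IHs] /=; first by rewrite big_nil mul1r.
  rewrite mcoeffB mcoeff_vfield_diagz mcoeffZ IHs big_cons rmorphM rmorphB /=.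
  by rewrite -mulrBl mulrA.
pose a : K := (\prod_(c' <- cs) (c - c'))%:~R.
have a_neq0 : a != 0.
  rewrite pchar0_intr_eq0 // prodf_seq_neq0; apply/allP => c' /=.
  by rewrite mem_rem_uniq ?undup_uniq // !inE subr_eq0 eq_sym => /andP[].
suff -> : graded_part d c p = a^-1 *: G cs by apply: subspaceZ.
apply/mpolyP => m; rewrite mcoeffZ GE mcoeff_graded_part.
have [e|ne] := eqVneq (grade d m) c; first by rewrite e mul1r mulKf.
rewrite mul0r; have [mp|mNp] := boolP (m \in msupp p); last first.
  by rewrite (memN_msupp_eq0 mNp) !mulr0.
suff -> : \prod_(c' <- cs) (grade d m - c') = 0 by rewrite mul0r mulr0.
apply/eqP; rewrite prodf_seq_eq0; apply/hasP; exists (grade d m).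
  by rewrite mem_rem_uniq ?undup_uniq // !inE ne mem_undup map_f.
by rewrite subrr eqxx.
Qed.

(** Diagonal fields commute, so splitting by one grading preserves the homogeneity already obtained
    for the others; [P'] records it along the induction. *)
Lemma multigraded_ind (ds : seq ('I_n -> int)) (P Q : S -> Prop) :
  subspace P -> subspace Q ->
  (forall i, (i < size ds)%N -> stable P (diagz (nth (fun=> 0) ds i))) ->
  (forall p, P p ->
     (forall i, (i < size ds)%N ->
        exists c, homogeneous (nth (fun=> 0) ds i) c p) -> Q p) ->
  forall p, P p -> Q p.
Proof.
move=> subP subQ; elim: ds P subP => [|d ds IHds] P subP stP PQ p Pp.
  exact: PQ.
rewrite (sum_graded_part d p); apply: subspace_sum => // c _.
pose P' q := P q /\ homogeneous d c q.
have subP' : subspace P'.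
  have subH := homogeneous_subspace d c.
  split; first by split; apply: subspace0.
    by move=> q r [? ?] [? ?]; split; apply: subspaceD.
  by move=> x q [? ?]; split; apply: subspaceZ.
apply: (IHds P' subP').
- move=> i lti q [Pq hq]; split; first exact: (stP i.+1 lti).
  exact: homogeneous_diagz_stable.
- move=> q [Pq hq] hds; apply: PQ => // -[_|i lti]; first by exists c.
  exact: hds.
- split; last exact: graded_part_homogeneous.
  by apply: graded_part_stable => //; apply: (stP 0%N).
Qed.

End Gradings.

Opaque vfield.

(** * Negative highest weights for sl_2 *)

Section Dominance.
Variables (K : fieldType) (n : nat).
Hypothesis charK0 : [pchar K] =i pred0.
Local Notation S := {mpoly K[n]}.
Variables (P : S -> Prop) (subP : subspace P) (e f : 'M[K]_n).
Variables (h d : 'I_n -> int) (k c : int) (q : S).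
Hypothesis efh : e *m f - f *m e = diagz K h.
Hypothesis hf : diagz K h *m f - f *m diagz K h = (-2)%:~R *: f.
Hypothesis df : diagz K d *m f - f *m diagz K d = (-1)%:~R *: f.
Hypothesis d_ge0 : forall i, 0 <= d i.
Hypotheses (stPe : stable P e) (stPf : stable P f).
Hypotheses (hq : homogeneous h k q) (dq : homogeneous d c q).
Hypotheses (eq0 : P (vfield e q)) (k_lt0 : k < 0).

Local Notation fq i := (iter i (vfield f) q).

(* Modulo [P], [e f^(i+1) q = (i+1)(k-i) f^i q], as in a highest weight module
   for sl_2; since [f] is nilpotent this forces [q] into [P]. *)
Lemma negative_highest_weight : P q.
Proof.
have hfq i : homogeneous h (k - 2 * i%:Z) (fq i).
  elim: i => [|i IHi] /=; first by rewrite mulr0 subr0.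
  have -> : k - 2 * i.+1%:Z = k - 2 * i%:Z + (-2) by lia.
  exact: homogeneous_shift hf IHi.
have dfq i : homogeneous d (c - i%:Z) (fq i).
  elim: i => [|i IHi] /=; first by rewrite subr0.
  have -> : c - i.+1%:Z = c - i%:Z + (-1) by lia.
  exact: homogeneous_shift df IHi.
have efq i : P (vfield e (fq i.+1) - (i.+1%:Z * (k - i%:Z))%:~R *: fq i).
  elim: i => [|i IHi].
    rewrite /= vfield_comm efh hq mul1r subr0 addrK.
    exact: stPf.
  rewrite [fq i.+2]iterS vfield_comm efh hfq.
  have -> : i.+2%:Z * (k - i.+1%:Z) =
      i.+1%:Z * (k - i%:Z) + (k - 2 * i.+1%:Z) by lia.
  rewrite [(_ * _ + _)%:~R]rmorphD /= scalerDl opprD addrACA subrr addr0.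
  by have := stPf IHi; rewrite linearB linearZ.
have Pfq i : P (fq i) -> P q.
  elim: i => [//|i IHi] Pi; apply: IHi.
  have a_neq0 : (i.+1%:Z * (k - i%:Z))%:~R != 0 :> K.
    by rewrite pchar0_intr_eq0 // mulf_neq0 //; lia.
  rewrite -(scalerK a_neq0 (fq i)); apply: subspaceZ => //.
  have -> : (i.+1%:Z * (k - i%:Z))%:~R *: fq i = vfield e (fq i.+1) -
      (vfield e (fq i.+1) - (i.+1%:Z * (k - i%:Z))%:~R *: fq i).
    by rewrite subKr.
  by apply: subspaceB => //; apply: stPe.
(* The degree of [f^i q] for [d] is [c - i], which is negative at [i = |c| + 1]. *)
apply: (Pfq `|c|.+1); rewrite (homogeneous_lt0 charK0 d_ge0 _ (dfq _)).
  exact: subspace0.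
by lia.
Qed.

End Dominance.

(** * Polynomials in the entries of a matrix *)

Section MatrixVariables.
Variables (K : fieldType) (r s : nat).
Local Notation S := {mpoly K[r * s]}.

Local Notation idx := (@mxvec_index r s).

Definition mvar (a : 'I_r) (j : 'I_s) : S := 'X_(idx a j).

(** The transpose compensates for the row vector convention of [lin_mx]: [lmul] is multiplicative,
    and the variables of a column are transformed like the basis vectors of [V]. On points the
    operator acts through the transposed matrix. *)
Definition lmul (A : 'M[K]_r) : 'M[K]_(r * s) := lin_mx (mulmx A^T).
Definition rmul (B : 'M[K]_s) : 'M[K]_(r * s) := lin_mx (mulmxr B).

Definition weight2 (f : 'I_r -> 'I_s -> int) : 'I_(r * s) -> int :=
  fun k => mxvec (\matrix_(i, j) f i j) 0 k.

Lemma weight2E f a j : weight2 f (idx a j) = f a j.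
Proof. by rewrite /weight2 mxvecE mxE. Qed.

Lemma sum_mxvec_index (V : nmodType) (F : 'I_(r * s) -> V) :
  \sum_k F k = \sum_a \sum_j F (idx a j).
Proof.
by rewrite (reindex _ (curry_mxvec_bij _ _)) pair_bigA; apply: eq_bigr => -[].
Qed.

Lemma mxvec_index_mxP (M N : 'M[K]_(r * s)) :
  (forall a j c i, M (idx a j) (idx c i) = N (idx a j) (idx c i)) -> M = N.
Proof.
move=> MN; apply/matrixP => k l.
by case/mxvec_indexP: k => a j; case/mxvec_indexP: l => c i.
Qed.

Lemma mxvec_row_mxP (M N : 'M[K]_(r * s)) :
  (forall x : 'M_(r, s), mxvec x *m M = mxvec x *m N) -> M = N.
Proof.
move=> MN; apply/row_matrixP => k; rewrite !rowE -(vec_mxK (delta_mx 0 k)).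
exact: MN.
Qed.

Lemma vec_lmul A x : mxvec x *m lmul A = mxvec (A^T *m x).
Proof. exact: mul_vec_lin. Qed.

Lemma vec_rmul B x : mxvec x *m rmul B = mxvec (x *m B).
Proof. exact: (mul_vec_lin (mulmxr B)). Qed.

Lemma lmulM A A' : lmul (A *m A') = lmul A *m lmul A'.
Proof.
by apply: mxvec_row_mxP => x; rewrite mulmxA !vec_lmul trmx_mul -mulmxA.
Qed.

Lemma rmulM B B' : rmul (B *m B') = rmul B *m rmul B'.
Proof. by apply: mxvec_row_mxP => x; rewrite mulmxA !vec_rmul mulmxA. Qed.

Lemma lmul_rmul A B : lmul A *m rmul B = rmul B *m lmul A.
Proof.
by apply: mxvec_row_mxP => x; rewrite !mulmxA !(vec_lmul, vec_rmul) mulmxA.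
Qed.

Lemma lmul_is_linear : linear lmul.
Proof.
move=> c A A'; apply: mxvec_row_mxP => x.
rewrite mulmxDr -scalemxAr !vec_lmul linearD linearZ /= mulmxDl -scalemxAl.
by rewrite linearD linearZ.
Qed.

HB.instance Definition _ :=
  GRing.isLinear.Build K 'M_r 'M_(r * s) *:%R lmul lmul_is_linear.

Lemma rmul_is_linear : linear rmul.
Proof.
move=> c B B'; apply: mxvec_row_mxP => x.
by rewrite mulmxDr -scalemxAr !vec_rmul mulmxDr -scalemxAr linearD linearZ.
Qed.

HB.instance Definition _ :=
  GRing.isLinear.Build K 'M_s 'M_(r * s) *:%R rmul rmul_is_linear.

Lemma lmulE A c i a j : lmul A (idx c i) (idx a j) = A c a *+ (i == j).
Proof.
have -> : lmul A (idx c i) (idx a j) = (mxvec (delta_mx c i) *m lmul A) 0 (idx a j).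
  by rewrite mxvec_delta -rowE [RHS]mxE.
rewrite vec_lmul mxvecE mxE (bigD1 c) //= big1 ?addr0 => [|b bc].
  by rewrite !mxE eqxx /= mulr_natr eq_sym.
by rewrite !mxE (negPf bc) /= mulr0.
Qed.

Lemma rmulE B c i a j : rmul B (idx c i) (idx a j) = B i j *+ (c == a).
Proof.
have -> : rmul B (idx c i) (idx a j) = (mxvec (delta_mx c i) *m rmul B) 0 (idx a j).
  by rewrite mxvec_delta -rowE [RHS]mxE.
rewrite vec_rmul mxvecE mxE (bigD1 i) //= big1 ?addr0 => [|b bc].
  by rewrite !mxE eqxx andbT mulr_natl eq_sym.
by rewrite !mxE (negPf bc) andbF mul0r.
Qed.

Lemma linform_lmul A a j : linform (lmul A) (idx a j) = \sum_c A c a *: mvar c j.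
Proof.
rewrite /linform sum_mxvec_index; apply: eq_bigr => c _.
rewrite (bigD1 j) //= lmulE eqxx mulr1n big1 ?addr0 // => i ij.
by rewrite lmulE (negPf ij) mulr0n scale0r.
Qed.

Lemma linform_rmul B a j : linform (rmul B) (idx a j) = \sum_i B i j *: mvar a i.
Proof.
rewrite /linform sum_mxvec_index (bigD1 a) //= [X in _ + X]big1 ?addr0.
  by apply: eq_bigr => i _; rewrite rmulE eqxx.
by move=> c ca; rewrite big1 // => i _; rewrite rmulE (negPf ca) mulr0n scale0r.
Qed.

Lemma diagzE n (d : 'I_n -> int) k l : diagz K d k l = (d k)%:~R *+ (k == l).
Proof. by rewrite !mxE. Qed.

Lemma mxvec_index_eq a j c i : (idx a j == idx c i) = (a == c) && (j == i).
Proof.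
have := bij_inj (onT_bij (curry_mxvec_bij r s)) => inj.
by rewrite -xpair_eqE; apply: (inj_eq inj (a, j) (c, i)).
Qed.

Lemma lmul_diagz (f : 'I_r -> int) :
  lmul (diagz K f) = diagz K (weight2 (fun a _ => f a)).
Proof.
apply: mxvec_index_mxP => a j c i.
rewrite lmulE !diagzE weight2E mxvec_index_eq.
by case: eqP => _; case: eqP => _; rewrite ?mulr1n ?mul0rn.
Qed.

Lemma rmul_diagz (f : 'I_s -> int) :
  rmul (diagz K f) = diagz K (weight2 (fun _ j => f j)).
Proof.
apply: mxvec_index_mxP => a j c i.
rewrite rmulE !diagzE weight2E mxvec_index_eq.
by case: eqP => _; case: eqP => _; rewrite ?mulr1n ?mul0rn.
Qed.

Definition egl (i j : 'I_s) : 'M[K]_(r * s) := rmul (delta_mx i j).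

Lemma eglM i j k l : egl i j *m egl k l = (j == k)%:R *: egl i l.
Proof.
by rewrite -rmulM mul_delta_mx_cond -linearZ /= scaler_nat; case: eqP.
Qed.

Lemma lmul_egl A i j : lmul A *m egl i j = egl i j *m lmul A.
Proof. exact: lmul_rmul. Qed.

Lemma linform_egl i j a k :
  linform (egl i j) (idx a k) = (j == k)%:R *: mvar a i.
Proof.
rewrite linform_rmul (bigD1 i) //= mxE eqxx /= [k == j]eq_sym big1 ?addr0 //.
by move=> l li; rewrite mxE (negPf li) scale0r.
Qed.

Definition coldeg (j : 'I_s) : 'I_(r * s) -> int :=
  weight2 (fun _ i => (j == i)%:Z).

Lemma egl_diag j : egl j j = diagz K (coldeg j).
Proof.
rewrite -(rmul_diagz (fun i => (j == i)%:Z)); congr rmul.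
apply/matrixP => i k; rewrite !mxE [i == j]eq_sym.
by case: (eqVneq j i) => [->|]; rewrite ?mul0rn //= eq_sym; case: eqP.
Qed.

Opaque lmul rmul egl linform diagz.

Definition casimir (p : S) : S :=
  \sum_i \sum_j vfield (egl i j) (vfield (egl j i) p).

Lemma casimirE p :
  casimir p = \sum_i \sum_j vfield (egl i j) (vfield (egl j i) p).
Proof. by []. Qed.

Lemma casimir_is_linear : linear casimir.
Proof.
move=> c p q; rewrite /casimir scaler_sumr -big_split; apply: eq_bigr => i _ /=.
rewrite scaler_sumr -big_split; apply: eq_bigr => j _ /=.
by rewrite !linearP.
Qed.

HB.instance Definition _ :=
  GRing.isLinear.Build K S S *:%R casimir casimir_is_linear.

Lemma vfield_egl_comm k l i j p :
  vfield (egl k l) (vfield (egl i j) p) =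
    vfield (egl i j) (vfield (egl k l) p) +
    ((l == i)%:R *: vfield (egl k j) p - (j == k)%:R *: vfield (egl i l) p).
Proof. by rewrite vfield_comm !eglM vfieldB !vfieldZ. Qed.

(** Moving [egl k l] past both factors leaves four sums, each with one Kronecker delta. They
    collapse to single sums that cancel in pairs. *)
Lemma casimir_egl k l p :
  casimir (vfield (egl k l) p) = vfield (egl k l) (casimir p).
Proof.
pose v i j i' j' := vfield (egl i j) (vfield (egl i' j') p).
have sumD (A B C D F : 'I_s -> 'I_s -> S) :
    \sum_i \sum_j (A i j + ((l == j)%:R *: B i j - (i == k)%:R *: C i j) +
      ((l == i)%:R *: D i j - (j == k)%:R *: F i j)) =
    \sum_i \sum_j A i j + (\sum_i B i l - \sum_j C k j) +
      (\sum_j D l j - \sum_i F i k).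
  have D1 (G : 'I_s -> 'I_s -> S) m :
      \sum_i \sum_j (m == j)%:R *: G i j = \sum_i G i m.
    apply: eq_bigr => i _; rewrite (bigD1 m) //= eqxx scale1r big1 ?addr0 //.
    by move=> j; rewrite eq_sym => /negPf->; rewrite scale0r.
  have D2 (G : 'I_s -> 'I_s -> S) m :
      \sum_i \sum_j (m == i)%:R *: G i j = \sum_j G m j.
    by rewrite exchange_big /= (D1 (fun j i => G i j)).
  rewrite -(D1 B) -(D2 C) -(D2 D) -(D1 F) -!sumrB -!big_split /=.
  apply: eq_bigr => i _; rewrite -!sumrB -!big_split /=.
  by apply: eq_bigr => j _; rewrite [k == i]eq_sym [k == j]eq_sym.
pose A i j := vfield (egl i j) (vfield (egl j i) (vfield (egl k l) p)).
have E i j : vfield (egl k l) (v i j j i) =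
    A i j + ((l == j)%:R *: v i j k i - (i == k)%:R *: v i j j l) +
    ((l == i)%:R *: v k j j i - (j == k)%:R *: v i l j i).
  rewrite /v vfield_egl_comm.
  rewrite [vfield (egl k l) (vfield (egl j i) p)]vfield_egl_comm.
  congr (_ + _); rewrite linearD; congr (_ + _).
  by rewrite linearB; congr (_ - _); rewrite linearZ.
transitivity (\sum_i \sum_j A i j); first by [].
symmetry; rewrite /casimir linear_sum /=.
under eq_bigr => i _.
  rewrite linear_sum /=; under eq_bigr => j _ do rewrite E.
  over.
apply: etrans (sumD A (fun i j => v i j k i) (fun i j => v i j j l)
  (fun i j => v k j j i) (fun i j => v i l j i)) _.
have cancelB (x a b : S) : x + (a - b) + (b - a) = x.
  by rewrite -addrA -[b - a]opprB subrr addr0.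
exact: cancelB.
Qed.

End MatrixVariables.

(** * Highest weight vectors for gl_3 *)

Notation c0 := (ord0 : 'I_3).
Notation c1 := (lift ord0 ord0 : 'I_3).
Notation c2 := (lift ord0 (lift ord0 ord0) : 'I_3).

Section GL3.
Variables (K : fieldType) (r : nat).
Hypothesis charK0 : [pchar K] =i pred0.
Local Notation S := {mpoly K[r * 3]}.
Local Notation egl := (@egl K r 3).
Local Notation coldeg := (@coldeg r 3).
Local Notation casimir := (@casimir K r 3).
Implicit Types (p q : S) (l : 'I_3 -> int) (P : S -> Prop).

Definition gl_weight l p := forall j, homogeneous (coldeg j) (l j) p.

Lemma coldeg_egl k i j :
  diagz K (coldeg k) *m egl i j - egl i j *m diagz K (coldeg k) =
    ((k == i)%:Z - (k == j)%:Z)%:~R *: egl i j.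
Proof.
rewrite -egl_diag !eglM rmorphB scalerBl.
congr (_ - _); first by case: eqP => [->|]; rewrite ?scale0r.
by rewrite eq_sym; case: eqP => [->|]; rewrite ?scale0r.
Qed.

Lemma gl_weight_egl l p i j : gl_weight l p ->
  gl_weight (fun k => l k + ((k == i)%:Z - (k == j)%:Z)) (vfield (egl i j) p).
Proof. by move=> lp k; apply: homogeneous_shift (lp k); apply: coldeg_egl. Qed.

Lemma gl_weight_subspace l : subspace (gl_weight l).
Proof.
split=> [j|p q lp lq j|c p lp j].
- exact: (subspace0 (homogeneous_subspace _ _ _)).
- exact: (subspaceD (homogeneous_subspace _ _ _) (lp j) (lq j)).
- exact: (subspaceZ (homogeneous_subspace _ _ _) _ (lp j)).
Qed.

(** Relative to [P]: for an ideal this is a highest weight vector of the quotient, for the zero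
    subspace an actual one. *)
Definition highest P q :=
  [/\ P (vfield (egl c0 c1) q), P (vfield (egl c1 c2) q) &
      P (vfield (egl c0 c2) q)].

(** This is [(l, l + 2 rho)] with [2 rho = (2, 0, -2)]. *)
Definition casimir_value l : int :=
  l c0 ^+ 2 + l c1 ^+ 2 + l c2 ^+ 2 + 2 * (l c0 - l c2).

Definition dominant l := l c2 <= l c1 <= l c0.

Section Modulo.
Variables (P : S -> Prop) (subP : subspace P).
Hypothesis stP : forall i j, stable P (egl i j).

(** Letting the raising factor act first costs [l i - l j] for each [i < j], which adds up to
    [2 (l0 - l2)]; the reordered products lie in [P] because [P] is stable. *)
Lemma casimir_highest l q : gl_weight l q -> highest P q ->
  P (casimir q - (casimir_value l)%:~R *: q).
Proof.
move=> lq [q01 q12 q02].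
have w2 j : vfield (egl j j) (vfield (egl j j) q) = (l j ^+ 2)%:~R *: q.
  by rewrite egl_diag lq linearZ /= lq scalerA -rmorphM.
have up i j : i != j ->
    vfield (egl i j) (vfield (egl j i) q) =
    vfield (egl j i) (vfield (egl i j) q) + (l i - l j)%:~R *: q.
  move=> ij; rewrite vfield_egl_comm !eqxx !scale1r !egl_diag !lq.
  by rewrite rmorphB scalerBl.
have sum3 (F : 'I_3 -> S) : \sum_i F i = F c0 + F c1 + F c2.
  by rewrite !big_ord_recl big_ord0 addr0 addrA.
have sum33 (F : 'I_3 -> 'I_3 -> S) : \sum_i \sum_j F i j =
    (F c0 c0 + F c0 c1 + F c0 c2) + (F c1 c0 + F c1 c1 + F c1 c2) +
    (F c2 c0 + F c2 c1 + F c2 c2).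
  by rewrite sum3; congr (_ + _ + _); apply: sum3.
rewrite casimirE (sum33 (fun i j => vfield (egl i j) (vfield (egl j i) q))).
rewrite (up c0 c1 isT) (up c1 c2 isT) (up c0 c2 isT) (w2 c0) (w2 c1) (w2 c2).
have {q01} := @stP c1 c0 _ q01.
have {q12} := @stP c2 c1 _ q12.
have {q02} := @stP c2 c0 _ q02.
move: (vfield _ (vfield _ q)) (vfield _ (vfield _ q)) (vfield _ (vfield _ q)).
move=> x y z Pz Py Px.
rewrite [X in P X](_ : _ = x *+ 2 + y *+ 2 + z *+ 2).
  by do 2?[apply: subspaceD => //]; apply: subspace_mulrnr.
have -> : casimir_value l = l c0 ^+ 2 + l c1 ^+ 2 + l c2 ^+ 2 +
    (l c0 - l c1) + (l c1 - l c2) + (l c0 - l c2).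
  by rewrite /casimir_value; ring.
move: (l c0 ^+ 2) (l c1 ^+ 2) (l c2 ^+ 2) (l c0 - l c1) (l c1 - l c2) (l c0 - l c2).
move=> a b c d e f; rewrite !rmorphD /= !scalerDl.
move: (_ *: q) (_ *: q) (_ *: q) (_ *: q) (_ *: q) (_ *: q).
by move=> qa qb qc qd qe qf; ring.
Qed.

Definition casimir_prod (cs : seq int) p : S :=
  foldr (fun c q => casimir q - c%:~R *: q) p cs.

Lemma casimir_prod_cat cs ds p :
  casimir_prod (cs ++ ds) p = casimir_prod cs (casimir_prod ds p).
Proof. by rewrite /casimir_prod foldr_cat. Qed.

Lemma casimir_prod0 cs : casimir_prod cs 0 = 0.
Proof. by elim: cs => //= c cs ->; rewrite linear0 scaler0 subr0. Qed.

Lemma casimir_prod_casimir cs p :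
  casimir_prod cs (casimir p) = casimir (casimir_prod cs p).
Proof. 
elim: cs => //= c cs ->; rewrite [RHS]linearB; congr (_ - _).
by rewrite [RHS]linearZ.
Qed.

Lemma casimir_prod_sub cs (a : K) p q :
  casimir_prod cs (p - a *: q) = casimir_prod cs p - a *: casimir_prod cs q.
Proof.
elim: cs => //= e es ->.
rewrite [casimir (_ - _)]linearB /= [casimir (_ *: _)]linearZ /=.
move: (casimir (casimir_prod es p)) (casimir (casimir_prod es q)) => x y.
move: (casimir_prod es p) (casimir_prod es q) => u v.
rewrite !scalerBr !scalerA [a * _]mulrC.
by move: (_ *: u) (_ *: v) (_ *: y) => u' v' y'; ring.
Qed.

(** All factors are polynomials in one operator. This brings the factors that kill a given weight
    space next to the vector. *)
Lemma casimir_prodC cs ds p :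
  casimir_prod cs (casimir_prod ds p) = casimir_prod ds (casimir_prod cs p).
Proof.
elim: cs => //= c cs IHcs.
by rewrite casimir_prod_sub casimir_prod_casimir IHcs.
Qed.

Lemma casimir_prod_egl cs i j p :
  vfield (egl i j) (casimir_prod cs p) = casimir_prod cs (vfield (egl i j) p).
Proof.
elim: cs => //= c cs IHcs; rewrite [LHS]linearB /=; congr (_ - _).
  by rewrite -casimir_egl IHcs.
by rewrite linearZ /= IHcs.
Qed.

Lemma casimir_stable p : P p -> P (casimir p).
Proof.
move=> Pp; apply: subspace_sum => // i _; apply: subspace_sum => // j _.
by do 2 apply: stP.
Qed.

Lemma casimir_prod_stable cs p : P p -> P (casimir_prod cs p).
Proof.
move=> Pp; elim: cs => //= c cs IHcs.
by apply: subspaceB => //; [apply: casimir_stable | apply: subspaceZ].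
Qed.

Lemma casimir_prod_eigen (a : int) cs p : P (casimir p - a%:~R *: p) ->
  P (casimir_prod cs p - (\prod_(c <- cs) (a - c))%:~R *: p).
Proof.
move=> Pap; elim: cs => [|c cs IHcs] /=.
  by rewrite big_nil scale1r subrr; apply: subspace0.
rewrite big_cons; set b := \prod_(_ <- _) _ in IHcs *.
set g := casimir_prod cs p in IHcs *.
rewrite [X in P X](_ : _ = (casimir (g - b%:~R *: p) - c%:~R *: (g - b%:~R *: p))
    + b%:~R *: (casimir p - a%:~R *: p)).
  apply: subspaceD => //; last exact: subspaceZ.
  by apply: subspaceB => //; [apply: casimir_stable | apply: subspaceZ].
rewrite [casimir (_ - _)]linearB /= [casimir (_ *: _)]linearZ /=.
have -> : ((a - c) * b)%:~R = (a%:~R - c%:~R) * b%:~R :> K.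
  by rewrite intrM intrD mulrNz.
move: (casimir g) (casimir p) => x y.
rewrite !scalerBr !scalerA !mulrBl !scalerBl [b%:~R * _]mulrC.
move: (_ *: g) (_ *: y) (_ *: p) (_ *: p) => u v w t.
by ring.
Qed.

Lemma gl_weight_casimir l p : gl_weight l p -> gl_weight l (casimir p).
Proof.
move=> lp; apply: (subspace_sum (gl_weight_subspace l)) => i _.
apply: (subspace_sum (gl_weight_subspace l)) => j _ k.
have := gl_weight_egl i j (gl_weight_egl j i lp) k.
by rewrite (_ : l k + _ + _ = l k) //; lia.
Qed.

Lemma gl_weight_casimir_prod l cs p :
  gl_weight l p -> gl_weight l (casimir_prod cs p).
Proof.
move=> lp; elim: cs => //= c cs IHcs.
apply: (subspaceB (gl_weight_subspace l)); first exact: gl_weight_casimir.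
exact: (subspaceZ (gl_weight_subspace l)).
Qed.

Lemma diagzB n (d e : 'I_n -> int) :
  diagz K (fun k => d k - e k) = diagz K d - diagz K e.
Proof.
apply/matrixP => k k'; rewrite [RHS]mxE [(- diagz K e) k k']mxE !diagzE.
by rewrite rmorphB mulrnBl.
Qed.

(** If [l i < l j] for a simple root [egl i j], the weight for the corresponding sl_2 is negative.
    The degree in column [i] is the grading that makes lowering nilpotent. *)
Lemma highest_dominant l q :
  gl_weight l q -> highest P q -> dominant l \/ P q.
Proof.
move=> lq [q01 q12 _].
have sl2 i j : i != j -> P (vfield (egl i j) q) -> l i < l j -> P q.
  move=> ij qij lij.
  apply: (@negative_highest_weight _ _ charK0 P subP (egl i j) (egl j i)
    (fun k => coldeg i k - coldeg j k) (coldeg i) (l i - l j) (l i)) => //.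
  - by rewrite !eglM !eqxx !scale1r !egl_diag diagzB.
  - have ci := coldeg_egl i j i; have cj := coldeg_egl j j i.
    rewrite diagzB mulmxBl mulmxBr.
    move: ci cj.
    move: (_ *m _) (_ *m _) (_ *m _) (_ *m _) => u v w t.
    rewrite !eqxx [j == i]eq_sym (negPf ij) => ci cj.
        have -> : t - v - (w - u) = (t - w) - (v - u).
      by rewrite !opprB addrACA [RHS]addrACA [- v - w]addrC.
    by rewrite ci cj -scalerBl -rmorphB.
  - by rewrite coldeg_egl eqxx (negPf ij).
  - move=> k; case/mxvec_indexP: k => a k.
    by rewrite /coldeg weight2E.
  - by rewrite /homogeneous diagzB vfieldB !lq rmorphB scalerBl.
  - by rewrite Num.Theory.subr_lt0.
have [l10|l01] := boolP (l c1 <= l c0); last first.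
  by right; apply: (sl2 c0 c1) => //; lia.
have [l21|l12] := boolP (l c2 <= l c1); last first.
  by right; apply: (sl2 c1 c2) => //; lia.
by left; rewrite /dominant l21.
Qed.

End Modulo.

End GL3.

Lemma seq_argmax (T : eqType) (f : T -> nat) (s : seq T) : s != [::] ->
  exists2 x, x \in s & forall y, y \in s -> (f y <= f x)%N.
Proof.
elim: s => // x [_ _|y s IHs _].
  by exists x; rewrite ?mem_head // => y; rewrite inE => /eqP->.
have [//|z zs zmax] := IHs; have [xz|zx] := leqP (f x) (f z).
  exists z; first by rewrite inE zs orbT.
  by move=> t; rewrite inE => /predU1P[->//|]; apply: zmax.
exists x; first exact: mem_head.
move=> t; rewrite inE => /predU1P[->//|/zmax tz].
exact: leq_trans tz (ltnW zx).
Qed.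

Lemma ord3P (j : 'I_3) : [\/ j = c0, j = c1 | j = c2].
Proof.
by case: j => [[|[|[|//]]] lt3];
  [apply: Or31 | apply: Or32 | apply: Or33]; apply: val_inj.
Qed.

(** * Exact highest weight vectors from Casimir products *)

Section Lifting.
Variables (K : fieldType) (r : nat).
Hypothesis charK0 : [pchar K] =i pred0.
Local Notation S := {mpoly K[r * 3]}.
Local Notation egl := (@egl K r 3).
Local Notation coldeg := (@coldeg r 3).
Local Notation casimir := (@casimir K r 3).
Local Notation highest0 := (@highest K r (fun p => p = 0)).
Implicit Types (p q : S) (l : 'I_3 -> int) (P : S -> Prop).

Lemma zero_subspace : subspace (fun p => p = 0).
Proof.
by split=> // [p q -> ->|c p ->]; rewrite ?addr0 ?scaler0.
Qed.

Lemma zero_stable M : stable (fun p => p = 0) M.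
Proof. by move=> p ->; rewrite linear0. Qed.

Definition raise i j l : 'I_3 -> int :=
  fun k => l k + ((k == i)%:Z - (k == j)%:Z).

Definition dominates l' l :=
  [/\ l c0 <= l' c0, l c0 + l c1 <= l' c0 + l' c1 &
      l c0 + l c1 + l c2 = l' c0 + l' c1 + l' c2].

(** The difference of the values is [(l' - l, l' + l + 2 rho)]. In the proof [x] and [y] are the
    coefficients of [l' - l] on the simple roots, and their cofactors are the positive pairings of
    these roots with [l' + l + 2 rho]. *)
Lemma casimir_value_lt l l' : dominant l -> dominant l' -> dominates l' l ->
  l c0 + (l c0 + l c1) < l' c0 + (l' c0 + l' c1) ->
  casimir_value l < casimir_value l'.
Proof.
rewrite /dominant /dominates /casimir_value.
move: (l c0) (l c1) (l c2) (l' c0) (l' c1) (l' c2) => a b c a' b' c'.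
move=> /andP[cb ba] /andP[cb' ba'] [aa' ab s] lt.
pose x := a' - a; pose y := a' + b' - (a + b).
have E : a' ^+ 2 + b' ^+ 2 + c' ^+ 2 + 2 * (a' - c') =
    a ^+ 2 + b ^+ 2 + c ^+ 2 + 2 * (a - c) +
    (x * ((a' - b') + (a - b) + 2) + y * ((b' - c') + (b - c) + 2)).
  have -> : c' = a + b + c - a' - b' by lia.
  by rewrite /x /y; ring.
rewrite E Num.Theory.ltrDl {E}.
have [u_gt0 w_gt0] : 0 < (a' - b') + (a - b) + 2 /\ 0 < (b' - c') + (b - c) + 2.
  by split; lia.
have [x_ge0 y_ge0 xy] : [/\ 0 <= x, 0 <= y & 0 < x + y].
  by rewrite /x /y; split; lia.
move: x y (_ + 2) (_ + 2) u_gt0 w_gt0 x_ge0 y_ge0 xy => x y u w u0 w0 x0 y0 xy.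
have [xz|xnz] := eqVneq x 0.
  by rewrite xz mul0r add0r Num.Theory.mulr_gt0 //; lia.
have : 0 < x * u by apply: Num.Theory.mulr_gt0 => //; lia.
have : 0 <= y * w by apply: Num.Theory.mulr_ge0 => //; lia.
by lia.
Qed.

(** Recording that the factors come from dominant weights above [l] is what later separates their
    values from [casimir_value l]. *)
Definition annihilated l (cs : seq int) :=
  (forall c, c \in cs -> exists l',
     [/\ dominant l', dominates l' l & c = casimir_value l']) /\
  (forall p, gl_weight l p -> casimir_prod cs p = 0).

(** A raising operator commutes with the product and lands in a raised weight space, which one of
    the three blocks of factors kills. Each raising increases [2 l0 + l1], hence the strict
    inequality. *)
Lemma raised_annihilated l :
  (exists cs, annihilated (raise c0 c1 l) cs) ->
  (exists cs, annihilated (raise c1 c2 l) cs) ->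
  (exists cs, annihilated (raise c0 c2 l) cs) ->
  exists cs, (forall c, c \in cs -> exists l',
     [/\ dominant l', dominates l' l,
         l c0 + (l c0 + l c1) < l' c0 + (l' c0 + l' c1)
       & c = casimir_value l']) /\
  (forall p, gl_weight l p -> highest0 (casimir_prod cs p)).
Proof.
move=> [s1 [v1 a1]] [s2 [v2 a2]] [s3 [v3 a3]]; exists (s1 ++ s2 ++ s3); split.
  move=> c; rewrite !mem_cat => /or3P[/v1|/v2|/v3] [l' [dl' [d1 d2 d3] ->]];
    by exists l'; move: d1 d2 d3; rewrite /dominates /raise /=; split=> //;
      [split|]; lia.
move=> p lp; rewrite !casimir_prod_cat; split.
- rewrite !casimir_prod_egl casimir_prodC [casimir_prod s1 _]casimir_prodC.
  by rewrite (a1 _ (gl_weight_egl c0 c1 lp)) !casimir_prod0.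
- rewrite !casimir_prod_egl [casimir_prod s2 _]casimir_prodC.
  by rewrite (a2 _ (gl_weight_egl c1 c2 lp)) !casimir_prod0.
- rewrite !casimir_prod_egl.
  by rewrite (a3 _ (gl_weight_egl c0 c2 lp)) !casimir_prod0.
Qed.

Lemma gl_weight_ge0 l p j : gl_weight l p -> l j < 0 -> p = 0.
Proof.
move=> lp lj; apply: (homogeneous_lt0 charK0 _ lj (lp j)) => k.
by case/mxvec_indexP: k => a i; rewrite /coldeg weight2E.
Qed.

(** Every raising decreases [l c1 + 2 * l c2]; once this number is negative some column degree is
    negative and the weight space is zero. *)
Lemma exists_annihilated l : exists cs, annihilated l cs.
Proof.
have [N ltN] : exists N : nat, l c1 + 2 * l c2 < N%:Z.
  by exists `|l c1 + 2 * l c2|.+1; lia.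
elim: N l ltN => [|N IHN] l ltN.
  exists [::]; split=> // p lp.
  have [l1|l1] := boolP (l c1 < 0); first exact: gl_weight_ge0 lp l1.
  by apply: (gl_weight_ge0 lp (j := c2)); lia.
have [|||cs [vcs hcs]] := @raised_annihilated l; try by apply: IHN; rewrite /raise /=; lia.
have [dl|ndl] := boolP (dominant l).
  (* The factors [cs] make the vector exactly highest, so one more factor kills it. For a weight
     that is not dominant, being highest already forces it to vanish. *)
  exists (casimir_value l :: cs); split=> [c|p lp /=].
    rewrite inE => /predU1P[->|/vcs[l' [? ? _ ?]]]; last by exists l'.
    by exists l.
  apply: (casimir_highest zero_subspace (fun i j => @zero_stable _)); last exact: hcs.
  exact: gl_weight_casimir_prod.
exists cs; split=> [c /vcs[l' [? ? _ ?]]|p lp]; first by exists l'.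
have := highest_dominant charK0 zero_subspace (fun i j => @zero_stable _)
  (gl_weight_casimir_prod cs lp) (hcs p lp).
by case=> // dl; rewrite dl in ndl.
Qed.

(* Complete reducibility under gl_3, in the only form needed: to prove an
   inclusion of stable subspaces it suffices to look at highest weight vectors.
   The product of the [casimir - c], for the eigenvalues [c] occurring in higher
   weights, makes a vector that is highest modulo [I] truly highest. *)
Lemma highest_suffices (J I : S -> Prop) :
  subspace J -> subspace I ->
  (forall i j, stable J (egl i j)) -> (forall i j, stable I (egl i j)) ->
  (forall l q, J q -> gl_weight l q -> highest0 q -> I q) ->
  forall p, J p -> I p.
Proof.
move=> subJ subI stJ stI JI.
suff JIw l p : J p -> gl_weight l p -> I p.
  apply: (@multigraded_ind _ _ charK0
    [:: coldeg c0; coldeg c1; coldeg c2] J I subJ subI).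
    by move=> [|[|[|//]]] _ /=; rewrite -egl_diag; apply: stJ.
  move=> p Jp wp; have [a pa] := wp 0%N isT.
  have [b pb] := wp 1%N isT; have [c pc] := wp 2%N isT.
  apply: (JIw (fun k => if k == c0 then a else if k == c1 then b else c)) => //.
  by move=> j; case: (ord3P j) => ->.
have [N ltN] : exists N : nat, l c1 + 2 * l c2 < N%:Z.
  by exists `|l c1 + 2 * l c2|.+1; lia.
elim: N l p ltN => [|N IHN] l p ltN Jp lp.
  have [l1|l1] := boolP (l c1 < 0).
    by rewrite (gl_weight_ge0 lp l1); apply: subspace0.
  by rewrite (gl_weight_ge0 (j := c2) lp); [apply: subspace0 | lia].
(* The raised vectors are in [J] with a smaller [l c1 + 2 * l c2], so the induction puts them in
   [I]. *)
have hp : highest I p.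
  by split; (apply: IHN; [|exact: stJ Jp|exact: gl_weight_egl lp]); rewrite /=; lia.
have [dl|//] := highest_dominant charK0 subI stI lp hp.
have [cs [vcs hcs]] := raised_annihilated (exists_annihilated _)
  (exists_annihilated _) (exists_annihilated (raise c0 c2 l)).
(* The product is exactly highest, so [JI] applies to it. Modulo [I] it is [b] times [p], and [b] is
   nonzero because all values in [cs] strictly exceed [casimir_value l]. *)
have Iq : I (casimir_prod cs p).
  apply: (JI l) (hcs p lp); last exact: gl_weight_casimir_prod.
  exact: casimir_prod_stable.
have := casimir_prod_eigen subI stI cs (casimir_highest subI stI lp hp).
set b := \prod_(_ <- _) _ => Ib.
have b_neq0 : b%:~R != 0 :> K.
  rewrite pchar0_intr_eq0 // prodf_seq_neq0; apply/allP => c /vcs.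
  move=> [l' [dl' dll' ltl' ->]] /=.
  by have := casimir_value_lt dl dl' dll' ltl'; lia.
rewrite -(scalerK b_neq0 p); apply: subspaceZ => //.
rewrite (_ : _ *: p = casimir_prod cs p - (casimir_prod cs p - b%:~R *: p)).
  exact: subspaceB.
by rewrite subKr.
Qed.

Local Notation idx := (@mxvec_index r 3).

(** Look at the coefficient of [m x_ai / x_aj]. The monomial [m] contributes a positive multiple of
    its own coefficient; a contribution through another row [b] would come from one of the monomials
    excluded from the support. *)
Lemma vfield_egl_neq0 q (m : 'X_{1..r * 3}) a i j :
  m \in msupp q -> m (idx a j) != 0%N -> i != j ->
  (forall b, b != a -> m (idx b i) != 0%N ->
     (m - U_(idx a j) + U_(idx a i) - U_(idx b i) + U_(idx b j))%MM
       \notin msupp q) ->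
  vfield (egl i j) q <> 0.
Proof.
move=> mq maj ij notq /(congr1 (mcoeff (m - U_(idx a j) + U_(idx a i))%MM)).
rewrite mcoeff0.
have -> : vfield (egl i j) q = \sum_b mvar K b i * q^`M(idx b j).
  rewrite vfieldE sum_mxvec_index; apply: eq_bigr => b _.
  rewrite (bigD1 j) //= linform_egl eqxx scale1r big1 ?addr0 // => k kj.
  by rewrite linform_egl eq_sym (negPf kj) scale0r mul0r.
rewrite raddf_sum (bigD1 a) //= big1 ?addr0; last first.
  move=> b ba; rewrite mcoeff_mulXU mcoeff_deriv.
  case mb: (_ != 0%N); last by rewrite mul0r.
  rewrite mul1r.
  have mbi : m (idx b i) != 0%N.
    move: mb; rewrite mnmDE mnmBE !mnm1E !mxvec_index_eq ![a == b]eq_sym.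
    by rewrite (negPf ba) /= subn0 addn0 => ->.
  by rewrite (memN_msupp_eq0 (notq b ba mbi)) mul0rn.
rewrite mcoeff_mulXU mcoeff_deriv.
have -> : (m - U_(idx a j) + U_(idx a i))%MM (idx a i) != 0%N.
  by rewrite mnmDE mnm1E eqxx addn1.
rewrite mul1r addmK submK; last by rewrite lep1mP.
move/eqP; rewrite -mulr_natr mulf_eq0 -[_ == 0]negbK -mcoeff_msupp mq /=.
by move/pcharf0P: charK0 => ->.
Qed.

(* The monomial maximising first the exponent of [x_(a0,0)] and then that of
   [x_(a1,1)]: the coefficient of any of the excluded variables would be moved
   by a raising operator. *)
Lemma highest_monomial q a0 a1 : a0 != a1 -> q <> 0 -> highest0 q ->
  exists2 m, m \in msupp q &
    [/\ m (idx a0 c1) = 0%N, m (idx a0 c2) = 0%N & m (idx a1 c2) = 0%N].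
Proof.
move=> a01 q_neq0 [q01 q12 q02].
have sq : msupp q != [::] by rewrite msupp_eq0; apply/eqP.
have [m0 m0q m0max] := seq_argmax (fun m : 'X_{1..r * 3} => m (idx a0 c0)) sq.
pose s := [seq m : 'X_{1..r * 3} <- msupp q | m (idx a0 c0) == m0 (idx a0 c0)].
have ss : s != [::].
  by apply/eqP => s0; have : m0 \in s; [rewrite mem_filter eqxx | rewrite s0].
have [m ms mmax] := seq_argmax (fun m : 'X_{1..r * 3} => m (idx a1 c1)) ss.
move: ms; rewrite mem_filter => /andP[/eqP mm0 mq]; exists m => //.
have max0 m' : m' \in msupp q -> (m' (idx a0 c0) <= m (idx a0 c0))%N.
  by rewrite mm0; apply: m0max.
have row0 j : j != c0 -> vfield (egl c0 j) q = 0 -> m (idx a0 j) = 0%N.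
  move=> j0 qj; apply/eqP/contraT => maj.
  have := vfield_egl_neq0 (i := c0) mq maj; rewrite qj eq_sym j0.
  case=> // b ba mb; apply/negP => /max0.
  rewrite !(mnmDE, mnmBE, mnm1E, mxvec_index_eq) !eqxx (negPf ba) (negPf j0) /=.
  by lia.
have m01 : m (idx a0 c1) = 0%N by apply: row0.
have m02 : m (idx a0 c2) = 0%N by apply: row0.
split=> //; apply/eqP/contraT => maj.
have := vfield_egl_neq0 (i := c1) mq maj; rewrite q12; case=> // b ba mb.
have ba0 : b != a0 by apply: contraNneq mb => ->; rewrite m01.
apply/negP => m'q.
set m' := (_ + _)%MM in m'q.
have m'00 : m' (idx a0 c0) = m (idx a0 c0).
  rewrite !(mnmDE, mnmBE, mnm1E, mxvec_index_eq) (negPf ba0).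
  by rewrite ![a1 == a0]eq_sym (negPf a01) /=; lia.
have m'11 : m' (idx a1 c1) = (m (idx a1 c1)).+1.
  rewrite !(mnmDE, mnmBE, mnm1E, mxvec_index_eq) (negPf ba) eqxx /=; lia.
have := mmax m'; rewrite mem_filter m'00 mm0 eqxx m'q m'11 => /(_ isT).
by rewrite ltnn.
Qed.

End Lifting.

(** * The minuscule representation of E_6 *)

(* A sparse integer matrix: the list of its entries [(row, column, value)],
   values at the same place being added. *)
Definition sparse := seq (nat * nat * int).

Definition sp_coef (l : sparse) (i j : nat) : int :=
  foldr (fun t x => if (t.1.1 == i) && (t.1.2 == j) then t.2 + x else x) 0 l.
Definition sp_opp (l : sparse) : sparse := [seq (t.1, - t.2) | t <- l].
Definition sp_tr (l : sparse) : sparse :=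
  [seq ((t.1.2, t.1.1), t.2) | t <- l].
Definition sp_mul (l1 l2 : sparse) : sparse :=
  flatten [seq [seq ((t.1.1, u.1.2), t.2 * u.2) | u <- l2 & t.1.2 == u.1.1]
          | t <- l1].
Definition sp_comm (l1 l2 : sparse) : sparse :=
  sp_mul l1 l2 ++ sp_opp (sp_mul l2 l1).
Definition sp_diag (n : nat) (f : nat -> int) : sparse :=
  [seq ((a, a), f a) | a <- iota 0 n].
Definition sp_scale (c : int) (l : sparse) : sparse :=
  [seq (t.1, c * t.2) | t <- l].
(** Coefficients away from the listed positions are zero, so this finite test over the integers
    proves the vanishing of the matrix over every field. *)
Definition sp_is0 (l : sparse) : bool :=
  all (fun t => sp_coef l t.1.1 t.1.2 == 0) l.
(** Products of lists match arbitrary natural indices, whereas a product of matrices sums only over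
    indices below [n]; the bound reconciles the two. *)
Definition sp_bounded (n : nat) (l : sparse) : bool :=
  all (fun t => (t.1.1 < n)%N && (t.1.2 < n)%N) l.

Lemma sp_coef_eq0 l r c :
  (forall t, t \in l -> ~~ ((t.1.1 == r) && (t.1.2 == c))) -> sp_coef l r c = 0.
Proof.
elim: l => //= t l IHl lN; rewrite (negPf (lN t (mem_head _ _))); apply: IHl => u ul.
by apply: lN; rewrite inE ul orbT.
Qed.

Section SparseMatrix.
Variables (K : fieldType) (n : nat).

Definition nat_delta (r c : nat) : 'M[K]_n :=
  \matrix_(i, j) ((val i == r) && (val j == c))%:R.

Definition sp_mx (l : sparse) : 'M[K]_n :=
  \sum_(t <- l) t.2%:~R *: nat_delta t.1.1 t.1.2.

Lemma sp_mxE l i j : sp_mx l i j = (sp_coef l i j)%:~R.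
Proof.
rewrite /sp_mx summxE; elim: l => [|[[r c] s] l IHl]; first by rewrite big_nil.
rewrite big_cons IHl /= !mxE [r == _]eq_sym [c == _]eq_sym.
by case: (_ && _); rewrite ?mulr1 ?mulr0 ?add0r // -rmorphD.
Qed.

Lemma sp_mx_cat l1 l2 : sp_mx (l1 ++ l2) = sp_mx l1 + sp_mx l2.
Proof. by rewrite /sp_mx big_cat. Qed.

Lemma sp_mx_opp l : sp_mx (sp_opp l) = - sp_mx l.
Proof.
rewrite /sp_mx big_map -sumrN; apply: eq_bigr => t _.
by rewrite rmorphN scaleNr.
Qed.

Lemma sp_mx_scale c l : sp_mx (sp_scale c l) = c%:~R *: sp_mx l.
Proof.
rewrite /sp_mx big_map scaler_sumr; apply: eq_bigr => t _.
by rewrite rmorphM scalerA.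
Qed.

Lemma sp_mx_tr l : sp_mx (sp_tr l) = (sp_mx l)^T.
Proof.
rewrite /sp_mx big_map linear_sum; apply: eq_bigr => t _ /=.
by rewrite linearZ; congr (_ *: _); apply/matrixP => i j; rewrite !mxE andbC.
Qed.

Lemma sp_mx_flatten ls : sp_mx (flatten ls) = \sum_(l <- ls) sp_mx l.
Proof.
elim: ls => [|l ls IHls]; first by rewrite big_nil /sp_mx big_nil.
by rewrite big_cons /= sp_mx_cat IHls.
Qed.

Lemma nat_deltaM r c r' c' : (c < n)%N ->
  nat_delta r c *m nat_delta r' c' = (c == r')%:R *: nat_delta r c'.
Proof.
move=> cn; apply/matrixP => i j; rewrite !mxE (bigD1 (Ordinal cn)) //=.
rewrite !mxE /= eqxx andbT big1 ?addr0 => [|k /negPf kc].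
  by case: (_ == r); case: (_ == c'); case: (c == r');
    rewrite ?(mulr0, mul0r, mulr1).
rewrite !mxE; have -> : (val k == c) = false by rewrite -kc -val_eqE.
by rewrite andbF mul0r.
Qed.

Lemma sp_mxM l1 l2 : sp_bounded n l1 ->
  sp_mx (sp_mul l1 l2) = sp_mx l1 *m sp_mx l2.
Proof.
move=> /allP b1; rewrite sp_mx_flatten big_map [sp_mx l1]/sp_mx mulmx_suml.
apply: eq_big_seq => t /b1/andP[_ tn].
rewrite /sp_mx big_map big_filter mulmx_sumr big_mkcond /=.
apply: eq_bigr => u _; rewrite -scalemxAl -scalemxAr nat_deltaM // !scalerA.
by rewrite rmorphM; case: eqP; rewrite ?mulr1 // mulr0 scale0r.
Qed.

Lemma sp_mx_comm l1 l2 : sp_bounded n l1 -> sp_bounded n l2 ->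
  sp_mx (sp_comm l1 l2) = sp_mx l1 *m sp_mx l2 - sp_mx l2 *m sp_mx l1.
Proof. by move=> b1 b2; rewrite sp_mx_cat sp_mx_opp !sp_mxM. Qed.

Lemma sp_mx_diag f : sp_mx (sp_diag n f) = diagz K (fun i : 'I_n => f i).
Proof.
apply/matrixP => i j; rewrite diagzE /sp_mx big_map summxE.
rewrite -{1}[n]subn0 -/(index_iota 0 n) big_mkord (bigD1 i) //= big1 ?addr0.
  by rewrite !mxE eqxx val_eqE eq_sym mulr_natr.
move=> k ki; rewrite !mxE; have -> : (val i == k) = false.
  by apply/negbTE; rewrite val_eqE eq_sym.
by rewrite mulr0.
Qed.

Lemma sp_is0P l : sp_is0 l -> sp_mx l = 0.
Proof.
move=> /allP l0; apply/matrixP => i j; rewrite sp_mxE mxE.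
have [/mapP[[[r c] s] /l0 /eqP /= rc0 [-> ->]]|ijl] :=
  boolP ((val i, val j) \in [seq t.1 | t <- l]); first by rewrite rc0.
suff -> : sp_coef l i j = 0 by [].
elim: l ijl {l0} => //= t l IHl; rewrite inE negb_or => /andP[/negPf tij /IHl->].
by rewrite -xpair_eqE -surjective_pairing eq_sym tij.
Qed.

Lemma sp_eq l1 l2 : sp_is0 (l1 ++ sp_opp l2) -> sp_mx l1 = sp_mx l2.
Proof.
move/sp_is0P; rewrite sp_mx_cat sp_mx_opp => /eqP.
by rewrite subr_eq0 => /eqP.
Qed.

End SparseMatrix.

(* [(b, a)] is in the list of index [i] when the root operator of the node
   [i.+1] lowers the weight vector [a] to the weight vector [b]. *)
Definition e6_lowering : seq (seq (nat * nat)) :=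
  [:: [:: (1, 0); (12, 10); (15, 13); (17, 16); (19, 18); (21, 20)];
      [:: (4, 3); (6, 5); (9, 7); (20, 18); (21, 19); (23, 22)];
      [:: (2, 1); (10, 8); (13, 11); (16, 14); (22, 19); (23, 21)];
      [:: (3, 2); (8, 6); (11, 9); (18, 16); (19, 17); (24, 23)];
      [:: (5, 3); (6, 4); (14, 11); (16, 13); (17, 15); (25, 24)];
      [:: (7, 5); (9, 6); (11, 8); (13, 10); (15, 12); (26, 25)]]%N.

(* Row [a] lists the coefficients of (highest weight) - (weight of [a]) on the
   simple roots. *)
Definition e6_depth : seq (seq nat) :=
  [:: [:: 0; 0; 0; 0; 0; 0]; [:: 1; 0; 0; 0; 0; 0]; [:: 1; 0; 1; 0; 0; 0];
      [:: 1; 0; 1; 1; 0; 0]; [:: 1; 1; 1; 1; 0; 0]; [:: 1; 0; 1; 1; 1; 0];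
      [:: 1; 1; 1; 1; 1; 0]; [:: 1; 0; 1; 1; 1; 1]; [:: 1; 1; 1; 2; 1; 0];
      [:: 1; 1; 1; 1; 1; 1]; [:: 1; 1; 2; 2; 1; 0]; [:: 1; 1; 1; 2; 1; 1];
      [:: 2; 1; 2; 2; 1; 0]; [:: 1; 1; 2; 2; 1; 1]; [:: 1; 1; 1; 2; 2; 1];
      [:: 2; 1; 2; 2; 1; 1]; [:: 1; 1; 2; 2; 2; 1]; [:: 2; 1; 2; 2; 2; 1];
      [:: 1; 1; 2; 3; 2; 1]; [:: 2; 1; 2; 3; 2; 1]; [:: 1; 2; 2; 3; 2; 1];
      [:: 2; 2; 2; 3; 2; 1]; [:: 2; 1; 3; 3; 2; 1]; [:: 2; 2; 3; 3; 2; 1];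
      [:: 2; 2; 3; 4; 2; 1]; [:: 2; 2; 3; 4; 3; 1]; [:: 2; 2; 3; 4; 3; 2]]%N.

(* A word [i; j; ..; k] stands for the positive root whose root vector is the
   iterated bracket [e_i, [e_j, .. e_k]]. *)
Definition e6_root_words : seq (seq nat) :=
  [:: [:: 0]; [:: 1]; [:: 2]; [:: 3]; [:: 4]; [:: 5]; [:: 2; 0]; [:: 3; 1];
      [:: 3; 2]; [:: 4; 3]; [:: 5; 4]; [:: 3; 2; 0]; [:: 2; 3; 1];
      [:: 4; 3; 1]; [:: 4; 3; 2]; [:: 5; 4; 3]; [:: 1; 3; 2; 0];
      [:: 4; 3; 2; 0]; [:: 4; 2; 3; 1]; [:: 5; 4; 3; 1]; [:: 5; 4; 3; 2];
      [:: 4; 1; 3; 2; 0]; [:: 5; 4; 3; 2; 0]; [:: 3; 4; 2; 3; 1];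
      [:: 5; 4; 2; 3; 1]; [:: 3; 4; 1; 3; 2; 0]; [:: 5; 4; 1; 3; 2; 0];
      [:: 5; 3; 4; 2; 3; 1]; [:: 2; 3; 4; 1; 3; 2; 0];
      [:: 5; 3; 4; 1; 3; 2; 0]; [:: 4; 5; 3; 4; 2; 3; 1];
      [:: 5; 2; 3; 4; 1; 3; 2; 0]; [:: 4; 5; 3; 4; 1; 3; 2; 0];
      [:: 4; 5; 2; 3; 4; 1; 3; 2; 0]; [:: 3; 4; 5; 2; 3; 4; 1; 3; 2; 0];
      [:: 1; 3; 4; 5; 2; 3; 4; 1; 3; 2; 0]]%N.

(* The partial derivatives of the invariant cubic: [(a, b, s)] is the monomial
   [s x_a x_b]. *)
Definition e6_quadric_table : seq (seq (nat * nat * int)) :=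
  [:: [:: (0, 12, 1); (1, 10, -1); (2, 8, 1); (3, 6, -1); (4, 5, 1)];
      [:: (0, 15, 1); (1, 13, -1); (2, 11, 1); (3, 9, -1); (4, 7, 1)];
      [:: (0, 17, 1); (1, 16, -1); (2, 14, 1); (5, 9, -1); (6, 7, 1)];
      [:: (0, 19, 1); (1, 18, -1); (3, 14, 1); (5, 11, -1); (7, 8, 1)];
      [:: (0, 21, 1); (1, 20, -1); (4, 14, 1); (6, 11, -1); (8, 9, 1)];
      [:: (0, 22, 1); (2, 18, -1); (3, 16, 1); (5, 13, -1); (7, 10, 1)];
      [:: (0, 23, 1); (2, 20, -1); (4, 16, 1); (6, 13, -1); (9, 10, 1)];
      [:: (0, 24, 1); (3, 20, -1); (4, 18, 1); (8, 13, -1); (10, 11, 1)];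
      [:: (0, 25, 1); (5, 20, -1); (6, 18, 1); (8, 16, -1); (10, 14, 1)];
      [:: (0, 26, 1); (7, 20, -1); (9, 18, 1); (11, 16, -1); (13, 14, 1)];
      [:: (1, 22, 1); (2, 19, -1); (3, 17, 1); (5, 15, -1); (7, 12, 1)];
      [:: (1, 23, 1); (2, 21, -1); (4, 17, 1); (6, 15, -1); (9, 12, 1)];
      [:: (1, 24, 1); (3, 21, -1); (4, 19, 1); (8, 15, -1); (11, 12, 1)];
      [:: (1, 25, 1); (5, 21, -1); (6, 19, 1); (8, 17, -1); (12, 14, 1)];
      [:: (1, 26, 1); (7, 21, -1); (9, 19, 1); (11, 17, -1); (14, 15, 1)];
      [:: (2, 24, 1); (3, 23, -1); (4, 22, 1); (10, 15, -1); (12, 13, 1)];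
      [:: (2, 25, 1); (5, 23, -1); (6, 22, 1); (10, 17, -1); (12, 16, 1)];
      [:: (2, 26, 1); (7, 23, -1); (9, 22, 1); (13, 17, -1); (15, 16, 1)];
      [:: (3, 25, 1); (5, 24, -1); (8, 22, 1); (10, 19, -1); (12, 18, 1)];
      [:: (3, 26, 1); (7, 24, -1); (11, 22, 1); (13, 19, -1); (15, 18, 1)];
      [:: (4, 25, 1); (6, 24, -1); (8, 23, 1); (10, 21, -1); (12, 20, 1)];
      [:: (4, 26, 1); (9, 24, -1); (11, 23, 1); (13, 21, -1); (15, 20, 1)];
      [:: (5, 26, 1); (7, 25, -1); (14, 22, 1); (16, 19, -1); (17, 18, 1)];
      [:: (6, 26, 1); (9, 25, -1); (14, 23, 1); (16, 21, -1); (17, 20, 1)];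
      [:: (8, 26, 1); (11, 25, -1); (14, 24, 1); (18, 21, -1); (19, 20, 1)];
      [:: (10, 26, 1); (13, 25, -1); (16, 24, 1); (18, 23, -1); (20, 22, 1)];
      [:: (12, 26, 1); (15, 25, -1); (17, 24, 1); (19, 23, -1); (21, 22, 1)]].

Definition depth (k a : nat) : int := (nth 0%N (nth [::] e6_depth a) k)%:Z.

Arguments depth (k a)%_N.

Definition cartan (i j : nat) : int :=
  nth 0 (nth [::]
    [:: [:: 2; 0; -1; 0; 0; 0]; [:: 0; 2; 0; -1; 0; 0]; [:: -1; 0; 2; -1; 0; 0];
        [:: 0; -1; -1; 2; -1; 0]; [:: 0; 0; 0; -1; 2; -1];
        [:: 0; 0; 0; 0; -1; 2]] i) j.

Definition sum_nodes (f : nat -> int) : int := foldr (fun k x => f k + x) 0 (iota 0 6).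

Definition e6_weight (i a : nat) : int :=
  (i == 0%N)%:Z - sum_nodes (fun k => cartan i k * depth k a).

(** For the form in which roots have square length 2, [(omega_1, omega_1) = 4/3], and this number is
    [1/3 - (wt a, wt b)]: the Cartan part of the split Casimir operator, moved to the other side of
    [root_tensor]. *)
Definition gram (a b : nat) : int :=
  depth 0 a + depth 0 b - 1 -
    sum_nodes (fun k => sum_nodes (fun l => cartan k l * (depth k a * depth l b))).

Definition sp_lower (i : nat) : sparse :=
  [seq (p, 1) | p <- nth [::] e6_lowering i].
Definition sp_raise (i : nat) : sparse := sp_tr (sp_lower i).

Fixpoint sp_root (w : seq nat) : sparse :=
  match w with
  | [::] => [::]
  | [:: i] => sp_raise i
  | i :: w' => sp_comm (sp_raise i) (sp_root w')
  end.

Definition sp_quadric (k : nat) : sparse :=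
  let l := nth [::] e6_quadric_table k in l ++ sp_tr l.

Definition nodes := iota 0 6.
Definition indices := iota 0 27.

Lemma bounded_lower : all (fun i => sp_bounded 27 (sp_lower i)) nodes.
Proof. by vm_compute. Qed.

Lemma check_comm_raise_lower : all (fun i => all (fun j =>
   sp_is0 (sp_comm (sp_raise i) (sp_lower j) ++
           sp_opp (if i == j then sp_diag 27 (e6_weight i) else [::]))) nodes) nodes.
Proof. by vm_compute. Qed.

Lemma check_square : all (fun i => sp_is0 (sp_mul (sp_lower i) (sp_lower i))) nodes.
Proof. by vm_compute. Qed.

Lemma check_depth_root : all (fun w => all (fun k =>
    sp_is0 (sp_comm (sp_diag 27 (depth k)) (sp_root w) ++
            sp_opp (sp_scale (- (count_mem k w)%:Z) (sp_root w)))) nodes) e6_root_words.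
Proof. by vm_compute. Qed.

Definition e6_roots : seq sparse := [seq sp_root w | w <- e6_root_words].

Lemma check_weight_lower : all (fun i => all (fun j =>
    sp_is0 (sp_comm (sp_diag 27 (e6_weight i)) (sp_lower j) ++
            sp_scale (cartan i j) (sp_lower j))) nodes) nodes.
Proof. by vm_compute. Qed.

(** The brackets add up to the sum of the positive coroots, whose value on
    [omega_1 - sum_k d_k alpha_k] is [16 - 2 sum_k d_k]. *)
Lemma check_two_rho :
  sp_is0 (flatten [seq sp_comm l (sp_tr l) | l <- e6_roots] ++
    sp_opp (sp_diag 27 (fun a => 16 - 2 * sum_nodes (fun k => depth k a)))).
Proof. by vm_compute. Qed.

(** Each weight of the minuscule representation pairs to 1 or -1 with exactly 16 of the 36 positive
    roots, and to 0 with the others. *)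
Lemma check_casimir_scalar :
  sp_is0 (flatten [seq sp_mul l (sp_tr l) ++ sp_mul (sp_tr l) l | l <- e6_roots] ++
    sp_opp (sp_diag 27 (fun => 16))).
Proof. by vm_compute. Qed.

Definition tensor_check (ls qs : seq sparse) (a b : nat) : bool :=
  sp_is0 (flatten [seq sp_mul (sp_mul l [:: (a, b, 1)]) l ++
                     sp_mul (sp_mul (sp_tr l) [:: (a, b, 1)]) (sp_tr l)
                  | l <- ls] ++
     sp_opp ((b, a, 1) :: (a, b, gram a b) ::
       flatten [seq sp_scale (- sp_coef q a b) q | q <- qs & sp_coef q a b != 0])).

Definition e6_quadrics : seq sparse := [seq sp_quadric k | k <- indices].

(** Abstracting over the two lists lets call-by-value evaluation compute them once for all pairs of
    indices. *)
Lemma check_tensor :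
  (fun ls qs => all (fun a => all (tensor_check ls qs a) indices) indices)
    e6_roots e6_quadrics.
Proof. by vm_compute. Qed.

Definition sp_act (l q : sparse) : sparse := sp_mul l q ++ sp_mul q (sp_tr l).

(** The 27 quadrics have distinct weights, so a pair of indices occurs in at most one of them and
    the first entry of [l] determines the only candidate. Only the multiples 0, 1 and -1 arise. *)
Definition sp_in_quadrics (l : sparse) : bool :=
  if l is t :: _ then
    let q := nth [::] e6_quadrics
      (find (fun q => sp_coef q t.1.1 t.1.2 != 0) e6_quadrics) in
    [|| sp_is0 l, sp_is0 (l ++ sp_opp q) | sp_is0 (l ++ q)]
  else true.

(** The last two tests concern the coefficient of [t^2] in the action of [1 + t A] on a quadric. Its
    vanishing makes the span of the quadrics stable under the group and not only under the Lie
    algebra. *)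
Lemma check_act_quadric : all (fun i => all (fun k =>
  [&& sp_in_quadrics (sp_act (sp_raise i) (sp_quadric k)),
      sp_in_quadrics (sp_act (sp_lower i) (sp_quadric k)),
      sp_is0 (sp_mul (sp_mul (sp_raise i) (sp_quadric k)) (sp_lower i)) &
      sp_is0 (sp_mul (sp_mul (sp_lower i) (sp_quadric k)) (sp_raise i))]) indices) nodes.
Proof. by vm_compute. Qed.

(** No monomial of a quadric involves only the coordinates 0, 1, 2: the quadrics vanish on the fibre
    of [R_3] at the base point. *)
Lemma check_quadric_top : all (fun k =>
  all (fun t => (2 < t.1.1)%N || (2 < t.1.2)%N) (sp_quadric k)) indices.
Proof. by vm_compute. Qed.

Lemma check_bounded_quadric : all (fun k => sp_bounded 27 (sp_quadric k)) indices.
Proof. by vm_compute. Qed.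

(* Three times the inverse Cartan matrix. *)
Definition cartan_inv3 : seq (seq int) :=
  [:: [:: 4; 3; 5; 6; 4; 2]; [:: 3; 6; 6; 9; 6; 3]; [:: 5; 6; 10; 12; 8; 4];
      [:: 6; 9; 12; 18; 12; 6]; [:: 4; 6; 8; 12; 10; 5];
      [:: 2; 3; 4; 6; 5; 4]].

Lemma check_depth_weight : all (fun k => all (fun a =>
  3 * depth k a == sum_nodes (fun i => nth 0 (nth [::] cartan_inv3 k) i *
                                       ((i == 0%N)%:Z - e6_weight i a)))
  indices) nodes.
Proof. by vm_compute. Qed.

(** All weights have the same length, so [gram a a] is [1/3 - 4/3]. The bound 10 serves to turn the
    depth into a nonnegative grading that lowering decreases. *)
Lemma check_depth : all (fun a => [&& gram a a == -1,
  (depth 0 a == 0) == (a == 0%N), (depth 2 a == 0) == (a < 2)%N,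
  (depth 3 a == 0) == (a < 3)%N & all (fun k => depth k a <= 10) nodes]) indices.
Proof. by vm_compute. Qed.

Lemma check_root_words :
  all (fun w => 0 < sum_nodes (fun k => (count_mem k w)%:Z)) e6_root_words.
Proof. by vm_compute. Qed.

Lemma sp_bounded_tr n l : sp_bounded n l -> sp_bounded n (sp_tr l).
Proof.
by move=> /allP bl; apply/allP => _ /mapP[t /bl /andP[? ?] ->] /=; apply/andP.
Qed.

Lemma sp_bounded_mul n l1 l2 :
  sp_bounded n l1 -> sp_bounded n l2 -> sp_bounded n (sp_mul l1 l2).
Proof.
move=> /allP b1 /allP b2; apply/allP => x /flatten_mapP[t /b1 /andP[t1 _]].
case/mapP => u; rewrite mem_filter => /andP[_ /b2/andP[_ u2]] -> /=.
by rewrite t1.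
Qed.

Lemma sp_bounded_comm n l1 l2 :
  sp_bounded n l1 -> sp_bounded n l2 -> sp_bounded n (sp_comm l1 l2).
Proof.
move=> b1 b2; rewrite /sp_bounded all_cat -/(sp_bounded n _) sp_bounded_mul //=.
by rewrite all_map; apply: sp_bounded_mul.
Qed.

Lemma sp_bounded_diag n f : sp_bounded n (sp_diag n f).
Proof.
by apply/allP => _ /mapP[a + ->] /=; rewrite mem_iota add0n leq0n /= => ->.
Qed.

Lemma sp_bounded_lower i : sp_bounded 27 (sp_lower i).
Proof.
have [i6|i6] := ltnP i 6; last by rewrite /sp_lower nth_default.
by apply: (allP bounded_lower); rewrite mem_iota.
Qed.

Lemma sp_bounded_raise i : sp_bounded 27 (sp_raise i).
Proof. exact/sp_bounded_tr/sp_bounded_lower. Qed.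

Lemma sp_root_cons i j w :
  sp_root [:: i, j & w] = sp_comm (sp_raise i) (sp_root (j :: w)).
Proof. by []. Qed.

Lemma sp_bounded_root w : sp_bounded 27 (sp_root w).
Proof.
case: w => // i w; elim: w i => [|j w IHw] i; first exact: sp_bounded_raise.
by rewrite sp_root_cons; apply: sp_bounded_comm; first exact: sp_bounded_raise.
Qed.

Section MinusculeModel.
Variable K : fieldType.
Local Notation mx := (sp_mx K 27).

Definition raise_mx i := mx (sp_raise i).
Definition lower_mx i := mx (sp_lower i).
Definition root_mx w := mx (sp_root w).
Definition quadric_mx k := mx (sp_quadric k).

Lemma raise_mxE i : raise_mx i = (lower_mx i)^T.
Proof. exact: sp_mx_tr. Qed.

Lemma lower_mxE i : lower_mx i = (raise_mx i)^T.
Proof. by rewrite raise_mxE trmxK. Qed.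

Lemma root_mx_simple i : root_mx [:: i] = raise_mx i.
Proof. by []. Qed.

Lemma root_mx_cons i j w : root_mx [:: i, j & w] =
  raise_mx i *m root_mx (j :: w) - root_mx (j :: w) *m raise_mx i.
Proof.
rewrite /root_mx sp_root_cons sp_mx_comm //; first exact: sp_bounded_raise.
exact: sp_bounded_root.
Qed.

Lemma raise_lower_comm i j : (i < 6)%N -> (j < 6)%N ->
  raise_mx i *m lower_mx j - lower_mx j *m raise_mx i =
  if i == j then diagz K (fun a : 'I_27 => e6_weight i a) else 0.
Proof.
move=> i6 j6; rewrite -sp_mx_comm ?sp_bounded_raise ?sp_bounded_lower //.
have /allP/(_ i) := check_comm_raise_lower; rewrite mem_iota => /(_ i6).
move=> /allP/(_ j); rewrite mem_iota => /(_ j6)/sp_eq->.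
case: eqP => _; first exact: sp_mx_diag.
by rewrite /sp_mx big_nil.
Qed.

Lemma lower_mx_sq i : (i < 6)%N -> lower_mx i *m lower_mx i = 0.
Proof.
move=> i6; rewrite -sp_mxM ?sp_bounded_lower //; apply: sp_is0P.
by apply: (allP check_square); rewrite mem_iota.
Qed.

Lemma raise_mx_sq i : (i < 6)%N -> raise_mx i *m raise_mx i = 0.
Proof. by move=> i6; rewrite raise_mxE -trmx_mul lower_mx_sq ?trmx0. Qed.

Lemma depth_root_comm k w : (k < 6)%N -> w \in e6_root_words ->
  diagz K (fun a : 'I_27 => depth k a) *m root_mx w -
    root_mx w *m diagz K (fun a : 'I_27 => depth k a) =
  (- (count_mem k w)%:Z)%:~R *: root_mx w.
Proof.
move=> k6 /(allP check_depth_root)/allP/(_ k); rewrite mem_iota => /(_ k6)/sp_eq.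
move=> /(_ K 27); rewrite sp_mx_comm ?sp_bounded_diag ?sp_bounded_root //.
by rewrite sp_mx_diag sp_mx_scale.
Qed.

Lemma weight_lower_comm i j : (i < 6)%N -> (j < 6)%N ->
  diagz K (fun a : 'I_27 => e6_weight i a) *m lower_mx j -
    lower_mx j *m diagz K (fun a : 'I_27 => e6_weight i a) =
  - ((cartan i j)%:~R *: lower_mx j).
Proof.
move=> i6 j6; have /allP/(_ i) := check_weight_lower.
rewrite mem_iota => /(_ i6)/allP/(_ j); rewrite mem_iota => /(_ j6)/sp_is0P.
move=> /(_ K 27); rewrite sp_mx_cat sp_mx_comm ?sp_bounded_diag ?sp_bounded_lower //.
by rewrite sp_mx_diag sp_mx_scale => /eqP; rewrite addr_eq0 => /eqP.
Qed.

Lemma diagz_tr n (d : 'I_n -> int) : (diagz K d)^T = diagz K d.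
Proof. exact: tr_diag_mx. Qed.

Lemma depth_lower_comm i : (i < 6)%N ->
  diagz K (fun a : 'I_27 => depth i a) *m lower_mx i -
    lower_mx i *m diagz K (fun a : 'I_27 => depth i a) = lower_mx i.
Proof.
move=> i6; have iw : [:: i] \in e6_root_words.
  by move: i i6; do 6!case=> //.
have := congr1 trmx (depth_root_comm i6 iw); rewrite root_mx_simple raise_mxE.
rewrite linearB linearZ /= !trmx_mul !trmxK diagz_tr /= eqxx addn0.
rewrite rmorphN scaleN1r => E; rewrite -[RHS]opprK -E opprB.
by [].
Qed.

Lemma sum_root_comm :
  \sum_(w <- e6_root_words)
    (root_mx w *m (root_mx w)^T - (root_mx w)^T *m root_mx w) =
  diagz K (fun a : 'I_27 => 16 - 2 * sum_nodes (fun k => depth k a)).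
Proof.
rewrite -(sp_mx_diag K 27 (fun a => 16 - 2 * sum_nodes (fun k => depth k a))).
rewrite -(sp_eq K 27 check_two_rho) sp_mx_flatten !big_map.
apply: eq_bigr => w _; rewrite sp_mx_comm ?sp_bounded_tr ?sp_bounded_root //.
by rewrite sp_mx_tr.
Qed.

Lemma sum_root_anticomm :
  \sum_(w <- e6_root_words)
    (root_mx w *m (root_mx w)^T + (root_mx w)^T *m root_mx w) =
  diagz K (fun a : 'I_27 => 16).
Proof.
rewrite -(sp_mx_diag K 27 (fun=> 16)) -(sp_eq K 27 check_casimir_scalar).
rewrite sp_mx_flatten !big_map; apply: eq_bigr => w _.
by rewrite sp_mx_cat !sp_mxM ?sp_bounded_tr ?sp_bounded_root // sp_mx_tr.
Qed.

Lemma sp_mx1 (a b : 'I_27) : mx [:: (a : nat, b : nat, 1)] = delta_mx a b.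
Proof.
rewrite /sp_mx big_seq1 scale1r; apply/matrixP => i j.
by rewrite !mxE !val_eqE.
Qed.

(** With [delta_mx a b] for the tensor of two basis vectors, the terms are the operators
    [X_alpha (x) X_(-alpha)] and their opposites; the transpose on the second factor turns them into
    [R _ R]. Together with the Cartan part, the split Casimir operator is the swap plus 1/3 modulo
    the quadrics. *)
Lemma root_tensor (a b : 'I_27) :
  \sum_(w <- e6_root_words)
    (root_mx w *m delta_mx a b *m root_mx w +
     (root_mx w)^T *m delta_mx a b *m (root_mx w)^T) =
  delta_mx b a + (gram a b)%:~R *: delta_mx a b -
    \sum_(k <- indices) quadric_mx k a b *: quadric_mx k.
Proof.
have ind (c : 'I_27) : (c : nat) \in indices by rewrite mem_iota leq0n add0n ltn_ord.
have := check_tensor => /allP/(_ _ (ind a))/allP/(_ _ (ind b)).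
have bd : sp_bounded 27 [:: (a : nat, b : nat, 1)] by rewrite /sp_bounded /= !ltn_ord.
move=> /sp_eq-/(_ K 27); rewrite sp_mx_flatten !big_map => E.
transitivity (\sum_(j <- e6_root_words)
  mx (sp_mul (sp_mul (sp_root j) [:: (a : nat, b : nat, 1)]) (sp_root j) ++
  sp_mul (sp_mul (sp_tr (sp_root j)) [:: (a : nat, b : nat, 1)]) (sp_tr (sp_root j)))).
  apply: eq_bigr => w _; have bw := sp_bounded_root w.
  have bw' := sp_bounded_tr bw.
  by rewrite sp_mx_cat !sp_mxM ?sp_bounded_mul // sp_mx_tr sp_mx1.
rewrite {}E -cat1s sp_mx_cat sp_mx1 -addrA; congr (_ + _).
rewrite -[_ :: flatten _]cat1s sp_mx_cat; congr (_ + _).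
  have -> : [:: (a : nat, b : nat, gram a b)] = sp_scale (gram a b) [:: (a : nat, b : nat, 1)].
    by rewrite /sp_scale /= mulr1.
  by rewrite sp_mx_scale sp_mx1.
rewrite sp_mx_flatten big_map big_filter big_mkcond /= big_map -sumrN.
apply: eq_bigr => k _; rewrite /quadric_mx sp_mxE -scaleNr -rmorphN.
by case: eqP => [->|_]; rewrite ?oppr0 ?scale0r // sp_mx_scale.
Qed.

Lemma sp_in_quadricsP l : sp_in_quadrics l ->
  exists c k, (k < 27)%N /\ mx l = c *: quadric_mx k.
Proof.
have mx0 : mx [::] = 0 by rewrite /sp_mx big_nil.
case: l => [_|t l]; first by exists 0, 0%N; rewrite mx0 scale0r.
rewrite /sp_in_quadrics; move: (find _ _) => k.
(* An unsuccessful search gives the index 27, whose default, the empty list, stands for the zero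
   matrix. *)
have -> : nth [::] e6_quadrics k = if (k < 27)%N then sp_quadric k else [::].
  case: ltnP => k27; last by rewrite nth_default // size_map size_iota.
  by rewrite (nth_map 0%N) ?size_iota // nth_iota.
set q := if _ then _ else _ => l0.
have mq : exists c k', (k' < 27)%N /\ mx q = c *: quadric_mx k'.
  rewrite /q; case: ifP => k27; first by exists 1, k; rewrite scale1r.
  by exists 0, 0%N; rewrite mx0 scale0r.
case/or3P: l0 => /sp_is0P-/(_ K 27); rewrite ?sp_mx_cat ?sp_mx_opp.
- by move=> ->; exists 0, 0%N; rewrite scale0r.
- by move/eqP; rewrite subr_eq0 => /eqP->.
- move/eqP; rewrite addr_eq0 => /eqP->; have [c [k' [k27 ->]]] := mq.
  by exists (- c), k'; rewrite scaleNr.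
Qed.

Lemma act_quadric i k M : (i < 6)%N -> (k < 27)%N ->
  M = raise_mx i \/ M = lower_mx i ->
  M *m quadric_mx k *m M^T = 0 /\
  exists c k', (k' < 27)%N /\
    M *m quadric_mx k + quadric_mx k *m M^T = c *: quadric_mx k'.
Proof.
move=> i6 k27 ME; have /allP/(_ i) := check_act_quadric.
rewrite mem_iota => /(_ i6)/allP/(_ k); rewrite mem_iota => /(_ k27).
have bq : sp_bounded 27 (sp_quadric k).
  by apply: (allP check_bounded_quadric); rewrite mem_iota.
have [bl br] := (sp_bounded_lower i, sp_bounded_raise i).
have ltr : mx (sp_tr (sp_raise i)) = lower_mx i.
  by rewrite sp_mx_tr -[mx _]/(raise_mx i) raise_mxE trmxK.
have rtr : mx (sp_tr (sp_lower i)) = raise_mx i by rewrite sp_mx_tr raise_mxE.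
case/and4P => /sp_in_quadricsP[c [j [j27 cE]]] /sp_in_quadricsP[d [h [h27 dE]]].
move=> /sp_is0P-/(_ K 27) r0 /sp_is0P-/(_ K 27) l0.
have rT : (raise_mx i)^T = lower_mx i by rewrite raise_mxE trmxK.
case: ME => ->.
  rewrite rT; split; last first.
    by exists c, j; split=> //; rewrite -cE sp_mx_cat !sp_mxM // ltr.
  by move: r0; rewrite !sp_mxM ?sp_bounded_mul.
rewrite -raise_mxE; split; last first.
  by exists d, h; split=> //; rewrite -dE sp_mx_cat !sp_mxM // rtr.
by move: l0; rewrite !sp_mxM ?sp_bounded_mul.
Qed.

Lemma quadric_mx_top k (a b : 'I_27) : (k < 27)%N -> (a < 3)%N -> (b < 3)%N ->
  quadric_mx k a b = 0.
Proof.
move=> k27 a3 b3; rewrite sp_mxE; have /allP/(_ k) := check_quadric_top.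
rewrite mem_iota => /(_ k27); elim: (sp_quadric k) => //= t l IHl /andP[tab /IHl].
case: eqP => [ta|] //=; case: eqP => [tb|] //=.
by move: tab; rewrite ta tb ltnNge -ltnS a3 ltnNge -ltnS b3.
Qed.

End MinusculeModel.

(** * Second order operators *)

Section SecondOrder.
Variables (K : fieldType) (n : nat).
Local Notation S := {mpoly K[n]}.
Implicit Types (p q : S) (M N : 'M[K]_n) (c : 'I_n -> 'I_n -> S).

Lemma diagz_ext (d e : 'I_n -> int) : d =1 e -> diagz K d = diagz K e.
Proof. by move=> de; apply/matrixP => i j; rewrite !diagzE de. Qed.

Lemma diagz_lin x y (d e : 'I_n -> int) :
  diagz K (fun k => x * d k + y * e k) =
    x%:~R *: diagz K d + y%:~R *: diagz K e.
Proof.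
apply/matrixP => i j; rewrite diagzE [RHS]mxE [X in _ = X + _]mxE.
rewrite [X in _ = _ + X]mxE !diagzE.
by case: eqP => _; rewrite ?mulr0n ?mulr0 ?addr0 // !mulr1n rmorphD !rmorphM.
Qed.

Lemma diagzM (d e : 'I_n -> int) :
  diagz K d *m diagz K e = diagz K (fun k => d k * e k).
Proof.
apply/matrixP => i j; rewrite [LHS]mxE (bigD1 i) //= big1 ?addr0.
  by rewrite !diagzE eqxx mulr1n rmorphM mulrnAr.
by move=> k ki; rewrite !diagzE eq_sym (negPf ki) mulr0n mul0r.
Qed.

Lemma homogeneous_ext (d e : 'I_n -> int) a p :
  d =1 e -> homogeneous d a p -> homogeneous e a p.
Proof. by move=> de; rewrite /homogeneous (diagz_ext de). Qed.

Lemma homogeneous_lin x y (d e : 'I_n -> int) a b p :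
  homogeneous d a p -> homogeneous e b p ->
  homogeneous (fun k => x * d k + y * e k) (x * a + y * b) p.
Proof.
move=> hd he; rewrite /homogeneous diagz_lin vfieldD !vfieldZ hd he !scalerA.
by rewrite -scalerDl -!rmorphM -rmorphD.
Qed.

Lemma homogeneous0 p : homogeneous (fun=> 0) 0 p.
Proof.
rewrite /homogeneous scale0r; have -> : diagz K (fun=> 0) = 0 :> 'M_n.
  by apply/matrixP => i j; rewrite diagzE mxE mul0rn.
exact: vfield0.
Qed.

Lemma homogeneous_sum_nodes (x b : nat -> int) (d : nat -> 'I_n -> int) p :
  (forall k, (k < 6)%N -> homogeneous (d k) (b k) p) ->
  homogeneous (fun i => sum_nodes (fun k => x k * d k i))
    (sum_nodes (fun k => x k * b k)) p.
Proof.
move=> hd; have : forall k, k \in iota 0 6 -> homogeneous (d k) (b k) p.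
  by move=> k; rewrite mem_iota; apply: hd.
rewrite /sum_nodes; elim: (iota 0 6) => [_|k s IHs ks]; first exact: homogeneous0.
have h1 := ks k (mem_head _ _).
have {}IHs := IHs (fun j js => ks j (@mem_behead _ (_ :: _) j js)).
have := homogeneous_lin (x k) 1 h1 IHs; rewrite mul1r.
by apply: homogeneous_ext => i; rewrite mul1r.
Qed.

Definition second_order c p : S := \sum_k \sum_l c k l * p^`M(l)^`M(k).

Lemma vfield_comp2 M N p : vfield M (vfield N p) = vfield (M *m N) p +
  second_order (fun k l => linform M k * linform N l) p.
Proof. exact: vfield_comp. Qed.

Lemma second_order_sum (I : Type) (r : seq I) (F : I -> 'I_n -> 'I_n -> S) p :
  second_order (fun k l => \sum_(i <- r) F i k l) p =
    \sum_(i <- r) second_order (F i) p.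
Proof.
rewrite /second_order [RHS]exchange_big; apply: eq_bigr => k _ /=.
by rewrite [RHS]exchange_big; apply: eq_bigr => l _ /=; rewrite mulr_suml.
Qed.

Lemma second_orderD c c' p :
  second_order (fun k l => c k l + c' k l) p =
    second_order c p + second_order c' p.
Proof.
rewrite /second_order -big_split; apply: eq_bigr => k _ /=.
by rewrite -big_split; apply: eq_bigr => l _ /=; rewrite mulrDl.
Qed.

Lemma second_orderZ a c p :
  second_order (fun k l => a *: c k l) p = a *: second_order c p.
Proof.
rewrite /second_order scaler_sumr; apply: eq_bigr => k _ /=.
by rewrite scaler_sumr; apply: eq_bigr => l _ /=; rewrite scalerAl.
Qed.

Lemma eq_second_order c c' p : (forall k l, c k l = c' k l) ->
  second_order c p = second_order c' p.
Proof.
by move=> cc'; apply: eq_bigr => k _; apply: eq_bigr => l _; rewrite cc'.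
Qed.

(** Coefficients multiply the derivatives from outside, so congruences between them pass to the
    operators. This is how the quadrics enter the comparison of Casimir operators. *)
Lemma second_order_ideal qs c c' p :
  (forall k l, in_ideal qs (c k l - c' k l)) ->
  in_ideal qs (second_order c p - second_order c' p).
Proof.
move=> cc'; rewrite /second_order -sumrB.
apply: (subspace_sum (in_ideal_subspace qs)) => k _; rewrite -sumrB.
apply: (subspace_sum (in_ideal_subspace qs)) => l _; rewrite -mulrBl.
exact: in_ideal_mulr.
Qed.

(* [X_k X_l d_l d_k] weighted by [g]; the first order term makes the eigenvalue
   of a rank one form [f k * h l] the product of the eigenvalues. *)
Definition quadratic_eigen (g : 'I_n -> 'I_n -> int) (z : int) p : Prop :=
  second_order (fun k l => (g k l)%:~R *: ('X_k * 'X_l)) p +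
    vfield (diagz K (fun k => g k k)) p = z%:~R *: p.

Lemma quadratic_eigen_ext g g' z p : (forall k l, g k l = g' k l) ->
  quadratic_eigen g z p -> quadratic_eigen g' z p.
Proof.
move=> gg'; rewrite /quadratic_eigen => <-; congr (_ + _).
  by apply: eq_second_order => k l; rewrite gg'.
by rewrite (diagz_ext (fun k => gg' k k)).
Qed.

Lemma quadratic_eigen_mul d e a b p : homogeneous d a p -> homogeneous e b p ->
  quadratic_eigen (fun k l => d k * e l) (a * b) p.
Proof.
move=> hd he; have := congr1 (vfield (diagz K d)) he.
rewrite vfield_comp2 diagzM linearZ /= hd scalerA -rmorphM mulrC.
rewrite /quadratic_eigen => <-; rewrite addrC; congr (_ + _).
apply: eq_second_order => k l; rewrite !linform_diagz -scalerAl -scalerAr scalerA.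
by rewrite rmorphM.
Qed.

Lemma quadratic_eigen_lin x y g h z t p :
  quadratic_eigen g z p -> quadratic_eigen h t p ->
  quadratic_eigen (fun k l => x * g k l + y * h k l) (x * z + y * t) p.
Proof.
rewrite /quadratic_eigen => gz ht; rewrite rmorphD !rmorphM /= scalerDl -!scalerA.
rewrite -gz -ht diagz_lin vfieldD !vfieldZ !scalerDr addrACA; congr (_ + _).
rewrite -!second_orderZ -second_orderD; apply: eq_second_order => k l.
by rewrite !scalerA -scalerDl -!rmorphM -rmorphD.
Qed.

Lemma quadratic_eigen0 p : quadratic_eigen (fun _ _ => 0) 0 p.
Proof.
rewrite /quadratic_eigen.
have -> : second_order (fun k l => 0%:~R *: ('X_k * 'X_l)) p = 0.
  by rewrite second_orderZ scale0r.
by rewrite add0r; apply: homogeneous0.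
Qed.

Lemma quadratic_eigen_sum_nodes (x z : nat -> int)
    (g : nat -> 'I_n -> 'I_n -> int) p :
  (forall i, (i < 6)%N -> quadratic_eigen (g i) (z i) p) ->
  quadratic_eigen (fun k l => sum_nodes (fun i => x i * g i k l))
    (sum_nodes (fun i => x i * z i)) p.
Proof.
move=> hg; have : forall i, i \in iota 0 6 -> quadratic_eigen (g i) (z i) p.
  by move=> i; rewrite mem_iota; apply: hg.
rewrite /sum_nodes; elim: (iota 0 6) => [_|i s IHs gs]; first exact: quadratic_eigen0.
have h1 := gs i (mem_head _ _).
have {}IHs := IHs (fun j js => gs j (@mem_behead _ (_ :: _) j js)).
have := quadratic_eigen_lin (x i) 1 h1 IHs; rewrite mul1r.
by apply: quadratic_eigen_ext => k l; rewrite mul1r.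
Qed.

End SecondOrder.

Section Bilinear.
Variables (K : fieldType) (r s : nat).
Local Notation S := {mpoly K[r * s]}.
Local Notation mvar := (@mvar K r s).
Local Notation idx := (@mxvec_index r s).

Definition bilform (i j : 'I_s) (T : 'M[K]_r) : S :=
  \sum_a \sum_b T a b *: (mvar a i * mvar b j).

Lemma bilformE i j T :
  bilform i j T = \sum_a \sum_b T a b *: (mvar a i * mvar b j).
Proof. by []. Qed.

Lemma bilform_is_linear i j : linear (bilform i j).
Proof.
move=> c T T'; rewrite /bilform scaler_sumr -big_split; apply: eq_bigr => a _ /=.
rewrite scaler_sumr -big_split; apply: eq_bigr => b _ /=.
by rewrite !mxE scalerDl scalerA.
Qed.

HB.instance Definition _ i j :=
  GRing.isLinear.Build K 'M_r S *:%R (bilform i j) (bilform_is_linear i j).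

Lemma mul_delta_mxE (A B : 'M[K]_r) a b c d :
  (A *m delta_mx a b *m B) c d = A c a * B b d.
Proof.
rewrite -(mul_delta_mx (0 : 'I_1)) mulmxA -mulmxA -colE -rowE mxE big_ord1.
by rewrite !mxE.
Qed.

(** Second order coefficients become bilinear forms of transformed elementary tensors, so that
    matrix identities such as [root_tensor] apply to them. *)
Lemma linform_lmul_mul A B a i b j :
  linform (lmul s A) (idx a i) * linform (lmul s B) (idx b j) =
    bilform i j (A *m delta_mx a b *m B^T).
Proof.
rewrite !linform_lmul mulr_suml /bilform; apply: eq_bigr => c _.
rewrite mulr_sumr; apply: eq_bigr => d _.
by rewrite mul_delta_mxE mxE -scalerAl -scalerAr scalerA.
Qed.

Lemma lmul1 : lmul s 1%:M = 1%:M :> 'M[K]_(r * s).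
Proof.
by apply: mxvec_row_mxP => x; rewrite vec_lmul trmx1 mul1mx mulmx1.
Qed.

Lemma rmul1 : rmul r 1%:M = 1%:M :> 'M[K]_(r * s).
Proof. by apply: mxvec_row_mxP => x; rewrite vec_rmul !mulmx1. Qed.

Lemma linform_lmul1 a i : linform (lmul s 1%:M) (idx a i) = mvar a i.
Proof.
rewrite linform_lmul (bigD1 a) //= mxE eqxx scale1r big1 ?addr0 // => c ca.
by rewrite mxE (negPf ca) scale0r.
Qed.

Lemma bilform_delta i j a b : bilform i j (delta_mx a b) = mvar a i * mvar b j.
Proof.
by rewrite -2!linform_lmul1 linform_lmul_mul trmx1 mulmx1 mul1mx.
Qed.

Lemma vfield_bilform A i j T :
  vfield (lmul s A) (bilform i j T) = bilform i j (A *m T + T *m A^T).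
Proof.
have E a b : vfield (lmul s A) (mvar a i * mvar b j) =
    bilform i j (A *m delta_mx a b + delta_mx a b *m A^T).
  rewrite vfieldM !vfieldX -{1}linform_lmul1 -[X in _ + X * _]linform_lmul1.
  by rewrite !linform_lmul_mul linearD /= trmx1 mulmx1 mul1mx.
pose D := \sum_a \sum_b T a b *: delta_mx a b.
have -> : A *m T + T *m A^T = A *m D + D *m A^T by rewrite /D -matrix_sum_delta.
rewrite /D mulmx_sumr mulmx_suml -big_split [RHS]linear_sum.
rewrite (bilformE i j T) [LHS]linear_sum; apply: eq_bigr => a _ /=.
rewrite mulmx_sumr mulmx_suml -big_split [RHS]linear_sum [LHS]linear_sum /=.
apply: eq_bigr => b _.
rewrite linearZ /= E -linearZ /=; congr (bilform _ _ _).
by rewrite -scalemxAr -scalemxAl scalerDr.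
Qed.

Lemma vfield_egl_bilform k l i j T :
  vfield (egl K r k l) (bilform i j T) =
    (l == i)%:R *: bilform k j T + (l == j)%:R *: bilform i k T.
Proof.
rewrite /bilform linear_sum !scaler_sumr -big_split; apply: eq_bigr => a _ /=.
rewrite linear_sum !scaler_sumr -big_split; apply: eq_bigr => b _ /=.
rewrite linearZ /= vfieldM !vfieldX !linform_egl -scalerAl -scalerAr scalerDr.
by rewrite !scalerA ![T a b * _]mulrC.
Qed.

End Bilinear.

(** * The ideal of quadrics *)

Lemma mem_nodes k : (k < 6)%N -> k \in nodes.
Proof. by rewrite mem_iota. Qed.

Lemma mem_indices (a : 'I_27) : (a : nat) \in indices.
Proof. by rewrite mem_iota leq0n add0n ltn_ord. Qed.

Lemma sum_nodesE f : sum_nodes f = \sum_(k <- nodes) f k.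
Proof.
rewrite /sum_nodes /nodes; elim: (iota 0 6) => [|k s IHs]; first by rewrite big_nil.
by rewrite big_cons /= IHs.
Qed.

Lemma e6_letters w : w \in e6_root_words -> all (fun i => i < 6)%N w.
Proof. by move=> ww; apply: (allP (a := all _)) ww; vm_compute. Qed.

Section QuadricIdeal.
Variable K : fieldType.
Hypothesis charK0 : [pchar K] =i pred0.
Local Notation S := {mpoly K[27 * 3]}.
Local Notation idx := (@mxvec_index 27 3).
Local Notation egl := (@egl K 27 3).
Local Notation lmul := (@lmul K 27 3).

Definition quadrics : seq S :=
  [seq bilform ij.1 ij.2 (quadric_mx K k) | k <- indices,
     ij <- enum {: 'I_3 * 'I_3}].

Local Notation I := (in_ideal quadrics).

Lemma lmul_comm A B : lmul A *m lmul B - lmul B *m lmul A =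
  lmul (A *m B - B *m A).
Proof. by rewrite linearB /= !lmulM. Qed.

Lemma quadric_in_ideal k i j : (k < 27)%N -> I (bilform i j (quadric_mx K k)).
Proof.
move=> k27; apply: in_ideal_gen; apply/allpairsP; exists (k, (i, j)).
by split; rewrite // ?mem_iota // mem_enum.
Qed.

Lemma ideal_lmul_stable i M : (i < 6)%N ->
  M = raise_mx K i \/ M = lower_mx K i -> stable I (lmul M).
Proof.
move=> i6 ME; apply: in_ideal_stable => _ /allpairsP[[k [j l]] [/= ki _ ->]].
have k27 : (k < 27)%N by move: ki; rewrite mem_iota.
rewrite vfield_bilform; have [_ [c [k' [k'27 ->]]]] := act_quadric i6 k27 ME.
rewrite linearZ; apply: (subspaceZ (in_ideal_subspace _)).
exact: quadric_in_ideal.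
Qed.

Lemma ideal_egl_stable i j : stable I (egl i j).
Proof.
apply: in_ideal_stable => _ /allpairsP[[k [i' j']] [/= ki _ ->]].
have k27 : (k < 27)%N by move: ki; rewrite mem_iota.
rewrite vfield_egl_bilform; have subI := in_ideal_subspace quadrics.
by apply: (subspaceD subI); apply: (subspaceZ subI); apply: quadric_in_ideal.
Qed.

Definition depth2 (k : nat) : 'I_(27 * 3) -> int :=
  weight2 (fun a _ => depth k a).

Arguments depth2 k%_N.

Lemma depth2E k a j : depth2 k (idx a j) = depth k a.
Proof. exact: weight2E. Qed.

Section Stable.
Variables (P : S -> Prop) (subP : subspace P).
Hypothesis stE : forall i, (i < 6)%N -> stable P (lmul (raise_mx K i)).
Hypothesis stF : forall i, (i < 6)%N -> stable P (lmul (lower_mx K i)).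
Hypothesis stG : forall i j, stable P (egl i j).

Lemma root_stable w : w \in e6_root_words ->
  stable P (lmul (root_mx K w)) /\ stable P (lmul (root_mx K w)^T).
Proof.
move/e6_letters; case: w => [_|i w].
  rewrite /root_mx /sp_mx big_nil trmx0 linear0.
  by split=> p _; rewrite vfield0; apply: subspace0.
elim: w i => [|j w IHw] i /= /andP[i6 w6].
  rewrite root_mx_simple raise_mxE trmxK; split; last exact: stF.
  by rewrite -raise_mxE; apply: stE.
have [sw swT] := IHw j w6; rewrite root_mx_cons; split.
  by rewrite -lmul_comm; apply: stable_bracket => //; apply: stE.
rewrite linearB /= !trmx_mul -lower_mxE.
by rewrite -lmul_comm; apply: stable_bracket => //; apply: stF.
Qed.

Lemma weight_stable i : (i < 6)%N ->
  stable P (lmul (diagz K (fun a : 'I_27 => e6_weight i a))).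
Proof.
move=> i6; have := raise_lower_comm K i6 i6; rewrite eqxx => <-.
by rewrite -lmul_comm; apply: stable_bracket; auto.
Qed.

(** The inverse Cartan matrix, whose denominator is 3, expresses the depth through the coroot
    weights of [omega_1 - wt a]. The constant part is a multiple of the Euler field, which is the
    sum of the [egl j j]. *)
Lemma depth_stable k : (k < 6)%N -> stable P (diagz K (depth2 k)).
Proof.
move=> k6; rewrite /depth2 -(lmul_diagz K 3 (fun a : 'I_27 => depth k a)).
have three : 3%:R != 0 :> K by move/pcharf0P: charK0 => ->.
pose N i := nth 0 (nth [::] cartan_inv3 k) i.
have -> : diagz K (fun a : 'I_27 => depth k a) = 3%:R^-1 *:
    \sum_(i <- nodes) (N i)%:~R *: ((i == 0%N)%:R *: 1%:M -
       diagz K (fun a : 'I_27 => e6_weight i a)).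
  apply: (scalerI three); rewrite scalerA mulfV // scale1r.
  apply/matrixP => a b; rewrite mxE diagzE summxE.
  have /allP/(_ _ (mem_nodes k6))/allP/(_ _ (mem_indices a))/eqP :=
    check_depth_weight.
  move/(congr1 (fun z : int => z%:~R : K)); rewrite rmorphM /= => E.
  rewrite mulrnAr E sum_nodesE.
  rewrite rmorph_sum -sumrMnl; apply: eq_bigr => i _ /=.
  rewrite mxE [X in _ = _ * X]mxE [X in _ = _ * (X + _)]mxE.
  rewrite [X in _ = _ * (_ + X)]mxE [X in _ = _ * (_ * X + _)]mxE diagzE.
  rewrite rmorphM rmorphB /= -/(N i) -mulrnAr mulrnBl mulr_natr -mulrnA.
  by congr (_ * (_ - _)); case: (i == _); rewrite ?mul1n ?mul0n.
rewrite linearZ linear_sum /=; apply: stableZ => //.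
rewrite big_seq; apply: stable_sum => // i; rewrite mem_iota => i6.
rewrite linearZ linearB linearZ /=; apply: stableZ => //; apply: stableD => //.
  apply: stableZ => //; rewrite lmul1 -(rmul1 K 27 3) scalar_mx_sum_delta.
  rewrite linear_sum /=; apply: stable_sum => // j _.
  by rewrite scale1r; apply: stG.
by apply: stableN => //; apply: weight_stable.
Qed.

End Stable.

End QuadricIdeal.

(** * Highest weight vectors modulo the quadrics *)

(* The Casimir value is strictly increasing along the dominance order on dominant
   weights: the difference below is the pairing of the gap between the two
   weights, a combination of simple roots with nonnegative coefficients
   [b0 - l1 - l2], [b1], [b2 - l2], [b3], .., with a strictly dominant weight. *)
Lemma e6_casimir_equality (b : nat -> int) (l0 l1 l2 : int) :
  let d := l0 + l1 + l2 in
  l1 <= l0 -> l2 <= l1 -> 0 <= l2 -> (forall k, (k < 6)%N -> 0 <= b k) ->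
  l1 + l2 <= b 0%N -> l2 <= b 2%N ->
  (forall i, (i < 6)%N ->
     0 <= (i == 0%N)%:Z * d - sum_nodes (fun k => cartan i k * b k)) ->
  16 * d - 2 * sum_nodes b =
    16 * d + (l0 ^+ 2 + l1 ^+ 2 + l2 ^+ 2 + 2 * (l0 - l2) - 3 * d) +
    (d * b 0%N + d * b 0%N - d * d -
       sum_nodes (fun k => sum_nodes (fun l => cartan k l * (b k * b l))) + d) ->
  b 3%N = 0.
Proof.
move=> d l10 l21 l2_ge0 b_ge0 b0l b2l mu_ge0 E.
have := (mu_ge0 0%N isT, mu_ge0 1%N isT, mu_ge0 2%N isT, mu_ge0 3%N isT,
  mu_ge0 4%N isT, mu_ge0 5%N isT).
have := (b_ge0 1%N isT, b_ge0 3%N isT, b_ge0 4%N isT, b_ge0 5%N isT).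
have s6 f : sum_nodes f = f 0%N + (f 1%N + (f 2%N + (f 3%N + (f 4%N + (f 5%N + 0))))) by [].
move: E; rewrite !s6 /cartan /= {s6 mu_ge0 b_ge0}.
move: (b 0%N) (b 1%N) (b 2%N) (b 3%N) (b 4%N) (b 5%N) b0l b2l.
move=> b0 b1 b2 b3 b4 b5 b0l b2l.
set lhs := _ - _; set rhs := _ + _ => E [[[b1_ge0 b3_ge0] b4_ge0] b5_ge0].
move=> [[[[[mu0 mu1] mu2] mu3] mu4] mu5].
(* [w0], .., [w5] are the values on the simple coroots of the sum of both weights and [2 rho]. The
   depths of the larger weight are [l1 + l2] at node 1, [l2] at node 3 and 0 elsewhere, since
   [omega_3 = 2 omega_1 - alpha_1] and [omega_4 = 3 omega_1 - 2 alpha_1 - alpha_3]. *)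
pose w0 := (l0 - l1) + (d - (2 * b0 - b2)) + 2.
pose w1 := (b3 - 2 * b1) + 2.
pose w2 := (l1 - l2) + (b0 + b3 - 2 * b2) + 2.
pose w3 := l2 + (b1 + b2 + b4 - 2 * b3) + 2.
pose w4 := (b3 + b5 - 2 * b4) + 2.
pose w5 := (b4 - 2 * b5) + 2.
have sum0 : (b0 - l1 - l2) * w0 + b1 * w1 + (b2 - l2) * w2 + b3 * w3 + b4 * w4 +
    b5 * w5 = 0.
  transitivity (rhs - lhs); last by rewrite E subrr.
  by rewrite /rhs /lhs /w0 /w1 /w2 /w3 /w4 /w5 /d; ring.
have mul_ge0 (x y : int) : 0 <= x -> 0 < y -> 0 <= x * y.
  by move=> x0 y0; rewrite Num.Theory.mulr_ge0 // Order.POrderTheory.ltW.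
have w3_gt0 : 0 < w3 by rewrite /w3; lia.
have p0 : 0 <= (b0 - l1 - l2) * w0 by apply: mul_ge0; rewrite /w0; lia.
have p1 : 0 <= b1 * w1 by apply: mul_ge0; rewrite /w1; lia.
have p2 : 0 <= (b2 - l2) * w2 by apply: mul_ge0; rewrite /w2; lia.
have p3 : 0 <= b3 * w3 by apply: mul_ge0.
have p4 : 0 <= b4 * w4 by apply: mul_ge0; rewrite /w4; lia.
have p5 : 0 <= b5 * w5 by apply: mul_ge0; rewrite /w5; lia.
have /eqP : b3 * w3 = 0.
  move: sum0 p0 p1 p2 p3 p4 p5.
  move: (_ * w0) (b1 * w1) (_ * w2) (b3 * w3) (b4 * w4) (b5 * w5).
  by move=> *; lia.
by rewrite mulf_eq0 => /orP[/eqP//|/eqP w30]; rewrite w30 in w3_gt0.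
Qed.

Lemma eq_sum_nodes f g : (forall k, f k = g k) -> sum_nodes f = sum_nodes g.
Proof. by move=> fg; rewrite !sum_nodesE; apply: eq_bigr. Qed.

Section HighestVector.
Variable K : fieldType.
Hypothesis charK0 : [pchar K] =i pred0.
Local Notation S := {mpoly K[27 * 3]}.
Local Notation idx := (@mxvec_index 27 3).
Local Notation egl := (@egl K 27 3).
Local Notation lmul := (@lmul K 27 3).
Local Notation coldeg := (@coldeg 27 3).
Local Notation mvar := (@mvar K 27 3).
Local Notation highest0 := (@highest K 27 (fun p => p = 0)).
Local Notation I := (in_ideal (quadrics K)).
Local Notation R := (root_mx K).

Variables (l : 'I_3 -> int) (b : nat -> int) (q : S).
Hypotheses (lq : gl_weight l q) (hq : highest0 q).
Hypothesis bq : forall k, (k < 6)%N -> homogeneous (depth2 k) (b k) q.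

Local Notation d := (l c0 + l c1 + l c2).
Local Notation one := (weight2 (fun (_ : 'I_27) (_ : 'I_3) => 1)).

Let subI := in_ideal_subspace (quadrics K).

Lemma degree_homogeneous : homogeneous one d q.
Proof.
have := homogeneous_lin 1 1 (homogeneous_lin 1 1 (lq c0) (lq c1)) (lq c2).
rewrite !mul1r; apply: homogeneous_ext => k; case/mxvec_indexP: k => a i.
by rewrite !mul1r /coldeg !weight2E; case: (ord3P i) => ->.
Qed.

Lemma two_rho_homogeneous :
  homogeneous (weight2 (fun (a : 'I_27) (_ : 'I_3) =>
    16 - 2 * sum_nodes (fun k => depth k a))) (16 * d - 2 * sum_nodes b) q.
Proof.
have := homogeneous_sum_nodes (fun=> 1) bq.
move/(homogeneous_lin 16 (-2) degree_homogeneous).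
rewrite (eq_sum_nodes (g := b)) ?mulNr => [|k]; last exact: mul1r.
apply: homogeneous_ext => k; case/mxvec_indexP: k => a i.
rewrite !weight2E mulr1 mulNr; congr (_ - 2 * _); apply: eq_sum_nodes => k.
by rewrite mul1r depth2E.
Qed.

Definition root_casimir : S := \sum_(w <- e6_root_words)
  (vfield (lmul (R w)) (vfield (lmul (R w)^T) q) +
   vfield (lmul (R w)^T) (vfield (lmul (R w)) q)).

(** Letting the raising operator act first produces terms of [I] and the brackets, which sum to the
    field of [2 rho]. *)
Lemma root_casimir_highest :
  (forall w, w \in e6_root_words -> I (vfield (lmul (R w)) q)) ->
  I (root_casimir - (16 * d - 2 * sum_nodes b)%:~R *: q).
Proof.
move=> Rq; have := two_rho_homogeneous; rewrite /homogeneous => <-.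
rewrite -lmul_diagz -sum_root_comm [lmul _]linear_sum /=.
rewrite vfield_sum -sumrB big_seq.
apply: subspace_sum => // w ww.
rewrite -lmul_comm (vfield_comm (lmul (R w)) (lmul (R w)^T)).
have [stE stF stG] : [/\ forall i, (i < 6)%N -> stable I (lmul (raise_mx K i)),
    forall i, (i < 6)%N -> stable I (lmul (lower_mx K i)) &
    forall i j, stable I (egl i j)].
  split=> [i i6|i i6|i j]; last exact: ideal_egl_stable.
    by apply: (ideal_lmul_stable i6); left.
  by apply: (ideal_lmul_stable i6); right.
have [_ /(_ _ (Rq w ww))] := root_stable subI stE stF ww.
move: (vfield _ (vfield _ q)) => x Ix; set y := vfield _ q.
by rewrite addrAC addrK -mulr2n; apply: subspace_mulrnr.
Qed.

Definition gram2 (k l : 'I_(27 * 3)) : int :=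
  depth2 0 k * one l + one k * depth2 0 l - one k * one l -
  sum_nodes (fun i => sum_nodes (fun j =>
    cartan i j * (depth2 i k * depth2 j l))).

Lemma gram2E a i c j : gram2 (idx a i) (idx c j) = gram a c.
Proof.
rewrite /gram2 /gram !depth2E !weight2E !mulr1 !mul1r; congr (_ - _).
by apply: eq_sum_nodes => k; apply: eq_sum_nodes => k'; rewrite !depth2E.
Qed.

Definition gram_value : int :=
  d * b 0%N + d * b 0%N - d * d -
    sum_nodes (fun i => sum_nodes (fun j => cartan i j * (b i * b j))).

(** The summand [d] corrects for the first order term of [quadratic_eigen]: as [gram a a = -1], that
    term is minus the Euler field. *)
Lemma gram2_eigen :
  second_order (fun k l => (gram2 k l)%:~R *: ('X_k * 'X_l)) q =
    (gram_value + d)%:~R *: q.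
Proof.
have hd := degree_homogeneous; have h0 := bq (isT : (0 < 6)%N).
have e1 := quadratic_eigen_lin 1 1 (quadratic_eigen_mul h0 hd) (quadratic_eigen_mul hd h0).
have e2 := quadratic_eigen_lin 1 (-1) e1 (quadratic_eigen_mul hd hd).
have e3 : quadratic_eigen (fun k l => sum_nodes (fun i => 1 *
      sum_nodes (fun j => cartan i j * (depth2 i k * depth2 j l))))
    (sum_nodes (fun i => 1 * sum_nodes (fun j => cartan i j * (b i * b j)))) q.
  apply: (quadratic_eigen_sum_nodes (fun=> 1)
    (z := fun i => sum_nodes (fun j => cartan i j * (b i * b j)))
    (g := fun i k l => sum_nodes (fun j => cartan i j * (depth2 i k * depth2 j l)))).
  move=> i i6; apply: (quadratic_eigen_sum_nodes (fun j => cartan i j)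
    (z := fun j => b i * b j) (g := fun j k l => depth2 i k * depth2 j l)).
  by move=> j j6; apply: quadratic_eigen_mul; apply: bq.
have := quadratic_eigen_lin 1 (-1) e2 e3.
have -> : 1 * (1 * (1 * (b 0%N * d) + 1 * (d * b 0%N)) + -1 * (d * d)) + -1 *
    sum_nodes (fun i => 1 * sum_nodes (fun j => cartan i j * (b i * b j))) =
    gram_value.
  rewrite !mul1r !mulN1r [b 0%N * d]mulrC /gram_value; congr (_ - _).
  by apply: eq_sum_nodes => i; rewrite mul1r.
move=> e4; have {e4} : quadratic_eigen gram2 gram_value q.
  apply: quadratic_eigen_ext e4 => k k'; rewrite !mul1r !mulN1r /gram2.
  by congr (_ - _); apply: eq_sum_nodes => i; rewrite mul1r.
have -> : (gram_value + d)%:~R *: q = gram_value%:~R *: q + d%:~R *: q.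
  by rewrite -scalerDl -rmorphD.
rewrite /quadratic_eigen => <-.
rewrite -addrA -[LHS]addr0; congr (_ + _); apply/esym/eqP.
rewrite addrC addr_eq0 -hd -vfieldN; apply/eqP; congr vfield.
apply/matrixP => k k'; rewrite [RHS]mxE !diagzE -mulNrn -rmorphN.
case/mxvec_indexP: k => a i; rewrite gram2E weight2E.
by have /allP/(_ _ (mem_indices a))/and5P[/eqP->] := check_depth.
Qed.

(** Since variables commute, exchanging the columns of [x_ai x_cj] is the same as exchanging its
    rows. This identifies the swap in [root_tensor] with the second order part of the Casimir
    operator of gl(E). *)
Lemma sum_egl_linform a i c j :
  \sum_k \sum_k' linform (egl k k') (idx a i) * linform (egl k' k) (idx c j) =
    mvar a j * mvar c i.
Proof.
under eq_bigr => k _ do under eq_bigr => k' _ do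
  rewrite !linform_egl -scalerAl -scalerAr scalerA.
rewrite (bigD1 j) //= (bigD1 i) //= !eqxx mulr1 scale1r.
rewrite [X in _ + X + _]big1 ?addr0; last first.
  by move=> k' /negPf k'i; rewrite k'i mul0r scale0r.
rewrite big1 ?addr0 // => k /negPf kj; rewrite big1 // => k' _.
by rewrite kj mulr0 scale0r.
Qed.

(** The first order part of the gl_3 Casimir operator is the sum of [egl i i] over all [i] and [j],
    that is 3 times the degree; the rest is the swap. *)
Lemma swap_eigen :
  second_order (fun k l =>
    \sum_i \sum_j linform (egl i j) k * linform (egl j i) l) q =
  (casimir_value l - 3 * d)%:~R *: q.
Proof.
have := casimir_highest (zero_subspace K 27) (fun i j => @zero_stable K 27 _) lq hq.
move/eqP; rewrite subr_eq0 => /eqP cq.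
have -> : (casimir_value l - 3 * d)%:~R *: q =
    (casimir_value l)%:~R *: q - (3 * d)%:~R *: q.
  by rewrite -scalerBl -rmorphB.
rewrite -{}cq; apply/eqP; rewrite -subr_eq opprK addrC eq_sym; apply/eqP.
rewrite second_order_sum casimirE.
have -> : (3 * d)%:~R *: q = \sum_(i < 3) \sum_(j < 3) vfield (egl i i) q.
  have lE i : vfield (egl i i) q = (l i)%:~R *: q by rewrite egl_diag; apply: lq.
  under [RHS]eq_bigr => i _ do rewrite sumr_const card_ord lE.
  rewrite !big_ord_recl big_ord0 addr0 -!scaler_nat !scalerA -!scalerDl.
  by congr (_ *: q); rewrite intrM !intrD; ring.
rewrite -big_split; apply: eq_bigr => i _ /=.
rewrite second_order_sum -big_split; apply: eq_bigr => j _ /=.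
by rewrite vfield_comp2 eglM eqxx scale1r.
Qed.

(** The second evaluation of the same operator, by normal ordering. The first order part is 16 on
    each variable; [root_tensor] splits the second order part into swap, Gram part and quadrics, and
    the last vanish modulo [I]. *)
Lemma root_casimir_normal :
  I (root_casimir - (16 * d + (casimir_value l - 3 * d) + (gram_value + d))%:~R *: q).
Proof.
pose cR k k' := \sum_(w <- e6_root_words)
  (linform (lmul (R w)) k * linform (lmul (R w)^T) k' +
   linform (lmul (R w)^T) k * linform (lmul (R w)) k').
have -> : root_casimir = (16 * d)%:~R *: q + second_order cR q.
  have <- : vfield (diagz K (weight2 (fun (_ : 'I_27) (_ : 'I_3) => 16))) q =
      (16 * d)%:~R *: q.
    have := homogeneous_lin 16 0 degree_homogeneous degree_homogeneous.
    rewrite mul0r addr0; apply: homogeneous_ext => k.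
    by case/mxvec_indexP: k => a i; rewrite !weight2E.
  rewrite -(lmul_diagz K 3 (fun _ : 'I_27 => 16)) -sum_root_anticomm.
  rewrite [lmul _]linear_sum /= vfield_sum second_order_sum -big_split.
  apply: eq_bigr => w _ /=; rewrite !vfield_comp2 second_orderD addrACA.
  by rewrite linearD /= vfieldD !lmulM.
pose c' k k' := \sum_i \sum_j linform (egl i j) k * linform (egl j i) k' +
  (gram2 k k')%:~R *: ('X_k * 'X_k').
have -> : (16 * d + (casimir_value l - 3 * d) + (gram_value + d))%:~R *: q =
    (16 * d)%:~R *: q + second_order c' q.
  have D3 (x y z : int) : (x + y + z)%:~R *: q = x%:~R *: q + (y%:~R *: q + z%:~R *: q).
    by rewrite !intrD !scalerDl addrA.
  by rewrite second_orderD swap_eigen gram2_eigen D3.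
rewrite opprD addrACA subrr add0r; apply: second_order_ideal => k k'.
case/mxvec_indexP: k => a i; case/mxvec_indexP: k' => c j.
rewrite /c' sum_egl_linform gram2E /cR.
under eq_bigr => w _ do rewrite !linform_lmul_mul trmxK -linearD.
rewrite -linear_sum /= root_tensor linearB linearD linearZ /= !bilform_delta.
rewrite -/(mvar a i) -/(mvar c j) [mvar a j * _]mulrC addrAC subrr sub0r.
apply: subspaceN => //; rewrite linear_sum big_seq; apply: subspace_sum => // k.
rewrite mem_iota => k27; rewrite linearZ; apply: (subspaceZ subI).
exact: quadric_in_ideal.
Qed.

Lemma weight_homogeneous i : (i < 6)%N ->
  homogeneous (weight2 (fun (a : 'I_27) (_ : 'I_3) => e6_weight i a))
    ((i == 0%N)%:Z * d - sum_nodes (fun k => cartan i k * b k)) q.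
Proof.
move=> i6; have := homogeneous_sum_nodes (fun k => cartan i k) bq.
move/(homogeneous_lin (i == 0%N)%:Z (-1) degree_homogeneous); rewrite mulN1r.
apply: homogeneous_ext => k; case/mxvec_indexP: k => a j.
rewrite !weight2E mulr1 mulN1r /e6_weight; congr (_ - _).
by apply: eq_sum_nodes => k; rewrite depth2E.
Qed.

Lemma e6_dominant i : (i < 6)%N -> I (vfield (lmul (raise_mx K i)) q) ->
  I q \/ 0 <= (i == 0%N)%:Z * d - sum_nodes (fun k => cartan i k * b k).
Proof.
move=> i6 Eq; set mu := _ - _; have [mu_ge0|mu_lt0] := boolP (0 <= mu).
  by right.
(* The lowering operator increases the depth, so nilpotency has to be seen on the complementary
   grading, which is nonnegative by the bound in [check_depth]. *)
left; pose codepth := weight2 (fun (a : 'I_27) (_ : 'I_3) => 10 - depth i a).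
apply: (@negative_highest_weight _ _ charK0 I subI (lmul (raise_mx K i))
  (lmul (lower_mx K i))
  (weight2 (fun (a : 'I_27) (_ : 'I_3) => e6_weight i a)) codepth mu
  (10 * d - b i)) => //.
- by rewrite lmul_comm raise_lower_comm // eqxx lmul_diagz.
- rewrite -(lmul_diagz K 3 (fun a : 'I_27 => e6_weight i a)) lmul_comm.
  rewrite weight_lower_comm // -scaleNr linearZ -rmorphN.
  by rewrite (_ : cartan i i = 2) //; move: (i) i6; do 6!case=> //.
- rewrite -(lmul_diagz K 3 (fun a : 'I_27 => 10 - depth i a)) lmul_comm.
  have -> : diagz K (fun a : 'I_27 => 10 - depth i a) =
      10%:~R *: 1%:M - diagz K (fun a : 'I_27 => depth i a).
    apply/matrixP => a a'; rewrite [RHS]mxE [X in _ = X + _]mxE.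
    rewrite [X in _ = _ * X + _]mxE [X in _ = _ + X]mxE !diagzE.
    by rewrite rmorphB mulrnBl mulr_natr.
  rewrite mulmxBl mulmxBr -scalemxAl -scalemxAr mul1mx mulmx1.
  rewrite opprB addrC addrA subrK -opprB depth_lower_comm // linearN.
  by rewrite rmorphN scaleN1r.
- move=> k; case/mxvec_indexP: k => a j; rewrite /codepth weight2E subr_ge0.
  have /allP/(_ _ (mem_indices a))/and5P[_ _ _ _] := check_depth.
  by move/allP/(_ _ (mem_nodes i6)).
- by apply: (ideal_lmul_stable i6); left.
- by apply: (ideal_lmul_stable i6); right.
- exact: weight_homogeneous.
- have := homogeneous_lin 10 (-1) degree_homogeneous (bq i6); rewrite mulN1r.
  apply: homogeneous_ext => k; case/mxvec_indexP: k => a j.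
  by rewrite /codepth !weight2E depth2E mulr1 mulN1r.
- by rewrite ltNge mu_lt0.
Qed.

Lemma grade_sum (f : 'I_27 -> 'I_3 -> int) (m : 'X_{1..27 * 3}) :
  grade (weight2 f) m = \sum_a \sum_j f a j * (m (idx a j))%:Z.
Proof.
rewrite /grade sum_mxvec_index; apply: eq_bigr => a _; apply: eq_bigr => j _.
by rewrite weight2E.
Qed.

Lemma depth_gt0 (a : 'I_27) : [/\ (0 < a)%N -> 1 <= depth 0 a,
  (1 < a)%N -> 1 <= depth 2 a & (2 < a)%N -> 1 <= depth 3 a].
Proof.
have /allP/(_ _ (mem_indices a))/and5P[_ /eqP e0 /eqP e2 /eqP e3 _] := check_depth.
have ge0 k : 0 <= depth k a by [].
move: (ge0 0%N) (ge0 2%N) (ge0 3%N) e0 e2 e3.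
move: (depth 0 a) (depth 2 a) (depth 3 a) => x y z.
by split; lia.
Qed.

(* The monomial of [highest_monomial] has rows 0 and 1 as short as the shape [l]
   demands, which bounds the depths [b 0] and [b 2] from below. *)
Lemma depth_bounds : q <> 0 -> l c1 + l c2 <= b 0%N /\ l c2 <= b 2%N.
Proof.
move=> q_neq0; pose a0 : 'I_27 := inord 0; pose a1 : 'I_27 := inord 1.
have a0E : (a0 : nat) = 0%N by rewrite inordK.
have a1E : (a1 : nat) = 1%N by rewrite inordK.
have a01 : a0 != a1 by rewrite -val_eqE /= a0E a1E.
have [m mq [m01 m02 m12]] := highest_monomial charK0 a01 q_neq0 hq.
have gb k : (k < 6)%N -> grade (depth2 k) m = b k.
  by move=> k6; apply: (homogeneous_grade charK0 (bq k6) mq).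
have gl j : grade (coldeg j) m = l j.
  exact: (homogeneous_grade charK0 (lq j) mq).
split.
  rewrite -(gb 0%N) // -!gl -subr_ge0.
  have -> : grade (depth2 0) m - (grade (coldeg c1) m + grade (coldeg c2) m) =
      \sum_(a < 27) \sum_(j < 3)
        (depth 0 a - ((c1 == j)%:Z + (c2 == j)%:Z)) * (m (idx a j))%:Z.
    rewrite !grade_sum -big_split -sumrB; apply: eq_bigr => a _ /=.
    rewrite -big_split -sumrB; apply: eq_bigr => j _ /=.
    by rewrite mulrBl mulrDl.
  apply: Num.Theory.sumr_ge0 => a _; apply: Num.Theory.sumr_ge0 => j _.
  have [a_gt0|a_le0] := ltnP 0 a.
    have [/(_ a_gt0) d0 _ _] := depth_gt0 a.
    apply: Num.Theory.mulr_ge0 => //.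
    by case: (ord3P j) => -> /=; lia.
  have -> : a = a0 by apply: val_inj; rewrite /= a0E; lia.
  by case: (ord3P j) => ->; rewrite ?m01 ?m02 ?mulr0 // Num.Theory.mulr_ge0.
rewrite -(gb 2%N) // -!gl -subr_ge0 /coldeg /depth2 !grade_sum -sumrB.
apply: Num.Theory.sumr_ge0 => a _; rewrite -sumrB.
apply: Num.Theory.sumr_ge0 => j _; rewrite -mulrBl.
have [a_gt1|a_le1] := ltnP 1 a.
  have [_ /(_ a_gt1) d2 _] := depth_gt0 a.
  apply: Num.Theory.mulr_ge0 => //; move: (depth 2 a) d2 => x x_ge1.
  by case: (ord3P j) => -> /=; lia.
have [aE|aE] : a = a0 \/ a = a1.
- by case: (posnP a) => ?; [left|right]; apply: val_inj; rewrite /= ?a0E ?a1E; lia.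
- by rewrite aE; case: (ord3P j) => ->; rewrite ?m02 ?mulr0 // subr0 Num.Theory.mulr_ge0.
- by rewrite aE; case: (ord3P j) => ->; rewrite ?m12 ?mulr0 // subr0 Num.Theory.mulr_ge0.
Qed.

(** The root Casimir operator has been evaluated twice. If the values differ, a nonzero multiple of
    [q] is in [I]. If they agree and the weight is dominant, the depth at node 4, which has index 3,
    is zero, and this excludes every variable of a row beyond 2. *)
Lemma e6_highest_vector :
  (forall w, w \in e6_root_words -> I (vfield (lmul (R w)) q)) ->
  I q \/ forall m, m \in msupp q -> forall (a : 'I_27) j,
    (2 < a)%N -> m (idx a j) = 0%N.
Proof.
move=> Rq; have [->|/eqP q_neq0] := eqVneq q 0.
  by left; apply: subspace0.
have simple i : (i < 6)%N -> I (vfield (lmul (raise_mx K i)) q).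
  move=> i6; rewrite -root_mx_simple; apply: Rq.
  by move: i i6; do 6!case=> //.
pose eqz := 16 * d - 2 * sum_nodes b ==
  16 * d + (casimir_value l - 3 * d) + (gram_value + d).
have [zE|zN] := boolP eqz; last first.
  left; have := subspaceB subI root_casimir_normal (root_casimir_highest Rq).
  rewrite opprB addrC addrA subrK -scalerBl -rmorphB => Iz.
  have z_neq0 : (16 * d - 2 * sum_nodes b -
      (16 * d + (casimir_value l - 3 * d) + (gram_value + d)))%:~R != 0 :> K.
    by rewrite pchar0_intr_eq0 // subr_eq0.
  by rewrite -(scalerK z_neq0 q); apply: (subspaceZ subI).
have all_mu n : (n <= 6)%N -> I q \/ forall i, (i < n)%N ->
    0 <= (i == 0%N)%:Z * d - sum_nodes (fun k => cartan i k * b k).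
  elim: n => [|n IHn] n6; first by right.
  have [Iq|mu_ge0] := IHn (ltnW n6); first by left.
  have [Iq|mun] := e6_dominant n6 (simple _ n6); first by left.
  by right=> i; rewrite ltnS leq_eqVlt => /predU1P[->|/mu_ge0].
have [Iq|mu_ge0] := all_mu 6%N isT; first by left.
right=> m mq a j a_gt2.
have [b0 b2] := depth_bounds q_neq0.
have b_ge0 k : (k < 6)%N -> 0 <= b k.
  move=> k6; rewrite leNgt; apply/negP => bk; apply: q_neq0.
  apply: (homogeneous_lt0 charK0 _ bk (bq k6)) => x.
  by case/mxvec_indexP: x => a' i; rewrite depth2E.
have l2_ge0 : 0 <= l c2.
  by rewrite leNgt; apply/negP => l2; apply/q_neq0/(gl_weight_ge0 charK0 lq l2).
have [/andP[l21 l10]|//] :=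
  highest_dominant charK0 (zero_subspace K 27) (fun i j => @zero_stable K 27 _) lq hq.
have b3 := e6_casimir_equality l10 l21 l2_ge0 b_ge0 b0 b2 mu_ge0 (eqP zE).
have := homogeneous_grade charK0 (bq (isT : (3 < 6)%N)) mq.
rewrite b3 grade_sum => /eqP; rewrite psumr_eq0; last first.
  by move=> a' _; apply: sumr_ge0 => i _; apply: mulr_ge0.
move=> /allP/(_ a (mem_index_enum _))/=; rewrite psumr_eq0; last first.
  by move=> i _; apply: mulr_ge0.
move=> /allP/(_ j (mem_index_enum _))/=; rewrite mulf_eq0.
have [_ _ /(_ a_gt2)] := depth_gt0 a; move: (depth 3 a) => x x_ge1.
by case/orP => [/eqP x0|/eqP[]//]; rewrite x0 in x_ge1.
Qed.

End HighestVector.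

(** * Induction on the e_6-weight *)

Section Core.
Variable K : fieldType.
Hypothesis charK0 : [pchar K] =i pred0.
Local Notation S := {mpoly K[27 * 3]}.
Local Notation idx := (@mxvec_index 27 3).
Local Notation egl := (@egl K 27 3).
Local Notation lmul := (@lmul K 27 3).
Local Notation highest0 := (@highest K 27 (fun p => p = 0)).
Local Notation I := (in_ideal (quadrics K)).

Variable J : S -> Prop.
Hypothesis subJ : subspace J.
Hypothesis stE : forall i, (i < 6)%N -> stable J (lmul (raise_mx K i)).
Hypothesis stF : forall i, (i < 6)%N -> stable J (lmul (lower_mx K i)).
Hypothesis stG : forall i j, stable J (egl i j).
Hypothesis Jtop : forall p, J p ->
  (forall m, m \in msupp p -> forall (a : 'I_27) j, (2 < a)%N -> m (idx a j) = 0%N) ->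
  p = 0.

Let subI := in_ideal_subspace (quadrics K).

Lemma gl_weight_lmul A l p : gl_weight l p -> gl_weight l (vfield (lmul A) p).
Proof.
move=> lp j; rewrite -[l j]addr0; apply: homogeneous_shift (lp j).
by rewrite -egl_diag lmul_egl subrr scale0r.
Qed.

Lemma highest0_lmul A q : highest0 q -> highest0 (vfield (lmul A) q).
Proof.
have E i j : vfield (egl i j) q = 0 -> vfield (egl i j) (vfield (lmul A) q) = 0.
  by move=> q0; rewrite vfield_comm q0 linear0 lmul_egl subrr vfield0 addr0.
by case=> ? ? ?; split; apply: E.
Qed.

(** Raising by a positive root preserves [J] and exact highestness for gl_3 and lowers the total
    depth. By induction [q] is therefore highest for e_6 modulo [I]. In the base case some depth is
    negative, which forces [q] to vanish. *)
Lemma highest_in_quadrics N l b q : J q -> gl_weight l q -> highest0 q ->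
  (forall k, (k < 6)%N -> homogeneous (depth2 k) (b k) q) ->
  sum_nodes b < N%:Z -> I q.
Proof.
elim: N b q => [|N IHN] b q Jq lq hq bq ltN.
  have [k k6 bk] : exists2 k, (k < 6)%N & b k < 0.
    have [/allP b_ge0|] := boolP (all (fun k => 0 <= b k) nodes).
      have : 0 <= sum_nodes b by rewrite sum_nodesE big_seq; apply: sumr_ge0.
      by rewrite leNgt ltN.
    by case/allPn => k; rewrite mem_iota -ltNge => k6 bk; exists k.
  rewrite (homogeneous_lt0 charK0 _ bk (bq k k6)); first exact: subspace0.
  by move=> x; case/mxvec_indexP: x => a i; rewrite depth2E.
have [w ww|//|] := e6_highest_vector charK0 lq hq bq.
  apply: (IHN (fun k => b k - (count_mem k w)%:Z)).
  - by have [sw _] := root_stable subJ stE stF ww; apply: sw.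
  - exact: gl_weight_lmul.
  - exact: highest0_lmul.
  - move=> k k6; apply: homogeneous_shift (bq k k6).
    rewrite /depth2 -(lmul_diagz K 3 (fun a : 'I_27 => depth k a)) lmul_comm.
    by rewrite depth_root_comm // linearZ.
  - have : 0 < sum_nodes (fun k => (count_mem k w)%:Z) by apply: (allP check_root_words).
    move: ltN; rewrite !sum_nodesE sumrB.
    move: (\sum_(k <- nodes) (count_mem k w)%:Z) (\sum_(k <- nodes) b k) => x y.
    by lia.
by move/(Jtop Jq)->; apply: subspace0.
Qed.

Theorem vanishing_in_quadrics p : J p -> I p.
Proof.
apply: (highest_suffices charK0) => //; first exact: ideal_egl_stable.
move=> l q Jq lq hq; pose P x := [/\ J x, gl_weight l x & highest0 x].
have subP : subspace P.
  have subl := gl_weight_subspace K 27 l.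
  split.
  - split; [exact: subspace0|exact: (subspace0 subl)|].
    by split; rewrite linear0.
  - move=> x y [Jx lx [x1 x2 x3]] [Jy ly [y1 y2 y3]].
    split; [exact: subspaceD|exact: (subspaceD subl)|].
    by split; rewrite linearD /= ?x1 ?x2 ?x3 ?y1 ?y2 ?y3 addr0.
  - move=> c x [Jx lx [x1 x2 x3]]; split; [exact: subspaceZ|exact: (subspaceZ subl)|].
    by split; rewrite linearZ /= ?x1 ?x2 ?x3 scaler0.
have size6 : size [seq depth2 k | k <- nodes] = 6%N by [].
apply: (multigraded_ind charK0 (ds := [seq depth2 k | k <- nodes]) subP subI).
- move=> k; rewrite size6 => k6; rewrite (nth_map 0%N) // nth_iota // add0n.
  move=> x [Jx lx hx]; split; first exact: (depth_stable charK0 subJ stE stF stG k6 Jx).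
    by rewrite /depth2 -(lmul_diagz K 3 (fun a : 'I_27 => depth k a)); apply: gl_weight_lmul.
  by rewrite /depth2 -(lmul_diagz K 3 (fun a : 'I_27 => depth k a)); apply: highest0_lmul.
- move=> x [Jx lx hx] wx.
  have [b0 h0] := wx 0%N isT; have [b1 h1] := wx 1%N isT.
  have [b2 h2] := wx 2%N isT; have [b3 h3] := wx 3%N isT.
  have [b4 h4] := wx 4%N isT; have [b5 h5] := wx 5%N isT.
  pose b k := nth 0 [:: b0; b1; b2; b3; b4; b5] k.
  apply: (@highest_in_quadrics `|sum_nodes b|.+1 l b) => //; last by lia.
  by do 6!case=> //.
- by [].
Qed.

End Core.

(** * Uniqueness of the minuscule representation *)

(** Adjoin vectors satisfying [Q] as long as there are any outside; the dimension bounds the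
    process. It makes irreducibility, stated for [{vspace _}], applicable to inductively defined
    submodules. *)
Lemma prop_vspace (K : fieldType) (vT : vectType K) (Q : vT -> Prop) :
  Q 0 -> (forall c x y, Q x -> Q y -> Q (c *: x + y)) ->
  exists U : {vspace vT}, forall x, x \in U <-> Q x.
Proof.
move=> Q0 QD; suff grow (n : nat) (U : {vspace vT}) : (\dim {:vT} < n + \dim U)%N ->
    (forall x, x \in U -> Q x) -> exists U : {vspace vT}, forall x, x \in U <-> Q x.
  apply: (grow (\dim {:vT}).+1 0%VS); first by rewrite dimv0 addn0.
  by move=> x; rewrite memv0 => /eqP->.
elim: n U => [|n IHn] U ltn UQ.
  by move: ltn; rewrite ltnNge dimvS ?subvf.
have [[x [Qx xU]]|allU] := classic (exists x, Q x /\ x \notin U).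
  apply: (IHn (<[x]> + U)%VS).
    have -> : \dim (<[x]> + U) = (\dim U).+1.
      have x0 : x != 0 by apply: contraNneq xU => ->; apply: mem0v.
      rewrite dimv_disjoint_sum ?dim_vline ?x0 //.
      apply/eqP; rewrite -subv0; apply/subvP => y; rewrite memv_cap memv0.
      case/andP => /vlineP[c ->] cxU; have [->|c0] := eqVneq c 0.
        by rewrite scale0r.
      by case/negP: xU; rewrite -(scalerK c0 x) memvZ.
    by move: ltn; rewrite addSnnS.
  by move=> y /memv_addP[_ /vlineP[c ->] [z zU ->]]; apply: QD => //; apply: UQ.
exists U => x; split; first exact: UQ.
by move=> Qx; apply: contraT => xU; case: allU; exists x.
Qed.

Lemma big_nodes (R : nmodType) (G : nat -> R) :
  \sum_(k <- nodes) G k = \sum_(i < 6) G i.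
Proof. by rewrite -(big_mkord xpredT G) /index_iota subn0. Qed.

Lemma e6_cartanE (i j : 'I_6) : e6_cartan i j = cartan i j.
Proof.
by case: i => [[|[|[|[|[|[|//]]]]]] ?]; case: j => [[|[|[|[|[|[|//]]]]]] ?].
Qed.

Lemma check_top : all (fun i => [&& e6_weight i 0 == (i == 0%N)%:Z &
  all (fun t => t.1.1 != 0%N) (sp_lower i)]) nodes.
Proof. by vm_compute. Qed.

Definition parent_check (a i b : nat) : bool :=
  (b < a)%N && sp_is0 (sp_mul (sp_lower i) [:: (b, b, 1)] ++ [:: (a, b, -1)]).

(** Every basis vector except the top one is the image, with coefficient exactly 1, of an earlier
    one under a simple lowering operator. *)
Lemma check_parent : all (fun a => has (fun i => has (parent_check a i) indices) nodes)
  (iota 1 26).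
Proof. by vm_compute. Qed.

(* The coefficients of the sum of the positive coroots on the simple coroots. *)
Definition two_rho : seq int := [:: 16; 22; 30; 42; 30; 16].

Lemma check_two_rho_cartan : all (fun j =>
  sum_nodes (fun i => nth 0 two_rho i * cartan i j) == 2) nodes.
Proof. by vm_compute. Qed.

Section ModelIso.
Variable K : fieldType.
Hypothesis charK0 : [pchar K] =i pred0.
Variables (V : chev_ops K 27) (v : 'cV[K]_27).
Hypothesis hV : irrep_of_highest_weight V (fund_weight node1) v.

Local Notation e := (ce V).
Local Notation f := (cf V).
Local Notation h := (ch V).
Local Notation E i := (raise_mx K (i : 'I_6)).
Local Notation F i := (lower_mx K (i : 'I_6)).
Local Notation H i := (diagz K (fun a : 'I_27 => e6_weight (i : 'I_6) a)).
Local Notation basis a := (delta_mx a 0 : 'cV[K]_27).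

(** The part of the direct sum of [V] and the model generated from the pair of top vectors by
    lowering. It turns out to be a submodule and the graph of the isomorphism. *)
Inductive linked : 'cV[K]_27 -> 'cV[K]_27 -> Prop :=
  | linked_top : linked v (basis 0)
  | linked_f i x y : linked x y -> linked (f i *m x) (F i *m y)
  | linked_lin c x y x' y' :
      linked x y -> linked x' y' -> linked (c *: x + x') (c *: y + y').

Lemma linked0 : linked 0 0.
Proof.
have := linked_lin (-1) linked_top linked_top.
by rewrite !scaleN1r !addNr.
Qed.

Lemma linkedZ c x y : linked x y -> linked (c *: x) (c *: y).
Proof. by move=> xy; have := linked_lin c xy linked0; rewrite !addr0. Qed.

Lemma linkedD x y x' y' : linked x y -> linked x' y' -> linked (x + x') (y + y').
Proof. by move=> xy xy'; have := linked_lin 1 xy xy'; rewrite !scale1r. Qed.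

Lemma linkedB x y x' y' : linked x y -> linked x' y' -> linked (x - x') (y - y').
Proof.
by move=> xy xy'; apply: linkedD => //; rewrite -!scaleN1r; apply: linkedZ.
Qed.

Lemma linked_sum (I : Type) (r : seq I) (X Y : I -> 'cV[K]_27) :
  (forall i, linked (X i) (Y i)) ->
  linked (\sum_(i <- r) X i) (\sum_(i <- r) Y i).
Proof.
move=> XY; elim: r => [|i r IHr]; first by rewrite !big_nil; apply: linked0.
by rewrite !big_cons; apply: linkedD.
Qed.

Lemma hf_comm i j : h i *m f j = f j *m h i - (cartan i j)%:~R *: f j.
Proof.
have [hrep _ _] := hV; have [_ _ _ hf _] := hrep i j.
by rewrite -e6_cartanE -hf /bracket addrC subrK.
Qed.

Lemma ef_comm i j : e i *m f j = f j *m e i + (if i == j then h i else 0).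
Proof.
have [hrep _ _] := hV; have [_ ef _ _ _] := hrep i j.
by rewrite -ef /bracket addrC subrK.
Qed.

Lemma HF_comm (i j : 'I_6) : H i *m F j = F j *m H i - (cartan i j)%:~R *: F j.
Proof. by rewrite -weight_lower_comm ?ltn_ord // addrC subrK. Qed.

Lemma EF_comm (i j : 'I_6) : E i *m F j = F j *m E i + (if i == j then H i else 0).
Proof.
by rewrite -[i == j]val_eqE -raise_lower_comm ?ltn_ord // addrC subrK.
Qed.

Lemma top_check (i : 'I_6) :
  e6_weight i 0 = (i == 0 :> nat)%:Z /\ forall a : 'I_27, F i 0 a = 0.
Proof.
have /allP/(_ _ (mem_nodes (ltn_ord i)))/andP[/eqP -> /allP F0] := check_top.
split=> // a; rewrite sp_mxE.
suff -> : sp_coef (sp_lower i) 0 a = 0 by [].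
elim: (sp_lower i) F0 => //= t s IHs F0; rewrite (negPf (F0 t _)) ?mem_head //=.
by apply: IHs => u us; apply: F0; rewrite inE us orbT.
Qed.

Lemma node1E (i : 'I_6) : fund_weight node1 i = (i == 0 :> nat)%:Z.
Proof. by rewrite /fund_weight -val_eqE /= inordK //; case: eqP. Qed.

Lemma linked_h i x y : linked x y -> linked (h i *m x) (H i *m y).
Proof.
elim=> [|j x' y' xy IH|c x1 y1 x2 y2 _ IH1 _ IH2].
- have [_ _ [_ /(_ i)[_ ->]]] := hV.
  have -> : H i *m basis 0 = (fund_weight node1 i)%:~R *: basis 0.
    apply/matrixP => a b; rewrite ord1 mxE (bigD1 a) //= big1 ?addr0.
      rewrite diagzE eqxx mulr1n !mxE node1E; case: eqP => [->|]; last first.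
        by rewrite !mulr0.
      by have [-> _] := top_check i.
    by move=> c ca; rewrite diagzE eq_sym (negPf ca) mul0r.
  exact/linkedZ/linked_top.
- rewrite !mulmxA hf_comm HF_comm !mulmxBl -!scalemxAl -!mulmxA.
  by apply: linkedB; [apply: linked_f | apply/linkedZ/linked_f].
- by rewrite !mulmxDr -!scalemxAr; apply: linked_lin.
Qed.

Lemma linked_e i x y : linked x y -> linked (e i *m x) (E i *m y).
Proof.
elim=> [|j x' y' xy IH|c x1 y1 x2 y2 _ IH1 _ IH2].
- have [_ _ [_ /(_ i)[-> _]]] := hV.
  have -> : E i *m basis 0 = 0.
    apply/matrixP => a b; rewrite -colE !mxE raise_mxE mxE.
    by have [_ ->] := top_check i.
  exact: linked0.
- rewrite !mulmxA ef_comm EF_comm !mulmxDl -!mulmxA.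
  apply: linkedD; first exact: linked_f.
  by case: eqP => _; [apply: linked_h | rewrite !mul0mx; apply: linked0].
- by rewrite !mulmxDr -!scalemxAr; apply: linked_lin.
Qed.

Let z : 'M[K]_27 := \sum_(i < 6) (nth 0 two_rho i)%:~R *: h i.

Lemma zf j : z *m f j = f j *m z - 2%:~R *: f j.
Proof.
have /allP/(_ _ (mem_nodes (ltn_ord j)))/eqP <- := check_two_rho_cartan.
rewrite sum_nodesE big_nodes rmorph_sum scaler_suml mulmx_suml mulmx_sumr -sumrB;
  apply: eq_bigr => i _.
by rewrite -scalemxAl hf_comm scalerBr scalemxAr scalerA rmorphM.
Qed.

Lemma zv : z *m v = 16%:~R *: v.
Proof.
rewrite mulmx_suml big_ord_recl big1 ?addr0.
  have [_ _ [_ /(_ ord0)[_ hv]]] := hV; rewrite -scalemxAl hv node1E /= scalerA.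
  by rewrite mulr1.
move=> i _; have [_ _ [_ /(_ (lift ord0 i))[_ hv]]] := hV.
by rewrite -scalemxAl hv node1E /= scale0r scaler0.
Qed.

(* Below the top weight space some product of the [z - (14 - 2k)] vanishes,
   whereas on [v] each factor is a nonzero scalar. *)
Fixpoint lowering_prod (n : nat) : 'M[K]_27 :=
  if n is k.+1 then (z - (14 - 2 * k%:Z)%:~R *: 1%:M) *m lowering_prod k else 1%:M.

Lemma z_shift_comm a b :
  (z - a *: 1%:M) *m (z - b *: 1%:M) = (z - b *: 1%:M) *m (z - a *: 1%:M).
Proof.
rewrite !mulmxBl !mulmxBr -!scalemxAl -!scalemxAr !mul1mx !mulmx1.
by rewrite !opprB addrACA [RHS]addrACA !scalerA [b * a]mulrC [- _ - _]addrC.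
Qed.

(** Moving a factor past [f j] shifts its constant by 2. The factor [z - 14] becomes [z - 16], which
    kills [v], and the others become the shorter product. *)
Lemma lowering_prod_f n j :
  lowering_prod n.+1 *m f j = f j *m (z - 16%:~R *: 1%:M) *m lowering_prod n.
Proof.
elim: n => [|n IHn].
  rewrite /= !mulmx1 mulmxBl mulmxBr zf -scalemxAl -scalemxAr mul1mx mulmx1.
  rewrite -addrA -opprD -scalerDl -rmorphD; congr (_ - _%:~R *: _).
rewrite [lowering_prod n.+2]/= -/(lowering_prod n.+1) -mulmxA IHn !mulmxA.
have -> : (z - (14 - 2 * n.+1%:Z)%:~R *: 1%:M) *m f j =
    f j *m (z - (14 - 2 * n%:Z)%:~R *: 1%:M).
  rewrite mulmxBl mulmxBr zf -scalemxAl -scalemxAr mul1mx mulmx1.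
  rewrite -addrA -opprD -scalerDl -rmorphD; congr (_ - _%:~R *: _).
  by lia.
rewrite -!mulmxA; congr (_ *m _); rewrite !mulmxA; congr (_ *m _).
exact: z_shift_comm.
Qed.

Lemma lowering_prod_f0 n j (x : 'cV_27) :
  lowering_prod n *m x = 0 -> lowering_prod n.+1 *m (f j *m x) = 0.
Proof. by move=> x0; rewrite mulmxA lowering_prod_f -mulmxA x0 mulmx0. Qed.

Lemma lowering_prod_le n n' (x : 'cV_27) :
  (n <= n')%N -> lowering_prod n *m x = 0 -> lowering_prod n' *m x = 0.
Proof.
move=> /subnK <-; elim: (n' - n)%N => //= k IHk x0.
by rewrite -mulmxA (IHk x0) mulmx0.
Qed.

Lemma lowering_prod_v n : lowering_prod n *m v =
  (\prod_(k < n) (2 + 2 * k%:Z))%:~R *: v.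
Proof.
elim: n => [|n IHn]; first by rewrite big_ord0 scale1r /= mul1mx.
rewrite big_ord_recr /= -mulmxA IHn -scalemxAr mulmxBl zv -scalemxAl mul1mx.
rewrite -scalerBl scalerA -rmorphB -rmorphM; congr (_%:~R *: _).
by congr (_ * _); lia.
Qed.

Lemma lowering_prod_v_neq0 n : lowering_prod n *m v <> 0.
Proof.
rewrite lowering_prod_v => /eqP; rewrite scaler_eq0 pchar0_intr_eq0 //.
have [_ _ [/negPf-> _]] := hV; rewrite orbF => /prodf_eq0[k _].
by lia.
Qed.

(** Row 0 of a lowering matrix is zero, so only multiples of the generating pair contribute to
    [y 0 0]; what remains of [x] is a sum of lowered vectors. *)
Lemma linked_top_coef x y : linked x y ->
  exists n, lowering_prod n *m (x - y 0 0 *: v) = 0.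
Proof.
elim=> [|j x' y' _ [n IH]|c x1 y1 x2 y2 _ [n1 IH1] _ [n2 IH2]].
- by exists 0%N; rewrite mxE !eqxx scale1r subrr mulmx0.
- exists n.+1; rewrite mxE big1 => [|a _].
    have [w x'E w0] : exists2 w, x' = w + y' 0 0 *: v & lowering_prod n *m w = 0.
      by exists (x' - y' 0 0 *: v); rewrite ?subrK.
    rewrite scale0r subr0 x'E !mulmxDr (lowering_prod_f0 j w0) add0r -!scalemxAr.
    rewrite (lowering_prod_le (n := 1)) ?scaler0 // mulmxA lowering_prod_f.
    rewrite /= mulmx1 -mulmxA mulmxBl zv -scalemxAl mul1mx subrr mulmx0.
    by [].
  by have [_ ->] := top_check j; rewrite mul0r.
- exists (maxn n1 n2); rewrite !mxE scalerDl opprD addrACA -scalerA -scalerBr.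
  rewrite mulmxDr -scalemxAr (lowering_prod_le _ IH1) ?leq_maxl //.
  by rewrite (lowering_prod_le _ IH2) ?leq_maxr // scaler0 addr0.
Qed.

(** The vectors linked with 0 form a submodule of [V]. If it were everything, [v] would be linked
    with 0 and hence killed by some [lowering_prod]. *)
Lemma linked_inj x x' y : linked x y -> linked x' y -> x = x'.
Proof.
move=> xy x'y; have := linkedB xy x'y; rewrite subrr => xx'.
have [U UE] : exists U : {vspace 'cV[K]_27}, forall t, t \in U <-> linked t 0.
  apply: prop_vspace => [|c t t' lt lt']; first exact: linked0.
  by have := linked_lin c lt lt'; rewrite scaler0 addr0.
have [_ [_ irr] _] := hV; have [] := irr U.
- move=> i t /UE t0; split; apply/UE.
  + by have := linked_e i t0; rewrite mulmx0.
  + by have := linked_f i t0; rewrite mulmx0.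
  + by have := linked_h i t0; rewrite mulmx0.
- move=> U0; apply/eqP; rewrite -subr_eq0 -memv0 -U0; exact/UE.
- move=> Ufull; have /UE/linked_top_coef[n] : v \in U by rewrite Ufull memvf.
  by rewrite mxE scale0r subr0 => /lowering_prod_v_neq0.
Qed.

Lemma linked_basis (a : 'I_27) : exists u, linked u (basis a).
Proof.
have [N ltN] := ubnP (a : nat); elim: N a ltN => // N IHN a ltN.
have [a0|a_gt0] := posnP a.
  exists v; have -> : a = 0 by apply: val_inj.
  exact: linked_top.
have aI : (a : nat) \in iota 1 26 by rewrite mem_iota a_gt0 (ltn_ord a).
have [i i6 [b b27 /andP[ba /sp_is0P-/(_ K 27)]]] : exists2 i, (i < 6)%N &
    exists2 b, (b < 27)%N & parent_check a i b.
  have /hasP[i] := allP check_parent _ aI; rewrite mem_iota => i6 /hasP[b].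
  by rewrite mem_iota => b27 ab; exists i => //; exists b.
rewrite sp_mx_cat sp_mxM ?sp_bounded_lower //.
have -> : sp_mx K 27 [:: (a : nat, b, -1)] = - nat_delta K 27 a b.
  by rewrite /sp_mx big_seq1 rmorphN scaleN1r.
have -> : sp_mx K 27 [:: (b, b, 1)] = nat_delta K 27 b b.
  by rewrite /sp_mx big_seq1 scale1r.
move/eqP; rewrite subr_eq0 => /eqP Fb.
have [u ub] := IHN (Ordinal b27) (leq_trans ba ltN).
exists (f (Ordinal i6) *m u); have := linked_f (Ordinal i6) ub.
suff -> : F (Ordinal i6) *m basis (Ordinal b27) = basis a by [].
have D r (rn : (r < 27)%N) : nat_delta K 27 r b *m basis (Ordinal b27) = basis (Ordinal rn).
  apply/matrixP => x y; rewrite ord1 mxE (bigD1 (Ordinal b27)) //= big1 ?addr0.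
    by rewrite !mxE /= !eqxx mulr1 !andbT.
  by move=> c cb; rewrite !mxE (negPf cb) mulr0.
have := congr1 (mulmx^~ (basis (Ordinal b27))) Fb.
rewrite -mulmxA (D b b27) (D a (ltn_ord a)) => ->.
by congr (delta_mx _ 0); apply: val_inj.
Qed.

Lemma model_iso : exists P : 'M[K]_27, [/\ P \in unitmx, P *m basis 0 = v,
  forall i : 'I_6, e i *m P = P *m E i & forall i : 'I_6, f i *m P = P *m F i].
Proof.
have [u ub] := fin_all_exists linked_basis.
pose P : 'M[K]_27 := \matrix_(i, a) u a i 0.
have Pb a : P *m basis a = u a.
  by rewrite -colE; apply/matrixP => i j; rewrite ord1 !mxE.
have Plink y : linked (P *m y) y.
  have yE : y = \sum_a y a 0 *: basis a.
    by rewrite {1}[y]matrix_sum_delta; apply: eq_bigr => a _; rewrite big_ord1.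
  rewrite yE mulmx_sumr; apply: linked_sum => a; rewrite -scalemxAr Pb.
  exact: linkedZ.
have inter A B : (forall x y, linked x y -> linked (A *m x) (B *m y)) ->
    A *m P = P *m B.
  move=> AB; apply/matrixP => i a.
  have -> (M : 'M[K]_27) : M i a = (M *m basis a) i 0 by rewrite -colE mxE.
  have -> (M : 'M[K]_27) : M i a = (M *m basis a) i 0 by rewrite -colE mxE.
  rewrite -!mulmxA (linked_inj (AB _ _ (Plink (basis a))) (Plink _)).
  by [].
have eP i : e i *m P = P *m E i by apply: inter => x y; apply: linked_e.
have fP i : f i *m P = P *m F i by apply: inter => x y; apply: linked_f.
have hP i : h i *m P = P *m H i by apply: inter => x y; apply: linked_h.
have Pv : P *m basis 0 = v by apply: linked_inj (Plink _) linked_top.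
exists P; split=> //; have [_ [_ irr] [v0 _]] := hV.
(* The image of [P] is a submodule that contains the nonzero vector [v], so irreducibility makes [P]
   surjective. *)
pose U := limg (linfun (mulmx P : 'cV_27 -> 'cV_27)).
have memU y : P *m y \in U.
  by have := memv_img (linfun (mulmx P : 'cV_27 -> 'cV_27)) (memvf y); rewrite lfunE.
have [|U0|Ufull] := irr U.
- move=> i x /memv_imgP[y _ ->]; rewrite lfunE /= !mulmxA eP fP hP -!mulmxA.
  by split; apply: memU.
- by have := memU (basis 0); rewrite U0 memv0 Pv (negPf v0).
have surj a : exists y, P *m y = basis a.
  have : basis a \in U by rewrite Ufull memvf.
  by case/memv_imgP => y _ ->; exists y; rewrite lfunE.
have [y yP] := fin_all_exists surj.
have : P *m (\matrix_(i, a) y a i 0) = 1%:M.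
  apply/matrixP => i a.
  transitivity ((P *m y a) i 0); first by rewrite !mxE; apply: eq_bigr => b _; rewrite mxE.
  by rewrite yP !mxE andbT.
by case/mulmx1_unit.
Qed.

End ModelIso.

(** * The points of Y *)

Lemma mpoly_ring_ind (K : fieldType) n (Q : {mpoly K[n]} -> Prop) :
  (forall c, Q c%:MP) -> (forall k, Q 'X_k) ->
  (forall p q, Q p -> Q q -> Q (p + q)) -> (forall p q, Q p -> Q q -> Q (p * q)) ->
  forall p, Q p.
Proof.
move=> QC QX QD QM p; rewrite [p]mpolyE; elim/big_rec: _ => [|m q _ Qq].
  by rewrite -mpolyC0; apply: (QC).
apply: (QD) => //; rewrite -mul_mpolyC; apply: (QM); rewrite ?mpolyXE_id //.
elim/big_rec: _ => [|k r _ Qr]; first by rewrite -mpolyC1; apply: (QC).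
apply: (QM) => //; elim: (m k) => [|i IHi]; first by rewrite expr0 -mpolyC1; apply: QC.
by rewrite exprS; apply: QM.
Qed.

Lemma eq_mmap n (R A : nzRingType) (h : R -> A) (x y : 'I_n -> A) p :
  x =1 y -> mmap h x p = mmap h y p.
Proof.
move=> xy; rewrite /mmap; apply: eq_bigr => m _; congr (_ * _).
by apply: eq_bigr => k _; rewrite xy.
Qed.

Lemma pchar0_poly_eq0 (L : fieldType) (f : {poly L}) : [pchar L] =i pred0 ->
  (forall t, f.[t] = 0) -> f = 0.
Proof.
move=> charL0 f0; apply: (@roots_geq_poly_eq0 _ _ [seq i%:R | i <- iota 0 (size f)]).
- by apply/allP => t _; rewrite /root f0.
- rewrite map_inj_uniq ?iota_uniq // => i j ij.
  by have /(pchar0_intr_inj charL0)/eqP := ij : (i%:Z)%:~R = (j%:Z)%:~R :> L;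
    rewrite eqz_nat => /eqP.
- by rewrite size_map size_iota.
Qed.

Section Curve.
Variables (K L : fieldType) (iota : {rmorphism K -> L}) (n : nat).
Implicit Types (p : {mpoly K[n]}) (x y : 'I_n -> L).

Local Notation iotaX := (polyC \o iota).

Lemma horner_mmap (X : 'I_n -> {poly L}) p t :
  (mmap iotaX X p).[t] = mmap iota (fun k => (X k).[t]) p.
Proof.
elim/mpoly_ring_ind: p => [c|k|p q IHp IHq|p q IHp IHq].
- by rewrite !mmapC /= hornerC.
- by rewrite !mmapX !mmap1U.
- by rewrite !raddfD hornerD IHp IHq.
- by rewrite !rmorphM hornerM IHp IHq.
Qed.

Lemma deriv_mmap (X : 'I_n -> {poly L}) p :
  (mmap iotaX X p)^`() = \sum_k mmap iotaX X p^`M(k) * (X k)^`().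
Proof.
elim/mpoly_ring_ind: p => [c|k|p q IHp IHq|p q IHp IHq].
- rewrite mmapC /= derivC big1 // => k _.
  by rewrite mderivC raddf0 mul0r.
- rewrite mmapX mmap1U (bigD1 k) //= mderivXU eqxx rmorph1 mul1r big1 ?addr0 //.
  by move=> l lk; rewrite mderivXU eq_sym (negPf lk) rmorph0 mul0r.
- rewrite raddfD derivD IHp IHq -big_split; apply: eq_bigr => k _ /=.
  by rewrite mderivD raddfD mulrDl.
- rewrite rmorphM derivM IHp IHq mulr_suml mulr_sumr -big_split.
  apply: eq_bigr => k _ /=; rewrite mderivM raddfD /= !rmorphM /=.
  by ring.
Qed.

(** The restriction of [p] to the line is a polynomial in [t] with infinitely many zeros, hence
    zero; the value of the field at [x] is its derivative at [t = 0]. *)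
Lemma vfield_line p x y (M : 'M[K]_n) : [pchar K] =i pred0 ->
  (forall k, mmap iota x (linform M k) = y k) ->
  (forall t, mmap iota (fun k => x k + t * y k) p = 0) ->
  mmap iota x (vfield M p) = 0.
Proof.
move=> charK0 My p0; pose X k := (x k)%:P + y k *: 'X.
have X0 : mmap iotaX X p = 0.
  apply: pchar0_poly_eq0 => [q|t]; first by rewrite (fmorph_pchar iota) charK0.
  rewrite horner_mmap -[RHS](p0 t); apply: eq_mmap => k.
  by rewrite /X hornerD hornerC hornerZ hornerX mulrC.
have Xx q : mmap iota x q = (mmap iotaX X q).[0].
  rewrite horner_mmap; apply: eq_mmap => k.
  by rewrite /X hornerD hornerC hornerZ hornerX mulr0 addr0.
transitivity ((mmap iotaX X p)^`()).[0]; last by rewrite X0 deriv0 horner0.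
rewrite deriv_mmap vfieldE raddf_sum horner_sum; apply: eq_bigr => k _ /=.
rewrite rmorphM /= My hornerM -Xx mulrC /X derivD derivC add0r derivZ derivX.
by rewrite hornerZ hornerC mulr1.
Qed.

Lemma mmap_subst m (X : 'I_n -> {mpoly K[m]}) (x : 'I_m -> L) p :
  mmap iota x (mmap (@mpolyC m K) X p) = mmap iota (fun k => mmap iota x (X k)) p.
Proof.
elim/mpoly_ring_ind: p => [c|k|p q IHp IHq|p q IHp IHq].
- by rewrite !mmapC.
- by rewrite !mmapX !mmap1U.
- by rewrite !raddfD /= IHp IHq.
- by rewrite !rmorphM /= IHp IHq.
Qed.

End Curve.

(** The columns up to 2 describe the action on the top plane: all raising operators preserve it, as
    do the lowering operators other than that of node 4. Nodes 1, 3 and 4 lower the basis vector 0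
    to 1, 1 to 2 and 2 to 3. *)
Lemma check_plane : all (fun i =>
    all (fun t => [|| 2 < t.1.2, t.1.1 < 3 | i == 3])%N (sp_lower i) &&
    all (fun t => (t.1.1 < t.1.2)%N) (sp_raise i)) nodes &&
  [&& all (fun t => (2 < t.1.2)%N || (t == (1, 0, 1))) (sp_lower 0),
      all (fun t => (2 < t.1.2)%N || (t == (2, 1, 1))) (sp_lower 2),
      all (fun t => (2 < t.1.2)%N || (t == (3, 2, 1))) (sp_lower 3) &
      all (fun t => (2 < t.1.2)%N) (sp_raise 3)].
Proof. by vm_compute. Qed.

Section Plane.
Variable L : fieldType.

(* The columns of [plane] span the fibre of the tautological bundle. *)
Definition plane : 'M[L]_(27, 3) := \matrix_(i, j) ((i : nat) == j)%:R.

Definition wid (j : 'I_3) : 'I_27 := widen_ord (isT : 3 <= 27)%N j.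

Lemma mul_plane n (M : 'M[L]_(n, 27)) i j : (M *m plane) i j = M i (wid j).
Proof.
rewrite mxE (bigD1 (wid j)) //= mxE eqxx mulr1 big1 ?addr0 // => k kj.
rewrite mxE; have -> : ((k : nat) == j) = false; last by rewrite mulr0.
by apply/negbTE; apply: contra kj => /eqP kj; apply/eqP/val_inj.
Qed.

Lemma plane_mul n (B : 'M[L]_(3, n)) i k : (plane *m B) i k =
  if insub (i : nat) is Some j then B j k else 0.
Proof.
rewrite mxE; case: insubP => [j _ ji|i3].
  rewrite (bigD1 j) //= mxE -ji eqxx mul1r big1 ?addr0 // => j' j'j.
  rewrite mxE -ji; case: eqP => [/val_inj e|_]; last by rewrite mul0r.
  by rewrite e eqxx in j'j.
rewrite big1 // => j _; rewrite mxE; case: eqP => [ij|]; rewrite ?mul0r //.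
by rewrite ij ltn_ord in i3.
Qed.

Lemma plane_stable (M : 'M[L]_27) :
  (forall (i : 'I_27) (j : 'I_3), (2 < i)%N -> M i (wid j) = 0) ->
  exists B, M *m plane = plane *m B.
Proof.
move=> M0; exists (\matrix_(i, j) M (wid i) (wid j)).
apply/matrixP => i j; rewrite mul_plane plane_mul.
case: insubP => [k _ ki|i3]; last by rewrite M0 // ltnNge -ltnS.
by rewrite mxE; congr (M _ _); apply: val_inj.
Qed.

Lemma sp_mx_plane l (r c : nat) :
  all (fun t => (2 < t.1.2)%N || (t == (r, c, 1))) l -> count_mem (r, c, 1) l = 1%N ->
  sp_mx L 27 l *m plane = \matrix_(i, j) (((i : nat) == r) && ((j : nat) == c))%:R.
Proof.
move=> lall l1; apply/matrixP => i j; rewrite mul_plane sp_mxE mxE.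
suff -> : sp_coef l i (wid j) =
    ((((i : nat) == r) && ((j : nat) == c)) * count_mem (r, c, 1%Z) l)%:Z.
  by rewrite l1 muln1; case: (_ && _).
elim: l lall {l1} => [_|[[r' c'] s] l IHl] /=; first by rewrite muln0.
case/andP => t2 /IHl->; case: (eqVneq (r', c', s) (r, c, 1)) t2 => [[-> -> ->] _|_].
  by rewrite eq_sym [c == _]eq_sym; case: (_ && _); rewrite ?mul0n // !mul1n.
rewrite orbF add0n => c'2; case: eqP => //= _; case: eqP => // c'j.
by move: c'2; rewrite c'j ltnNge -ltnS ltn_ord.
Qed.

End Plane.

Section Points.
Variables (L : fieldType) (m : nat) (rho : chev_ops L 27) (tau : chev_ops L m).
Variables (P : 'M[L]_27) (v : 'cV[L]_27) (w : 'cV[L]_m).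
Hypothesis Pu : P \in unitmx.
Hypothesis Pv : P *m delta_mx 0 0 = v.
Hypothesis eP : forall i, ce rho i *m P = P *m raise_mx L (i : 'I_6).
Hypothesis fP : forall i, cf rho i *m P = P *m lower_mx L (i : 'I_6).

Local Notation Y := (Y_points rho tau v w).
Local Notation plane := (plane L).

(** The size [n.+2] ensures that the truncated series contains its linear term. *)
Lemma expmx_square0 n (t : L) (x : 'M[L]_n.+2) :
  x *m x = 0 -> expmx t x = 1%:M + t *: x.
Proof.
move=> x2; rewrite /expmx !big_ord_recl big1 => [|i _].
  by rewrite addr0 !divr1 !expr1 !expr0 scale1r.
have xx : x * x = 0 by [].
have -> : x ^+ (lift ord0 (lift ord0 i)) = 0 by rewrite /= !exprS mulrA xx mul0r.
by rewrite scaler0.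
Qed.

Lemma conj_expmx t (A B : 'M[L]_27) : A *m P = P *m B -> B *m B = 0 ->
  expmx t A *m P = P *m (1%:M + t *: B).
Proof.
move=> AP B2; rewrite expmx_square0; last first.
  rewrite -[A *m A]mulmx1 -(mulmxV Pu) !mulmxA -[A *m A *m P]mulmxA AP mulmxA AP.
  by rewrite -[P *m B *m B]mulmxA B2 mulmx0 mul0mx.
by rewrite mulmxDl mulmxDr mul1mx mulmx1 -scalemxAl -scalemxAr AP.
Qed.

Lemma x_pos_conj i t :
  (x_pos rho tau i t).1 *m P = P *m (1%:M + t *: raise_mx L (i : 'I_6)).
Proof. by apply: conj_expmx; [apply: eP | apply: raise_mx_sq]. Qed.

Lemma x_neg_conj i t :
  (x_neg rho tau i t).1 *m P = P *m (1%:M + t *: lower_mx L (i : 'I_6)).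
Proof. by apply: conj_expmx; [apply: fP | apply: lower_mx_sq]. Qed.

Lemma Y_pointsP phi : Y phi <-> exists2 g, e6_group rho tau g &
  forall a : 'cV_3, exists u, levi_span rho tau node4 v u /\ phi *m a = g.1 *m u.
Proof.
split=> [[C [g [eg _ ga]]]|[g eg ga]]; first by exists g.
exists (fun x => exists p, line_stabilizer rho tau w p /\ x = g * p).
by exists g; split.
Qed.

Lemma Y_act x phi : (exists i t, x = x_pos rho tau i t \/ x = x_neg rho tau i t) ->
  Y phi -> Y (x.1 *m phi).
Proof.
move=> xg /Y_pointsP[g eg ga]; apply/Y_pointsP; exists (x * g).
  exact: gen_mul.
move=> a; have [u [lu ua]] := ga a; exists u; split=> //.
by rewrite -mulmxA ua mulmxA.
Qed.

Lemma Y_raise (i : 'I_6) t psi :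
  Y (P *m psi) -> Y (P *m ((1%:M + t *: raise_mx L i) *m psi)).
Proof.
move=> Yp; rewrite mulmxA -x_pos_conj -mulmxA; apply: Y_act => //.
by exists i, t; left.
Qed.

Lemma Y_lower (i : 'I_6) t psi :
  Y (P *m psi) -> Y (P *m ((1%:M + t *: lower_mx L i) *m psi)).
Proof.
move=> Yp; rewrite mulmxA -x_neg_conj -mulmxA; apply: Y_act => //.
by exists i, t; right.
Qed.

Lemma Y_mulr (B : 'M_3) phi : Y phi -> Y (phi *m B).
Proof.
move=> /Y_pointsP[g eg ga]; apply/Y_pointsP; exists g => // a.
by have [u [lu ua]] := ga (B *m a); exists u; rewrite -mulmxA.
Qed.

Lemma node4E : (node4 : nat) = 3%N.
Proof. by rewrite inordK. Qed.

Local Notation delta3 r c :=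
  (\matrix_(i < 27, j < 3) (((i : nat) == r) && ((j : nat) == c))%:R : 'M[L]_(27, 3)).

Lemma lower0_plane : lower_mx L 0 *m plane = delta3 1%N 0%N.
Proof.
by apply: sp_mx_plane => //; have /and5P[_ -> _ _ _] := check_plane.
Qed.

Lemma lower2_plane : lower_mx L 2 *m plane = delta3 2%N 1%N.
Proof.
by apply: sp_mx_plane => //; have /and5P[_ _ -> _ _] := check_plane.
Qed.

Lemma lower3_plane : lower_mx L 3 *m plane = delta3 3%N 2%N.
Proof.
by apply: sp_mx_plane => //; have /and5P[_ _ _ -> _] := check_plane.
Qed.

Lemma raise3_plane : raise_mx L 3 *m plane = 0.
Proof.
apply/matrixP => i j; rewrite mul_plane sp_mxE mxE.
have /and5P[_ _ _ _ /allP c3] := check_plane; rewrite sp_coef_eq0 // => t /c3.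
by apply: contraTN => /andP[_ /eqP->]; rewrite -leqNgt -ltnS (ltn_ord j).
Qed.

Lemma raise_plane (i : 'I_6) : exists B, raise_mx L i *m plane = plane *m B.
Proof.
apply: plane_stable => a j a_gt2; rewrite sp_mxE.
have /andP[/allP/(_ _ (mem_nodes (ltn_ord i)))/andP[_ /allP lt12] _] := check_plane.
rewrite sp_coef_eq0 // => t /lt12; apply: contraTN => /andP[/eqP-> /eqP->] /=.
by rewrite -leqNgt; apply/ltnW/(leq_trans (ltn_ord j)).
Qed.

Lemma lower_plane (i : 'I_6) : i != node4 ->
  exists B, lower_mx L i *m plane = plane *m B.
Proof.
rewrite -val_eqE /= node4E => /negPf i3.
apply: plane_stable => a j a_gt2; rewrite sp_mxE.
have /andP[/allP/(_ _ (mem_nodes (ltn_ord i)))/andP[/allP c3 _] _] := check_plane.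
rewrite sp_coef_eq0 // => t /c3; rewrite i3 orbF.
apply: contraTN => /andP[/eqP-> /eqP->] /=.
by rewrite negb_or -!leqNgt a_gt2 andbT -ltnS (ltn_ord j).
Qed.

Lemma fst_mul (x y : 'M[L]_27 * 'M[L]_m) : (x * y).1 = x.1 *m y.1.
Proof. by []. Qed.

Definition preserves_plane (g : 'M[L]_27 * 'M[L]_m) :=
  exists B, g.1 *m (P *m plane) = P *m plane *m B.

Lemma preserves_planeM x g :
  preserves_plane x -> preserves_plane g -> preserves_plane (x * g).
Proof.
move=> [B xB] [C gC]; exists (B *m C).
by rewrite fst_mul -mulmxA gC mulmxA xB !mulmxA.
Qed.

Lemma x_pos_plane i t : preserves_plane (x_pos rho tau i t).
Proof.
have [B iB] := raise_plane i; exists (1%:M + t *: B).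
rewrite mulmxA x_pos_conj -!mulmxA; congr (_ *m _).
by rewrite mulmxDl mulmxDr mul1mx mulmx1 -scalemxAl -scalemxAr iB.
Qed.

Lemma x_neg_plane i t : i != node4 -> preserves_plane (x_neg rho tau i t).
Proof.
move=> /lower_plane[B iB]; exists (1%:M + t *: B).
rewrite mulmxA x_neg_conj -!mulmxA; congr (_ *m _).
by rewrite mulmxDl mulmxDr mul1mx mulmx1 -scalemxAl -scalemxAr iB.
Qed.

Lemma weyl_conj i t : (weyl_elt rho tau i t).1 *m P =
  P *m ((1%:M + t *: raise_mx L (i : 'I_6)) *m
        (1%:M - t^-1 *: lower_mx L (i : 'I_6)) *m
        (1%:M + t *: raise_mx L (i : 'I_6))).
Proof.
rewrite /weyl_elt !fst_mul -mulmxA x_pos_conj mulmxA -[_ *m _ *m P]mulmxA.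
by rewrite x_neg_conj mulmxA x_pos_conj scaleNr !mulmxA.
Qed.

(** For node 4 the factors of [coroot_elt] do not preserve the plane one by one. The columns 2 of
    [plane] and of [C] carry the two-dimensional representation of sl_2 spanned by the basis vectors
    2 and 3, and [D] projects to column 2. Computing [W] there shows that the coroot acts on the
    plane as the diagonal matrix with entries [1, 1, t]. *)
Lemma coroot_plane i t : t != 0 -> preserves_plane (coroot_elt rho tau i t).
Proof.
move=> t0; have [->|i4] := eqVneq i node4; last first.
  by do !apply: preserves_planeM; try exact: x_pos_plane; exact: x_neg_plane.
pose D : 'M[L]_3 := delta_mx c2 c2; pose C := lower_mx L 3 *m plane.
have lC : lower_mx L 3 *m C = 0 by rewrite mulmxA lower_mx_sq // mul0mx.
have D2 : D *m D = D by rewrite mul_delta_mx.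
have CD : C *m D = C.
  rewrite /C lower3_plane; apply/matrixP => a b; rewrite mxE (bigD1 c2) //= big1 ?addr0.
    by rewrite !mxE /= eqxx andbT; case: (_ == 3); rewrite ?mul0r // mul1r -val_eqE.
  by move=> k k2; rewrite [D k b]mxE (negPf k2) mulr0.
have rC : raise_mx L 3 *m C = plane *m D.
  have := raise_lower_comm L (isT : 3 < 6)%N (isT : 3 < 6)%N; rewrite eqxx => /eqP.
  rewrite subr_eq => /eqP E.
  rewrite /C mulmxA E mulmxDl -[_ *m raise_mx L 3 *m plane]mulmxA raise3_plane.
  rewrite mulmx0 addr0; apply/matrixP => a b; rewrite mul_plane plane_mul.
  rewrite diagzE; case: insubP => [j _ ja|a3].
    have -> : a = wid j by apply: val_inj; rewrite /= ja.
    have wE : e6_weight 3 (wid j) = (j == c2)%:Z by case: (ord3P j) => ->.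
    rewrite wE mxE; have -> : (wid j == wid b) = (j == b) by [].
    by case: (eqVneq j b) => [<-|jb]; case: (eqVneq j c2) => [jE|]; rewrite ?mulr0n //;
      rewrite jE in jb; rewrite [b == _]eq_sym (negPf jb).
  case: eqP => [ab|]; last by rewrite mulr0n.
  by rewrite ab (ltn_ord b) in a3.
pose W s := (1%:M + s *: raise_mx L 3) *m (1%:M - s^-1 *: lower_mx L 3) *m
  (1%:M + s *: raise_mx L 3).
have WX s : s != 0 -> W s *m plane = plane - s^-1 *: C - plane *m D.
  move=> s0; rewrite /W -!mulmxA [(_ + _) *m plane]mulmxDl mul1mx -scalemxAl.
  rewrite raise3_plane scaler0 addr0 [(_ - _) *m plane]mulmxBl mul1mx -scalemxAl -/C.
  rewrite mulmxDl mul1mx -scalemxAl mulmxBr raise3_plane sub0r -scalemxAr rC.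
  by rewrite scalerN scalerA mulfV // scale1r.
have WC s : s != 0 -> W s *m C = s *: (plane *m D).
  move=> s0; rewrite /W -!mulmxA [(_ + _) *m C]mulmxDl mul1mx -scalemxAl rC.
  rewrite mulmxBl mul1mx -scalemxAl [lower_mx L 3 *m _]mulmxDr lC add0r.
  rewrite -scalemxAr mulmxA -/C CD scalerA mulVf // scale1r addrAC subrr add0r.
  rewrite mulmxDl mul1mx -scalemxAl -scalemxAr mulmxA raise3_plane mul0mx.
  by rewrite !scaler0 addr0.
have WP s : (weyl_elt rho tau node4 s).1 *m P = P *m W s.
  by rewrite weyl_conj node4E.
move: C lC CD rC W WX WC WP => C lC CD rC W WX WC WP.
exists (1%:M - D + t *: D).
rewrite /coroot_elt fst_mul mulmxA -[_ *m _ *m P]mulmxA WP mulmxA WP.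
rewrite -!mulmxA; congr (_ *m _); rewrite WX ?oppr_eq0 ?oner_eq0 //.
rewrite invrN1 scaleN1r opprK mulmxBr [W t *m (_ + _)]mulmxDr mulmxA WX // WC //.
rewrite !mulmxBl -!scalemxAl CD -[plane *m D *m D]mulmxA D2.
rewrite mulmxDr mulmxBr mulmx1 -scalemxAr.
rewrite [plane *m D - _ - _]addrAC subrr sub0r opprK.
by rewrite [_ - t^-1 *: C - _]addrAC [_ - t^-1 *: C + _]addrAC subrK.
Qed.

Lemma levi_plane l : levi rho tau node4 l -> preserves_plane l.
Proof.
elim=> [|x g xg _ IH].
  by exists 1%:M; rewrite mulmx1 mul1mx.
apply: preserves_planeM => //.
case: xg => [[i [t [t0 ->]]]|[i [t [i4 [->|->]]]]].
- exact: coroot_plane.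
- exact: x_pos_plane.
- exact: x_neg_plane.
Qed.

Lemma P_plane0 : P *m plane *m delta_mx 0 0 = v.
Proof.
rewrite -mulmxA -Pv; congr (_ *m _); rewrite -colE; apply/matrixP => i j.
by rewrite ord1 !mxE andbT.
Qed.

Lemma levi_span_plane (u : 'cV[L]_27) : levi_span rho tau node4 v u ->
  exists y : 'cV_3, u = P *m plane *m y.
Proof.
pose U := limg (linfun (mulmx (P *m plane) : 'cV_3 -> 'cV_27)).
move=> lsp; have /memv_imgP[y _ ->] : u \in U; last by exists y; rewrite lfunE.
apply: lsp => l /levi_plane[B lB]; rewrite -P_plane0 mulmxA lB -mulmxA.
have := memv_img (linfun (mulmx (P *m plane) : 'cV_3 -> 'cV_27))
  (memvf (B *m delta_mx 0 0)).
by rewrite lfunE.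
Qed.

(** In the model coordinates, the identity, [x_neg] of node 1, and [x_neg] of node 3 after it send
    the top vector to [e_0], [e_0 + e_1] and [e_0 + e_1 + e_2]; differences of these give a basis of
    the plane. *)
Lemma plane_levi_span (y : 'cV[L]_3) : levi_span rho tau node4 v (P *m plane *m y).
Proof.
move=> U lU; have W0 : P *m plane *m delta_mx 0 0 \in U.
  by rewrite P_plane0 -[v]mul1mx; apply: (lU 1); apply: gen_one.
have node_neq4 i (i6 : (i < 6)%N) : i != 3%N -> Ordinal i6 != node4.
  by rewrite -val_eqE /= node4E.
have gen_neg i (i6 : (i < 6)%N) g : i != 3%N -> levi rho tau node4 g ->
    levi rho tau node4 (x_neg rho tau (Ordinal i6) 1 * g).
  move=> i3 lg; apply: gen_mul => //; right; exists (Ordinal i6), 1.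
  by split; [apply: node_neq4 | right].
pose n0 := Ordinal (isT : 0 < 6)%N; pose n2 := Ordinal (isT : 2 < 6)%N.
have l0 : levi rho tau node4 (x_neg rho tau n0 1 * 1).
  by apply: gen_neg => //; apply: gen_one.
have l2 := gen_neg 2%N isT _ isT l0.
have F0 : lower_mx L 0 *m plane = plane *m delta_mx c1 c0.
  rewrite lower0_plane; apply/matrixP => a b; rewrite plane_mul mxE.
  case: insubP => [j _ ja|a3]; last by case: eqP => // a1; rewrite a1 in a3.
  by rewrite mxE -ja -!val_eqE.
have F2 : lower_mx L 2 *m plane = plane *m delta_mx c2 c1.
  rewrite lower2_plane; apply/matrixP => a b; rewrite plane_mul mxE.
  case: insubP => [j _ ja|a3]; last by case: eqP => // a1; rewrite a1 in a3.
  by rewrite mxE -ja -!val_eqE.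
have lE g B z : levi rho tau node4 g -> g.1 *m (P *m plane) = P *m plane *m B ->
    B *m delta_mx 0 0 = z -> P *m plane *m z \in U.
  move=> lg gB <-; rewrite mulmxA -gB -mulmxA P_plane0; exact: lU.
have neg_plane i (i6 : (i < 6)%N) D : lower_mx L i *m plane = plane *m D ->
    (x_neg rho tau (Ordinal i6) 1).1 *m (P *m plane) = P *m plane *m (1%:M + D).
  move=> iD; rewrite mulmxA x_neg_conj scale1r -!mulmxA; congr (_ *m _).
  by rewrite mulmxDl mulmxDr mul1mx mulmx1 iD.
have W1 : P *m plane *m (delta_mx c0 0 + delta_mx c1 0) \in U.
  apply: (lE _ _ _ l0); first by rewrite fst_mul mulmx1; apply: neg_plane F0.
  by rewrite mulmxDl mul1mx mul_delta_mx.
have W2 : P *m plane *m (delta_mx c0 0 + delta_mx c1 0 + delta_mx c2 0) \in U.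
  apply: (lE _ ((1%:M + delta_mx c2 c1) *m (1%:M + delta_mx c1 c0)) _ l2).
    rewrite fst_mul -mulmxA fst_mul mulmx1 (neg_plane _ _ _ F0) mulmxA.
    by rewrite (neg_plane _ _ _ F2) !mulmxA.
  rewrite -mulmxA [_ *m delta_mx 0 0]mulmxDl mul1mx mul_delta_mx.
  by rewrite mulmxDl mul1mx mulmxDr mul_delta_mx mul_delta_mx_0 // add0r.
have Wy (z : 'cV[L]_3) : z = z c0 0 *: delta_mx c0 0 + z c1 0 *: delta_mx c1 0 +
    z c2 0 *: delta_mx c2 0.
  apply/matrixP => a b; rewrite ord1 !mxE.
  by case: (ord3P a) => ->; rewrite /= ?(mulr1, mulr0, addr0, add0r).
have U1 : P *m plane *m delta_mx c1 0 \in U.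
  have -> : delta_mx c1 0 = delta_mx c0 0 + delta_mx c1 0 - delta_mx c0 0 :> 'cV[L]_3.
    by rewrite addrAC subrr add0r.
  by rewrite mulmxBr; apply: rpredB.
have U2 : P *m plane *m delta_mx c2 0 \in U.
  have -> : delta_mx c2 0 = delta_mx c0 0 + delta_mx c1 0 + delta_mx c2 0 -
      (delta_mx c0 0 + delta_mx c1 0) :> 'cV[L]_3.
    by rewrite addrAC subrr add0r.
  by rewrite mulmxBr; apply: rpredB.
by rewrite [y]Wy !mulmxDr -!scalemxAr !rpredD // rpredZ.
Qed.

Lemma Y_plane (B : 'M_3) : Y (P *m (plane *m B)).
Proof.
apply/Y_pointsP; exists 1; first exact: gen_one.
move=> a; exists (P *m plane *m (B *m a)); split; first exact: plane_levi_span.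
by rewrite mul1mx !mulmxA.
Qed.

(** Induction on words in the generators. A generator [1 + t A] sends a quadric to itself plus a
    multiple of another one, because the term in [t^2] vanishes. *)
Lemma group_quadric g : e6_group rho tau g ->
  exists2 G, g.1 *m P = P *m G & forall k, (k < 27)%N -> exists c : 'I_27 -> L,
    G^T *m quadric_mx L k *m G = \sum_(k' < 27) c k' *: quadric_mx L k'.
Proof.
elim=> [|x g' xg _ [G g'G GQ]].
  exists 1%:M; first by rewrite mulmx1 mul1mx.
  move=> k k27; exists (fun k' => (k' == Ordinal k27)%:R).
  rewrite (bigD1 (Ordinal k27)) //= eqxx scale1r big1 ?addr0.
    by rewrite trmx1 mul1mx mulmx1.
  by move=> k' /negPf ->; rewrite scale0r.
have step A (i : 'I_6) t : A = raise_mx L i \/ A = lower_mx L i ->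
    x.1 *m P = P *m (1%:M + t *: A) ->
    exists2 G, (x * g').1 *m P = P *m G & forall k, (k < 27)%N -> exists c : 'I_27 -> L,
    G^T *m quadric_mx L k *m G = \sum_(k' < 27) c k' *: quadric_mx L k'.
  move=> AE xA; exists ((1%:M + t *: A) *m G).
    by rewrite fst_mul -mulmxA g'G [LHS]mulmxA xA mulmxA.
  move=> k k27.
  have AE' : A^T = raise_mx L i \/ A^T = lower_mx L i.
    by case: AE => ->; [right; rewrite lower_mxE | left; rewrite raise_mxE].
  have [+ [c [k' [k'27]]]] := act_quadric (ltn_ord i) k27 AE'.
  rewrite trmxK => A2 A1; have [ck ckE] := GQ k k27; have [ck' ckE'] := GQ k' k'27.
  exists (fun j => ck j + t * c * ck' j).
  have E : (1%:M + t *: A)^T *m quadric_mx L k *m (1%:M + t *: A) =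
      quadric_mx L k + (t * c) *: quadric_mx L k'.
    have -> : (1%:M + t *: A)^T = 1%:M + t *: A^T.
      by rewrite linearD linearZ /= trmx1.
    rewrite mulmxDl mul1mx -scalemxAl mulmxDr mulmx1 -scalemxAr mulmxDl -scalemxAl.
    by rewrite A2 scaler0 addr0 -addrA -scalerDr A1 scalerA.
  have -> : ((1%:M + t *: A) *m G)^T *m quadric_mx L k *m ((1%:M + t *: A) *m G) =
      G^T *m ((1%:M + t *: A)^T *m quadric_mx L k *m (1%:M + t *: A)) *m G.
    by rewrite trmx_mul !mulmxA.
  rewrite E mulmxDr mulmxDl ckE -scalemxAr -scalemxAl ckE' scaler_sumr -big_split.
  by apply: eq_bigr => j _; rewrite scalerA scalerDl.
case: xg => [i [t [xE|xE]]].
  by apply: (step (raise_mx L i) i t); [left | rewrite xE; apply: x_pos_conj].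
by apply: (step (lower_mx L i) i t); [right | rewrite xE; apply: x_neg_conj].
Qed.

Lemma plane_quadric k : (k < 27)%N -> plane^T *m quadric_mx L k *m plane = 0.
Proof.
move=> k27; apply/matrixP => i j; rewrite mul_plane mxE [RHS]mxE big1 // => a _.
rewrite !mxE; case: eqP => [ai|]; last by rewrite mul0r.
have a3 : (a < 3)%N by rewrite ai (ltn_ord i).
have w3 : (wid j < 3)%N := ltn_ord j.
by rewrite quadric_mx_top // mulr0.
Qed.

(** A point of [Y] is a translate of a map into the top plane. The translation turns a quadric into
    a combination of quadrics, all of which vanish on that plane. *)
Lemma Y_quadric psi k : Y (P *m psi) -> (k < 27)%N ->
  psi^T *m quadric_mx L k *m psi = 0.
Proof.
move=> /Y_pointsP[g /group_quadric[G gG GQ] ga] k27.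
have ex (j : 'I_3) : exists y : 'cV_3, psi *m delta_mx j 0 = G *m plane *m y.
  have [u [/levi_span_plane[y ->]]] := ga (delta_mx j 0).
  rewrite -!mulmxA [g.1 *m _]mulmxA gG -!mulmxA => /(can_inj (mulKmx Pu)) ->.
  by exists y; rewrite !mulmxA.
have [y yE] := fin_all_exists ex.
have psiE : psi = G *m plane *m \matrix_(i < 3, j < 3) y j i 0.
  apply/matrixP => a j; transitivity ((psi *m (delta_mx j 0 : 'cV_3)) a 0).
    by rewrite -colE mxE.
  by rewrite yE !mxE; apply: eq_bigr => i _; rewrite mxE.
have [c cE] := GQ k k27; rewrite psiE !trmx_mul.
move: (\matrix_(_, _) _) => Z.
have -> : Z^T *m (plane^T *m G^T) *m quadric_mx L k *m (G *m plane *m Z) =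
   Z^T *m (plane^T *m (G^T *m quadric_mx L k *m G) *m plane) *m Z.
  by rewrite !mulmxA.
rewrite cE mulmx_sumr mulmx_suml big1 ?mulmx0 ?mul0mx // => k' _.
by rewrite -scalemxAr -scalemxAl plane_quadric // scaler0.
Qed.

End Points.

(** * The ideal of Y *)

Section Evaluation.
Variables (K L : fieldType) (iota : {rmorphism K -> L}).
Local Notation idx := (@mxvec_index 27 3).
Implicit Types (psi phi : 'M[L]_(27, 3)) (p : {mpoly K[27 * 3]}).

Lemma map_sp_mx l : map_mx iota (sp_mx K 27 l) = sp_mx L 27 l.
Proof. by apply/matrixP => i j; rewrite mxE !sp_mxE rmorph_int. Qed.

Lemma eval_mvar psi a j : eval_hom iota psi (mvar K a j) = psi a j.
Proof. by rewrite /eval_hom mmapX mmap1U mxvecE. Qed.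

Lemma eval_linform_lmul psi A a j :
  eval_hom iota psi (linform (lmul 3 A) (idx a j)) =
    ((map_mx iota A)^T *m psi) a j.
Proof.
rewrite linform_lmul /eval_hom raddf_sum mxE; apply: eq_bigr => c _ /=.
by rewrite mmapZ [mmap _ _ _]eval_mvar !mxE.
Qed.

Lemma eval_linform_rmul psi B a j :
  eval_hom iota psi (linform (rmul 27 B) (idx a j)) =
    (psi *m map_mx iota B) a j.
Proof.
rewrite linform_rmul /eval_hom raddf_sum mxE; apply: eq_bigr => c _ /=.
by rewrite mmapZ [mmap _ _ _]eval_mvar !mxE mulrC.
Qed.

Lemma eval_bilform psi i j k :
  eval_hom iota psi (bilform i j (quadric_mx K k)) =
    (psi^T *m quadric_mx L k *m psi) i j.
Proof.
rewrite bilformE /eval_hom raddf_sum -mulmxA mxE; apply: eq_bigr => a _ /=.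
rewrite raddf_sum !mxE mulr_sumr; apply: eq_bigr => b _ /=.
rewrite mmapZ rmorphM /= ![mmap _ _ (mvar _ _ _)]eval_mvar.
by rewrite /quadric_mx -map_sp_mx [map_mx _ _ a b]mxE mulrCA.
Qed.

Lemma eval_line psi phi p (M : 'M[K]_(27 * 3)) : [pchar K] =i pred0 ->
  (forall a j, eval_hom iota psi (linform M (idx a j)) = phi a j) ->
  (forall t, eval_hom iota (psi + t *: phi) p = 0) ->
  eval_hom iota psi (vfield M p) = 0.
Proof.
move=> charK0 My p0; apply: (vfield_line (y := fun k => mxvec phi 0 k)) => // [k|t].
  by case/mxvec_indexP: k => a j; rewrite mxvecE -My.
rewrite -[RHS](p0 t); apply: eq_mmap => k.
by rewrite linearD linearZ /= !mxE.
Qed.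

End Evaluation.

(** * Transport between the model and V *)

Section Main.
Variables (K : fieldType) (charK0 : [pchar K] =i pred0).
Variables (V : chev_ops K 27) (v : 'cV[K]_27) (m : nat) (V4 : chev_ops K m).
Variables (v4 : 'cV[K]_m) (P : 'M[K]_27).
Hypotheses (Pu : P \in unitmx) (Pv : P *m delta_mx 0 0 = v).
Hypothesis eP : forall i, ce V i *m P = P *m raise_mx K (i : 'I_6).
Hypothesis fP : forall i, cf V i *m P = P *m lower_mx K (i : 'I_6).

Local Notation S := {mpoly K[27 * 3]}.
Local Notation idx := (@mxvec_index 27 3).
Local Notation YL iota := (Y_points (base_change iota V) (base_change iota V4)
  (map_mx iota v) (map_mx iota v4)).

Section Extension.
Variables (L : fieldType) (iota : {rmorphism K -> L}).

Lemma PuL : map_mx iota P \in unitmx.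
Proof. by rewrite map_unitmx. Qed.

Lemma PvL : map_mx iota P *m delta_mx 0 0 = map_mx iota v.
Proof. by rewrite -Pv map_mxM map_delta_mx. Qed.

Lemma ePL i : ce (base_change iota V) i *m map_mx iota P =
  map_mx iota P *m raise_mx L (i : 'I_6).
Proof. by rewrite /= -map_mxM eP map_mxM map_sp_mx. Qed.

Lemma fPL i : cf (base_change iota V) i *m map_mx iota P =
  map_mx iota P *m lower_mx L (i : 'I_6).
Proof. by rewrite /= -map_mxM fP map_mxM map_sp_mx. Qed.

End Extension.

(* The ideal of [Y] in the coordinates of the minuscule model. *)
Definition model_ideal (p : S) : Prop :=
  forall (L : fieldType) (iota : {rmorphism K -> L}) (psi : 'M[L]_(27, 3)),
    YL iota (map_mx iota P *m psi) -> eval_hom iota psi p = 0.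

Lemma model_ideal_subspace : subspace model_ideal.
Proof.
split=> [L iota psi _|p q Jp Jq L iota psi Yp|c p Jp L iota psi Yp].
- by rewrite /eval_hom raddf0.
- by rewrite /eval_hom raddfD /= [mmap _ _ p]Jp // [mmap _ _ q]Jq // addr0.
- by rewrite /eval_hom mmapZ [mmap _ _ p]Jp // mulr0.
Qed.

(** Fields act on points through the transpose: the raising field is the derivative along the
    lowering root subgroup, whose orbits [(1 + t F) psi] are lines. *)
Lemma model_ideal_raise i : (i < 6)%N -> stable model_ideal (lmul 3 (raise_mx K i)).
Proof.
move=> i6 p Jp L iota psi Yp.
apply: (eval_line (phi := lower_mx L i *m psi)) => // [a j|t].
  by rewrite eval_linform_lmul map_sp_mx -lower_mxE.
apply: Jp; have := @Y_lower L m _ _ _ _ _ (PuL iota) (fPL iota) (Ordinal i6) t psi Yp.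
by rewrite mulmxDl mul1mx -scalemxAl.
Qed.

Lemma model_ideal_lower i : (i < 6)%N -> stable model_ideal (lmul 3 (lower_mx K i)).
Proof.
move=> i6 p Jp L iota psi Yp.
apply: (eval_line (phi := raise_mx L i *m psi)) => // [a j|t].
  by rewrite eval_linform_lmul map_sp_mx -raise_mxE.
apply: Jp; have := @Y_raise L m _ _ _ _ _ (PuL iota) (ePL iota) (Ordinal i6) t psi Yp.
by rewrite mulmxDl mul1mx -scalemxAl.
Qed.

Lemma model_ideal_egl i j : stable model_ideal (egl K 27 i j).
Proof.
move=> p Jp L iota psi Yp.
apply: (eval_line (phi := psi *m delta_mx i j)) => // [a k|t].
  by rewrite eval_linform_rmul map_delta_mx.
(* The matrix [1 + t E_ij] can be singular when [i = j], but a fibre of [Hom(E, R_3)] is closed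
   under composition with every endomorphism of [E]. *)
apply: Jp; have := Y_mulr (1%:M + t *: delta_mx i j) Yp.
by rewrite -mulmxA mulmxDr mulmx1 -scalemxAr.
Qed.

(* Evaluation at the generic point of the fibre over the base point. *)
Lemma model_ideal_top p : model_ideal p ->
  (forall m, m \in msupp p -> forall (a : 'I_27) j, (2 < a)%N -> m (idx a j) = 0%N) ->
  p = 0.
Proof.
move=> Jp ptop; pose L := {fraction S}.
pose iota : {rmorphism K -> L} := (@tofrac S) \o (@mpolyC (27 * 3) K).
pose B : 'M[L]_3 := \matrix_(i, j) tofrac (mvar K (wid i) j).
have := Jp L iota (plane L *m B)
  (Y_plane _ _ (PuL iota) (PvL iota) (@fPL L iota) B).
suff -> : eval_hom iota (plane L *m B) p = tofrac p.
  by move/eqP; rewrite tofrac_eq0 => /eqP.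
rewrite /eval_hom /mmap [in RHS](mpolyE p) raddf_sum big_seq [RHS]big_seq /=.
apply: eq_bigr => n np; rewrite -mul_mpolyC rmorphM /=; congr (_ * _).
rewrite mpolyXE_id rmorph_prod /mmap1; apply: eq_bigr => k _.
rewrite rmorphXn /=; case/mxvec_indexP: k => a j; rewrite mxvecE plane_mul.
(* The rows from 3 on are zero at the generic point, but their variables only occur with exponent
   0. *)
case: insubP => [i _ ia|a3]; last first.
  by rewrite (ptop n np a j) ?expr0 // ltnNge -ltnS.
rewrite mxE; congr (tofrac (mvar _ _ _) ^+ _).
exact: val_inj.
Qed.

Definition subst (A : 'M[K]_27) (p : S) : S :=
  mmap (@mpolyC (27 * 3) K) (linform (lmul 3 A)) p.

Lemma eval_subst (L : fieldType) (iota : {rmorphism K -> L}) psi A p :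
  eval_hom iota psi (subst A p) = eval_hom iota ((map_mx iota A)^T *m psi) p.
Proof.
rewrite /eval_hom /subst mmap_subst; apply: eq_mmap => k.
case/mxvec_indexP: k => a j; rewrite mxvecE -eval_linform_lmul.
by [].
Qed.

Lemma subst_mul A B p : subst A (subst B p) = subst (A *m B) p.
Proof.
rewrite /subst.
elim/mpoly_ring_ind: p => [c|k|p q IHp IHq|p q IHp IHq].
- by rewrite !mmapC.
- rewrite !mmapX !mmap1U; case/mxvec_indexP: k => a j.
  rewrite linform_lmul raddf_sum /=.
  under eq_bigr => c _ do
    rewrite mmapZ mmapX mmap1U mul_mpolyC linform_lmul scaler_sumr.
  rewrite exchange_big linform_lmul; apply: eq_bigr => d _ /=.
  by rewrite mxE scaler_suml; apply: eq_bigr => c _; rewrite scalerA mulrC.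
- by rewrite !raddfD /= IHp IHq.
- by rewrite !rmorphM /= IHp IHq.
Qed.

Lemma subst1 p : subst 1%:M p = p.
Proof.
rewrite /subst; elim/mpoly_ring_ind: p => [c|k|p q IHp IHq|p q IHp IHq].
- by rewrite mmapC.
- by rewrite mmapX mmap1U; case/mxvec_indexP: k => a j; rewrite linform_lmul1.
- by rewrite raddfD /= IHp IHq.
- by rewrite rmorphM /= IHp IHq.
Qed.

Lemma linform_homog n (M : 'M[K]_n) k : linform M k \is 1.-homog.
Proof.
apply: rpred_sum => l _; apply: dhomogZ.
by rewrite dhomogX /= mdeg1.
Qed.

Lemma subst_bilform_homog A i j T : subst A (bilform i j T) \is 2.-homog.
Proof.
rewrite /subst bilformE raddf_sum; apply: rpred_sum => a _ /=.
rewrite raddf_sum; apply: rpred_sum => b _ /=.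
rewrite mmapZ mul_mpolyC rmorphM /= !mmapX !mmap1U; apply: dhomogZ.
by apply: (dhomogM (d := 1) (e := 1)); apply: linform_homog.
Qed.

Lemma ideal_Y_model p : ideal_Y V V4 v v4 p -> model_ideal (subst P^T p).
Proof.
move=> Ip L iota psi Yp; rewrite eval_subst map_trmx trmxK.
exact: Ip.
Qed.

Lemma ideal_Y_generated_by_quadrics : generated_by_quadrics (ideal_Y V V4 v v4).
Proof.
(* Substituting [P^T] passes to the coordinates of the model and [Q] passes back. As linear changes
   of variables they keep quadrics homogeneous of degree 2. *)
pose Q := (invmx P)^T; have QP : Q *m P^T = 1%:M.
  by rewrite -trmx_mul mulmxV // trmx1.
exists [seq subst Q q | q <- quadrics K]; split.
  apply/allP => _ /mapP[_ /allpairsP[[k [i j]] [_ _ ->]] ->] /=.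
  exact: subst_bilform_homog.
move=> p; split=> [Ip|[c ->] L iota phi Yphi].
  have [c pE] : in_ideal (quadrics K) (subst P^T p).
    apply: (vanishing_in_quadrics charK0 model_ideal_subspace) (ideal_Y_model Ip).
    - exact: model_ideal_raise.
    - exact: model_ideal_lower.
    - exact: model_ideal_egl.
    - exact: model_ideal_top.
  have -> : p = subst Q (subst P^T p) by rewrite subst_mul QP subst1.
  rewrite {1}pE /subst raddf_sum /=.
  have szE : size [seq subst Q q | q <- quadrics K] = size (quadrics K).
    by rewrite size_map.
  exists (fun i => subst Q (c (cast_ord szE i))).
  rewrite (reindex (cast_ord szE)); last first.
    by exists (cast_ord (esym szE)) => i _; rewrite (cast_ordK, cast_ordKV).
  apply: eq_bigr => i _; rewrite rmorphM /=; congr (_ * _).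
  by rewrite (nth_map 0) // -szE.
rewrite /eval_hom raddf_sum big1 //= => i _; rewrite rmorphM /=.
suff -> : mmap iota (fun k => mxvec phi 0 k) [seq subst Q q | q <- quadrics K]`_i = 0.
  by rewrite mulr0.
have /mapP[_ /allpairsP[[k [a b]] [/= ki _ ->]] ->] := mem_nth 0 (ltn_ord i).
have k27 : (k < 27)%N by move: ki; rewrite mem_iota.
rewrite -[LHS]/(eval_hom iota phi _) eval_subst eval_bilform map_trmx trmxK.
set psi := _ *m phi.
have psiE : map_mx iota P *m psi = phi.
  by rewrite /psi mulmxA -map_mxM mulmxV // map_mx1 mul1mx.
have Ypsi : YL iota (map_mx iota P *m psi) by rewrite psiE.
by rewrite (Y_quadric (PuL iota) (PvL iota) (@ePL L iota) (@fPL L iota) Ypsi) ?mxE.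
Qed.

End Main.

Theorem theorem7p9 (K : fieldType) (charK0 : [pchar K] =i pred0)
  (V : chev_ops K 27) (v : 'cV[K]_27)
  (hV : irrep_of_highest_weight V (fund_weight node1) v)
  (m : nat) (V4 : chev_ops K m) (v4 : 'cV[K]_m)
  (hV4 : irrep_of_highest_weight V4 (fund_weight node4) v4) :
  generated_by_quadrics (ideal_Y V V4 v v4).
Proof.
have [P [Pu Pv eP fP]] := model_iso charK0 hV.
exact: ideal_Y_generated_by_quadrics Pu Pv eP fP.
Qed.
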